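(* Let $\alpha,\beta$ be real parameters, $l_0\ge 1$ an integer and $j_0\in\{1,2,3,4\}$, such that the polynomial whose square appears in the denominator of the weight function $w^{(j_0,l_0)}$ has no zeros on the unit circle. Then the four types of exceptional Hendriksen-van Rossum polynomials $P^{(j_0,l_0,n)}$ and their partners $Q^{(j_0,l_0,n)}$ satisfy the biorthogonality relations $$\frac{1}{2\pi}\int_0^{2\pi} w^{(j_0,l_0)}(e^{ix})\,P^{(j_0,l_0,m)}(e^{ix})\,Q^{(j_0,l_0,n)}(e^{-ix})\,dx = h_n^{(j_0,l_0)}\,\delta_{mn}$$ for $m,n\in\mathcal I_{j_0}$, where $\mathcal I_1=\{0,1,2,\ldots\}\setminus\{l_0\}$, $\mathcal I_2=\mathcal I_3=\{0,1,2,\ldots\}$, $\mathcal I_4=\{-l_0-1,0,1,2,\ldots\}$, with $$h^{(j_0,l_0)}_n=\begin{cases}-(n+\beta)(n-l_0)h_n, & j_0=1\ (n\ne l_0),\\ -(n+\beta)(n-l_0+\alpha+\beta)h_n, & j_0=2,\\ -(n+\beta)(n+l_0+1+\alpha+\beta)h_n, & j_0=3,\\ -(n+\beta)(n+l_0+1)h_n, & j_0=4\ (n\neq -l_0-1),\end{cases}$$ where $$h_n=\frac{(\alpha+n+1)_\infty(\beta+n+1)_\infty}{(n+1)_\infty(\alpha+\beta+n+1)_\infty}.$$ (For $j_0=4$ and $n=-l_0-1$ the constant is not given by this formula.)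
   Context: Pochhammer symbol: $(a)_0=1$, $(a)_n=a(a+1)\cdots(a+n-1)$; the ratio of infinite Pochhammer symbols in $h_n$ is read as the convergent product $\prod_{k\ge0}\frac{(\alpha+n+1+k)(\beta+n+1+k)}{(n+1+k)(\alpha+\beta+n+1+k)}$. Hendriksen-van Rossum (HR) polynomials: $P_n(z;a,b)=\frac{(b)_n}{(a+1)_n}\,{}_2F_1(-n,a+1;1-b-n;z)$. Write $P_n(z)=P_n(z;\alpha,\beta)$. The parameters are taken such that the expressions below are defined; terms with a factor $n$ are zero when $n=0$. For $n\ge 0$, $l_0\geq 1$ the exceptional HR polynomials $P^{(j_0,l_0,n)}(z)=P^{(j_0,l_0,n)}(z;\alpha,\beta)$ are $$P^{(1,l_0,n)}(z)=nP_{l_0}(z)P_{n-1}(z;\alpha+1,\beta)-l_0P_{l_0-1}(z;\alpha+1,\beta)P_n(z),$$ $$P^{(2,l_0,n)}(z)=(1-z)\big[nP_{l_0}(z;-\beta,-\alpha)P_{n-1}(z;\alpha+1,\beta)-l_0P_{l_0-1}(z;1-\beta,-\alpha)P_n(z)\big]-(\alpha+\beta)P_{l_0}(z;-\beta,-\alpha)P_n(z),$$ $$P^{(3,l_0,n)}(z)=\tfrac{(\beta)_{l_0}}{(\alpha+1)_{l_0}}\Big[nzP_{l_0}(z;\beta-1,\alpha+1)P_{n-1}(z;\alpha+1,\beta)+\tfrac{(\alpha+1)l_0}{\beta+l_0-1}P_{l_0-1}(z;\beta-1,\alpha+2)P_n(z)+(1+\alpha)P_{l_0}(z;\beta-1,\alpha+1)P_n(z)\Big],$$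 $$P^{(4,l_0,n)}(z)=\tfrac{(-\alpha)_{l_0}}{(-\beta+1)_{l_0}}\Big\{(z-1)\Big[nzP_{l_0}(z;-\alpha-1,-\beta+1)P_{n-1}(z;\alpha+1,\beta)+\tfrac{(-\beta+1)l_0}{-\alpha+l_0-1}P_{l_0-1}(z;-\alpha-1,-\beta+2)P_n(z)\Big]-(1-\beta-(1+\alpha)z)P_{l_0}(z;-\alpha-1,-\beta+1)P_n(z)\Big\}.$$ The partners are $Q^{(j_0,l_0,n)}(z)=P^{(j_0,l_0,n)}(z;\beta-1,\alpha+1)$, i.e. obtained by the simultaneous substitution $\alpha\to\beta-1$, $\beta\to\alpha+1$. In addition, by convention, $P^{(4,l_0,-l_0-1)}(z)=Q^{(4,l_0,-l_0-1)}(z)=1$. Let $w(z)=(-z)^{-\beta}(1-z)^{\alpha+\beta}$ with branches: $(-z)^{-\beta}=|z|^{-\beta}$ if $\arg z=\pi$ ($0<\arg z<2\pi$), and $(1-z)^{\alpha+\beta}=|1-z|^{\alpha+\beta}$ if $\arg(1-z)=0$ ($-\pi<\arg(1-z)<\pi$). The weight functions are $$w^{(1,l_0)}(z)=\frac{(\beta)_{l_0}}{(1+\alpha)_{l_0}}\frac{z^{l_0}(z-1)w(z)}{P_{l_0}(z)^2},\qquad w^{(2,l_0)}(z)=\frac{(-\alpha)_{l_0}}{(-\beta+1)_{l_0}}\frac{z^{1+l_0}w(z)}{(1-z)P_{l_0}(z;-\beta,-\alpha)^2},$$ $$w^{(3,l_0)}(z)=\frac{(1+\alpha)_{l_0}}{(\beta)_{l_0}}\frac{z^{l_0}(z-1)w(z)}{P_{l_0}(z;\beta-1,\alpha+1)^2},\qquad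 w^{(4,l_0)}(z)=\frac{(-\beta+1)_{l_0}}{(-\alpha)_{l_0}}\frac{z^{1+l_0}w(z)}{(1-z)P_{l_0}(z;-\alpha-1,-\beta+1)^2}.$$ *)

(* Defs.v *)
From Stdlib Require Import Reals ZArith.
From Coquelicot Require Import Coquelicot.

Open Scope R_scope.

Fixpoint poch (a : R) (n : nat) : R :=
  match n with
  | O => 1
  | S k => poch a k * (a + INR k)
  end.

(* The terminating series 2F1(-n, b; c; z), so only (c)_k with k <= n matters. *)
Definition hyp2F1_term (n : nat) (b c : R) (z : C) : C :=
  sum_n (fun k : nat =>
    (RtoC (poch (- INR n) k * poch b k / (poch c k * INR (fact k)))
     * Cpow z k)%C) n.

Definition HR (n : nat) (a b : R) (z : C) : C :=
  (RtoC (poch b n / poch (a + 1) n)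
   * hyp2F1_term n (a + 1) (1 - b - INR n) z)%C.

(* In the four definitions below n - 1 is truncated, which is harmless: it only
   occurs behind a factor n. The same holds for l - 1, as l >= 1. *)

Definition XHR1 (l n : nat) (al be : R) (z : C) : C :=
  (INR n * HR l al be z * HR (n - 1) (al + 1) be z
   - INR l * HR (l - 1) (al + 1) be z * HR n al be z)%C.

Definition XHR2 (l n : nat) (al be : R) (z : C) : C :=
  ((1 - z) * (INR n * HR l (- be) (- al) z * HR (n - 1) (al + 1) be z
              - INR l * HR (l - 1) (1 - be) (- al) z * HR n al be z)
   - RtoC (al + be) * HR l (- be) (- al) z * HR n al be z)%C.

Definition XHR3 (l n : nat) (al be : R) (z : C) : C :=
  (RtoC (poch be l / poch (al + 1) l)
   * (INR n * z * HR l (be - 1) (al + 1) z * HR (n - 1) (al + 1) be z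
      + RtoC ((al + 1) * INR l / (be + INR l - 1))
        * HR (l - 1) (be - 1) (al + 2) z * HR n al be z
      + RtoC (1 + al) * HR l (be - 1) (al + 1) z * HR n al be z))%C.

Definition XHR4 (l n : nat) (al be : R) (z : C) : C :=
  (RtoC (poch (- al) l / poch (- be + 1) l)
   * ((z - 1)
      * (INR n * z * HR l (- al - 1) (- be + 1) z * HR (n - 1) (al + 1) be z
         + RtoC ((- be + 1) * INR l / (- al + INR l - 1))
           * HR (l - 1) (- al - 1) (- be + 2) z * HR n al be z)
      - (RtoC (1 - be) - RtoC (1 + al) * z)
        * HR l (- al - 1) (- be + 1) z * HR n al be z))%C.

Inductive xtype : Set := X1 | X2 | X3 | X4.

Definition index (j : xtype) (l : nat) (n : Z) : Prop :=
  match j with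
  | X1 => (0 <= n)%Z /\ n <> Z.of_nat l
  | X2 | X3 => (0 <= n)%Z
  | X4 => (0 <= n)%Z \/ n = (- Z.of_nat l - 1)%Z
  end.

(* Only meant for n satisfying [index j l n]. *)
Definition XP (j : xtype) (l : nat) (n : Z) (al be : R) (z : C) : C :=
  match j with
  | X1 => XHR1 l (Z.to_nat n) al be z
  | X2 => XHR2 l (Z.to_nat n) al be z
  | X3 => XHR3 l (Z.to_nat n) al be z
  | X4 => if Z.eq_dec n (- Z.of_nat l - 1) then RtoC 1
          else XHR4 l (Z.to_nat n) al be z
  end.

Definition XQ (j : xtype) (l : nat) (n : Z) (al be : R) (z : C) : C :=
  XP j l n (be - 1) (al + 1) z.

(* Principal argument of a nonzero z, with values in ]-PI, PI]. *)
Definition Carg (z : C) : R :=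
  if Rlt_dec (Im z) 0 then - acos (Re z / Cmod z) else acos (Re z / Cmod z).

Definition cis (x : R) : C := (cos x, sin x).

Definition Cpowr (z : C) (s : R) : C :=
  (RtoC (Rpower (Cmod z) s) * cis (s * Carg z))%C.

(* 0 < arg z < 2 PI corresponds to -PI < arg (-z) < PI: both factors are
   principal powers. *)
Definition weight0 (al be : R) (z : C) : C :=
  (Cpowr (- z) (- be) * Cpowr (1 - z) (al + be))%C.

Definition denom (j : xtype) (l : nat) (al be : R) (z : C) : C :=
  match j with
  | X1 => HR l al be z
  | X2 => HR l (- be) (- al) z
  | X3 => HR l (be - 1) (al + 1) z
  | X4 => HR l (- al - 1) (- be + 1) z
  end.

Definition weight (j : xtype) (l : nat) (al be : R) (z : C) : C :=
  (match j with
   | X1 => RtoC (poch be l / poch (1 + al) l)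
           * (Cpow z l * (z - 1) * weight0 al be z)
   | X2 => RtoC (poch (- al) l / poch (- be + 1) l)
           * (Cpow z (1 + l) * weight0 al be z / (1 - z))
   | X3 => RtoC (poch (1 + al) l / poch be l)
           * (Cpow z l * (z - 1) * weight0 al be z)
   | X4 => RtoC (poch (- be + 1) l / poch (- al) l)
           * (Cpow z (1 + l) * weight0 al be z / (1 - z))
   end / Cpow (denom j l al be z) 2)%C.

Definition hbase (n : nat) (al be : R) : R :=
  real (Lim_seq (fun N : nat => prod_f_R0 (fun k : nat =>
    (al + INR n + 1 + INR k) * (be + INR n + 1 + INR k)
    / ((INR n + 1 + INR k) * (al + be + INR n + 1 + INR k))) N)).

Definition hX (j : xtype) (l n : nat) (al be : R) : R :=
  match j with
  | X1 => - (INR n + be) * (INR n - INR l) * hbase n al be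
  | X2 => - (INR n + be) * (INR n - INR l + al + be) * hbase n al be
  | X3 => - (INR n + be) * (INR n + INR l + 1 + al + be) * hbase n al be
  | X4 => - (INR n + be) * (INR n + INR l + 1) * hbase n al be
  end.

(* No denominator vanishes in the polynomials XP, XQ (for all indices), in the
   constants of the weight, or in hbase: (1-b-n)_k <> 0 for all k <= n amounts
   to (b)_n <> 0, and the parameters of the inner HR polynomials, of their
   partners and of the prefactors reduce to the ones below. *)
Definition params_defined (j : xtype) (l : nat) (al be : R) : Prop :=
  (forall n : nat,
      poch (al + 1) n <> 0 /\ poch be n <> 0 /\ poch (al + be + 1) n <> 0)
  /\ match j with
     | X1 | X3 => True
     | X2 | X4 => poch (- al) l <> 0 /\ poch (- be + 1) l <> 0
     end.

Definition integrand (j : xtype) (l : nat) (al be : R) (m n : Z) (x : R) : C :=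
  (weight j l al be (cis x) * XP j l m al be (cis x)
   * XQ j l n al be (cis (- x)))%C.

(* The integral over ]0, 2 PI[ is improper: the integrand may be singular at
   the endpoints, i.e. at z = 1. *)
Definition ex_integral (f : R -> C) : Prop :=
  ex_RInt_gen (V := C_R_CompleteNormedModule) f (at_right 0) (at_left (2 * PI)).

Definition integral (f : R -> C) : C :=
  RInt_gen (V := C_R_CompleteNormedModule) f (at_right 0) (at_left (2 * PI)).

(* Main.v *)
(** The weight [w] is, on the unit circle, the integrating factor of the
    generalized eigenvalue problem [L P_n = n M P_n] with
    [L = z(1-z) d^2 + (1-b-(a+2)z) d] and [M = (1-z) d - (a+1)], where [d = d/dz].
    Each of the four families comes from a solution [phi] (the seed) of
    [L phi = lam M phi]: up to elementary factors [P^(j,l,n)] is the Wronskian of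
    [phi] and [P_n], and, because [P_n(1/z; b-1, a+1)] is a multiple of
    [z^-n P_n(z; a, b)], the partner at [1/z] is the Wronskian of [z^-lam phi] and
    [z^-n P_n]. Hence the integrand is a multiple of [p u_m' v_n'] with
    [u_m = P_m / phi], [v_n = z^(lam-n) P_n / phi] and
    [(p u_m')' v_n] proportional to [(m - lam) w z^-n P_n M P_m]; one integration
    by parts removes the seed. For [m <> n] the remaining integrand is itself a
    derivative, and for [m = n] the contiguous relations lower [n], which leaves a
    multiple of [w] with exponent [a + b + 1] at [z = 1]. This works for
    [a + b > -2], where the classical biorthogonality integrals may diverge: the
    boundary terms then vanish because their coefficient is zero at [z = 1].
    The remaining Cauchy beta integral is found from the recurrence that raises
    the exponent by 2 and from the concentration of [|1 - z|^s] at [z = -1]. *)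

Require Import Defs.
From Stdlib Require Import Reals ZArith Lra Lia Psatz.
From Coquelicot Require Import Coquelicot.
Open Scope R_scope.
Set Bullet Behavior "Strict Subproofs".

(** * The Cauchy beta integral *)

(** The theorem puts no lower bound on [al + be]; a bound is extracted from the assumed convergence,
    and it depends on the type. A seed regular at z = 1 (types 1 and 3) gives only a + b > -2, a
    seed with the factor (1-z)^(-(a+b)) gives a + b >= 0 (type 2), and the additional constant
    polynomial of type 4 gives a + b > 0. For -2 < a + b < -1 the boundary terms of the two
    successive integrations need not vanish separately, so both are merged into one exact derivative
    and only the combined term is estimated. The one moment evaluated is that of the weight with a +
    1 for a, integrable in the whole range. The reductions are pointwise identities between rational
    expressions in z, the polynomials and their images under z d/dz; the differential equations
    eliminate second derivatives. The infinite product h_n is reached through finite products: N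
    steps of the recurrence split a partial product off the integral, and what remains has a
    computable limit, so convergence and value of the product come out together. *)

(* Improper integrals are expressed through an antiderivative with limits at
   both ends, so that exact integrands need no separate convergence proof. *)
Definition has_int (f : R -> R) (v : R) : Prop :=
  exists (G : R -> R) (l0 l1 : R),
    (forall x, 0 < x < 2 * PI -> is_derive G x (f x)) /\
    filterlim G (at_right 0) (locally l0) /\
    filterlim G (at_left (2 * PI)) (locally l1) /\ v = l1 - l0.

Lemma two_pi_pos : 0 < 2 * PI.
Proof. generalize PI_RGT_0; lra. Qed.

Lemma at_right_0_interval : at_right 0 (fun x => 0 < x < 2 * PI).
Proof.
  exists (mkposreal _ two_pi_pos); intros y Hy Hy0; simpl in *.
  unfold ball in Hy; simpl in Hy; unfold AbsRing_ball, abs, minus, plus, opp in Hy; simpl in Hy.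
  apply Rabs_def2 in Hy; lra.
Qed.

Lemma at_left_2pi_interval : at_left (2 * PI) (fun x => 0 < x < 2 * PI).
Proof.
  exists (mkposreal _ two_pi_pos); intros y Hy Hy0; simpl in *.
  unfold ball in Hy; simpl in Hy; unfold AbsRing_ball, abs, minus, plus, opp in Hy; simpl in Hy.
  apply Rabs_def2 in Hy; lra.
Qed.

Lemma has_int_ext (f g : R -> R) (v : R) :
  (forall x, 0 < x < 2 * PI -> f x = g x) -> has_int f v -> has_int g v.
Proof.
  intros E (G & l0 & l1 & HG & H0 & H1 & Hv).
  exists G, l0, l1; split; [ | auto].
  intros x Hx; rewrite <- (E x Hx); auto.
Qed.

Lemma has_int_lin (f g : R -> R) (v w c d : R) :
  has_int f v -> has_int g w -> has_int (fun x => c * f x + d * g x) (c * v + d * w).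
Proof.
  intros (F & l0 & l1 & HF & H0 & H1 & Hv) (G & k0 & k1 & HG & K0 & K1 & Hw).
  exists (fun x => c * F x + d * G x), (c * l0 + d * k0), (c * l1 + d * k1).
  assert (L : forall F0, Filter F0 -> forall l k, filterlim F F0 (locally l) ->
     filterlim G F0 (locally k) ->
     filterlim (fun x => c * F x + d * G x) F0 (locally (c * l + d * k))).
  { intros F0 FF l k Hl Hk.
    apply (filterlim_comp_2 (G := locally (c * l)) (H := locally (d * k))
             (fun x => c * F x) (fun x => d * G x) Rplus).
    - apply (filterlim_comp _ _ _ F (fun y => c * y) _ (locally l)); auto.
      apply (filterlim_scal_r (V := R_NormedModule) c l).
    - apply (filterlim_comp _ _ _ G (fun y => d * y) _ (locally k)); auto.
      apply (filterlim_scal_r (V := R_NormedModule) d k).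
    - apply (filterlim_plus (V := R_NormedModule) (c * l) (d * k)). }
  split; [ | split; [ | split]].
  - intros x Hx. apply (is_derive_plus (fun x => c * F x) (fun x => d * G x)).
    + apply is_derive_scal; auto.
    + apply is_derive_scal; auto.
  - apply L; auto; apply filter_filter.
  - apply L; auto; apply filter_filter.
  - subst; ring.
Qed.

Lemma has_int_unique (f : R -> R) (v w : R) : has_int f v -> has_int f w -> v = w.
Proof.
  intros Hv Hw.
  generalize (has_int_lin f f v w 1 (-1) Hv Hw); intros (H & l0 & l1 & HD & H0 & H1 & E).
  assert (K : forall x, 0 < x < 2 * PI -> H x = H PI).
  { assert (Z : forall t, 0 < t < 2 * PI -> is_derive H t zero).
    { intros t Ht; generalize (HD t Ht).
      replace (1 * f t + -1 * f t) with 0 by ring; auto. }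
    generalize PI_RGT_0; intros HP x Hx.
    destruct (Rtotal_order x PI) as [L | [-> | L]]; auto.
    - apply (eq_is_derive H x PI); auto; intros t Ht; apply Z; lra.
    - symmetry; apply (eq_is_derive H PI x); auto; intros t Ht; apply Z; lra. }
  assert (E0 : l0 = H PI).
  { apply (filterlim_locally_unique (F := at_right 0) H); auto.
    apply (filterlim_ext_loc (fun _ => H PI)); [ | apply filterlim_const].
    generalize at_right_0_interval; apply filter_imp; intros x Hx; symmetry; auto. }
  assert (E1 : l1 = H PI).
  { apply (filterlim_locally_unique (F := at_left (2 * PI)) H); auto.
    apply (filterlim_ext_loc (fun _ => H PI)); [ | apply filterlim_const].
    generalize at_left_2pi_interval; apply filter_imp; intros x Hx; symmetry; auto. }
  lra.
Qed.

Lemma has_int_RInt (f g : R -> R) :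
  (forall x, continuous g x) -> (forall x, 0 < x < 2 * PI -> f x = g x) ->
  ex_RInt f 0 (2 * PI) /\ has_int f (RInt f 0 (2 * PI)).
Proof.
  intros Hc E.
  assert (Eg : forall x, ex_RInt g 0 x) by (intros; apply (ex_RInt_continuous (V := R_CompleteNormedModule)); auto).
  generalize two_pi_pos; intros HP.
  split.
  - apply (ex_RInt_ext g); [ | apply Eg].
    intros x; rewrite Rmin_left, Rmax_right by lra; intros; symmetry; auto.
  - rewrite (RInt_ext f g) by (rewrite Rmin_left, Rmax_right by lra; auto).
    apply (has_int_ext g); [intros; symmetry; auto | ].
    assert (D : forall x, is_derive (RInt g 0) x (g x)).
    { intros x; apply (is_derive_RInt g (RInt g 0) 0 x); auto.
      apply filter_forall; intros y; apply (RInt_correct (V := R_CompleteNormedModule)); apply Eg. }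
    assert (C : forall x, continuous (RInt g 0) x).
    { intros x; apply (ex_derive_continuous (RInt g 0)); exists (g x); auto. }
    exists (RInt g 0), (RInt g 0 0), (RInt g 0 (2 * PI)); split; [auto | split; [ | split]].
    + eapply filterlim_filter_le_1; [ | apply (C 0)]. apply filter_le_within.
    + eapply filterlim_filter_le_1; [ | apply (C (2 * PI))]. apply filter_le_within.
    + rewrite RInt_point; unfold zero; simpl. symmetry; apply Rminus_0_r.
Qed.

(* The modulus of [1 - cis x]. *)
Definition chord (x : R) : R := 2 * sin (x / 2).

Lemma chord_pos x : 0 < x < 2 * PI -> 0 < chord x.
Proof. intros H; unfold chord; assert (0 < sin (x / 2)) by (apply sin_gt_0; lra); lra. Qed.

Lemma chord_le_2 x : chord x <= 2.
Proof. unfold chord; generalize (SIN_bound (x / 2)); lra. Qed.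

Lemma continuous_chord x : continuous chord x.
Proof. apply (ex_derive_continuous chord). unfold chord; auto_derive; auto. Qed.

Lemma chord_0 : chord 0 = 0.
Proof. unfold chord; replace (0 / 2) with 0 by field; rewrite sin_0; ring. Qed.

Lemma chord_2pi : chord (2 * PI) = 0.
Proof. unfold chord; replace (2 * PI / 2) with PI by field; rewrite sin_PI; ring. Qed.

Lemma chord_at_right : filterlim chord (at_right 0) (at_right 0).
Proof.
  intros P HP. unfold filtermap.
  assert (L : filterlim chord (at_right 0) (locally 0)).
  { rewrite <- chord_0 at 2; eapply filterlim_filter_le_1; [ apply filter_le_within | apply continuous_chord]. }
  generalize (filter_and _ _ at_right_0_interval (L _ HP)); apply filter_imp.
  intros x [Hx K]; apply K; apply chord_pos; auto.
Qed.

Lemma chord_at_left : filterlim chord (at_left (2 * PI)) (at_right 0).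
Proof.
  intros P HP. unfold filtermap.
  assert (L : filterlim chord (at_left (2 * PI)) (locally 0)).
  { rewrite <- chord_2pi; eapply filterlim_filter_le_1; [ apply filter_le_within | apply continuous_chord]. }
  generalize (filter_and _ _ at_left_2pi_interval (L _ HP)); apply filter_imp.
  intros x [Hx K]; apply K; apply chord_pos; auto.
Qed.

Lemma Rpower_lim_0 s : 0 < s -> filterlim (fun y => Rpower y s) (at_right 0) (locally 0).
Proof.
  intros Hs; unfold Rpower.
  apply (filterlim_comp _ _ _ (fun y => s * ln y) exp _ (Rbar_locally m_infty)).
  2: apply is_lim_exp_m.
  apply (filterlim_comp _ _ _ ln (fun y => s * y) _ (Rbar_locally m_infty)).
  - apply is_lim_ln_0.
  - generalize (filterlim_Rbar_mult_l s m_infty).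
    unfold Rbar_mult; simpl. case Rle_dec; [ | lra]; intros r; case Rle_lt_or_eq_dec; [auto | lra].
Qed.

Lemma filterlim_0_le {T} (F : (T -> Prop) -> Prop) {FF : Filter F} (f g : T -> R) (K : R) :
  F (fun x => Rabs (f x) <= K * g x) -> filterlim g F (locally 0) -> filterlim f F (locally 0).
Proof.
  intros H Hg.
  assert (HK : filterlim (fun x => K * g x) F (locally 0)).
  { replace 0 with (K * 0) by ring.
    apply (filterlim_comp _ _ _ g (fun y => K * y) _ (locally 0)); auto.
    apply (filterlim_scal_r (V := R_NormedModule) K 0). }
  intros P [eps HP]. 
  assert (B := HK (ball 0 eps) (locally_ball 0 eps)).
  unfold filtermap in *.
  generalize (filter_and _ _ H B); apply filter_imp; intros x [H1 H2].
  apply HP. unfold ball in *; simpl in *; unfold AbsRing_ball, abs, minus, plus, opp in *; simpl in *.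
  rewrite Ropp_0, Rplus_0_r in *.
  eapply Rle_lt_trans; [apply H1 | eapply Rle_lt_trans; [apply Rle_abs | apply H2]].
Qed.

Lemma chord_power_lim s : 0 < s ->
  filterlim (fun x => Rpower (chord x) s) (at_right 0) (locally 0) /\
  filterlim (fun x => Rpower (chord x) s) (at_left (2 * PI)) (locally 0).
Proof.
  intros Hs; split.
  - apply (filterlim_comp _ _ _ chord (fun y => Rpower y s) _ (at_right 0)); [apply chord_at_right | apply Rpower_lim_0; auto].
  - apply (filterlim_comp _ _ _ chord (fun y => Rpower y s) _ (at_right 0)); [apply chord_at_left | apply Rpower_lim_0; auto].
Qed.

(* With [s = a + b] and [d = (a - b) / 2], the values [th = 0] and
   [th = - PI / 2] give the real and the imaginary part of [weight0 a b]. *)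
Definition chord_cos (s d th x : R) : R := Rpower (chord x) s * cos (d * (x - PI) + th).

Definition chord_int (s d th : R) : R := RInt (chord_cos s d th) 0 (2 * PI).

Lemma continuous_chord_cos s d th x : 0 < x < 2 * PI -> continuous (chord_cos s d th) x.
Proof.
  intros Hx; apply (ex_derive_continuous (chord_cos s d th)); unfold chord_cos, Rpower, chord; auto_derive.
  generalize (chord_pos x Hx); unfold chord; auto.
Qed.

Lemma Rpower_pos x y : 0 < Rpower x y.
Proof. apply exp_pos. Qed.

Lemma chord_cos_has_int s d th : 0 < s ->
  ex_RInt (chord_cos s d th) 0 (2 * PI) /\ has_int (chord_cos s d th) (chord_int s d th).
Proof.
  intros Hs; destruct (chord_power_lim s Hs) as [L0 L1].
  assert (B : forall x, Rabs (chord_cos s d th x) <= 1 * Rpower (chord x) s).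
  { intros x; unfold chord_cos; rewrite Rabs_mult, (Rabs_pos_eq (Rpower _ _)) by (left; apply Rpower_pos).
    generalize (Rpower_pos (chord x) s) (COS_bound (d * (x - PI) + th)); intros.
    assert (Rabs (cos (d * (x - PI) + th)) <= 1) by (apply Rabs_le; lra). nra. }
  (* The default [ln 0 = 0] makes [Rpower 0 s] equal to 1, so [chord_cos] may jump at the ends; the
     integral is that of its continuous extension by 0. *)
  destruct (C0_extension_lt (chord_cos s d th) 0 0 0 (2 * PI) two_pi_pos) as (g & Hg & E & _ & _).
  - intros c Hc; apply (continuous_chord_cos s d th c Hc).
  - eapply filterlim_0_le; [typeclasses eauto | apply filter_forall; exact B | auto].
  - eapply filterlim_0_le; [typeclasses eauto | apply filter_forall; exact B | auto].
  - apply (has_int_RInt (chord_cos s d th) g); [ intros; apply Hg | intros; symmetry; auto].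
Qed.

(* Integration by parts raises the exponent by 2, so singular integrals reduce
   to proper ones. *)
Lemma chord_cos_step s d th v : -1 < s ->
  has_int (chord_cos (s + 2) d th) v ->
  has_int (chord_cos s d th) (((s / 2 + 1) ^ 2 - d ^ 2) / ((s + 1) * (s + 2)) * v).
Proof.
  intros Hs (G & l0 & l1 & HG & H0 & H1 & Hv).
  assert (Hb : has_int (fun x => chord_cos s d th x * ((s + 1) * (s + 2))
      - chord_cos (s + 2) d th x * ((s / 2 + 1) ^ 2 - d ^ 2)) 0).
  (* Up to sign [A] is the Wronskian of [chord ^ (s + 2)] and [cos (d * (x - PI) + th)]. As chord''
     = - chord / 4 and chord'^2 = 1 - chord^2 / 4, its derivative is the integrand; it vanishes at
     both ends because [s + 1 > 0]. *)
  { set (A := fun x => Rpower (chord x) (s + 1) * ((s + 2) * (cos (x / 2) * cos (d * (x - PI) + th))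
                                 + d * (chord x * sin (d * (x - PI) + th)))).
    assert (B : forall x, Rabs (A x) <= (Rabs (s + 2) + 2 * Rabs d) * Rpower (chord x) (s + 1)).
    { intros x; unfold A; rewrite Rabs_mult, (Rabs_pos_eq (Rpower _ _)) by (left; apply Rpower_pos).
      rewrite Rmult_comm; apply Rmult_le_compat_r; [left; apply Rpower_pos | ].
      eapply Rle_trans; [apply Rabs_triang | ]; rewrite !Rabs_mult.
      assert (Cb : forall y, Rabs (cos y) <= 1) by (intros y; generalize (COS_bound y); intros; apply Rabs_le; lra).
      assert (Sb : forall y, Rabs (sin y) <= 1) by (intros y; generalize (SIN_bound y); intros; apply Rabs_le; lra).
      assert (Ub : Rabs (chord x) <= 2) by (unfold chord; rewrite Rabs_mult, (Rabs_pos_eq 2) by lra; generalize (Sb (x/2)); lra).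
      generalize (Cb (x / 2)) (Cb (d * (x - PI) + th)) (Sb (d * (x - PI) + th)); intros c1 c2 c3.
      assert (Rabs (cos (x / 2)) * Rabs (cos (d * (x - PI) + th)) <= 1 * 1)
        by (apply Rmult_le_compat; auto; apply Rabs_pos).
      assert (Rabs (chord x) * Rabs (sin (d * (x - PI) + th)) <= 2 * 1)
        by (apply Rmult_le_compat; auto; apply Rabs_pos).
      generalize (Rabs_pos (s + 2)) (Rabs_pos d); intros; nra. }
    destruct (chord_power_lim (s + 1)) as [L0 L1]; [lra | ].
    exists A, 0, 0; split; [ | split; [ | split]].
    - intros x Hx; generalize (chord_pos x Hx); intros Hu; unfold A, chord_cos.
      assert (E2 : Rpower (chord x) (s + 2) = Rpower (chord x) s * (chord x) ^ 2)
        by (rewrite Rpower_plus; f_equal; rewrite <- (Rpower_pow 2 (chord x)) by auto; f_equal; simpl; ring).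
      rewrite E2.
      assert (E1 : Rpower (chord x) (s + 1) = Rpower (chord x) s * chord x)
        by (rewrite Rpower_plus, Rpower_1; auto).
      evar_last.
      + apply (is_derive_mult (K := R_AbsRing) (fun x => Rpower (chord x) (s + 1))
           (fun x => (s + 2) * (cos (x / 2) * cos (d * (x - PI) + th)) + d * (chord x * sin (d * (x - PI) + th)))
           x ((s + 1) * cos (x / 2) * Rpower (chord x) s)
           ((s + 2) * (- sin (x / 2) / 2 * cos (d * (x - PI) + th) - cos (x / 2) * (d * sin (d * (x - PI) + th)))
             + d * (cos (x / 2) * sin (d * (x - PI) + th) + chord x * (d * cos (d * (x - PI) + th)))));
          [ | | intros; apply Rmult_comm].
        * evar_last; [ unfold Rpower, chord; auto_derive; [exact Hu | reflexivity] | ].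
          fold (chord x). replace (exp ((s + 1) * ln (chord x))) with (Rpower (chord x) (s + 1)) by reflexivity.
          replace (2 * sin (x * / 2)) with (chord x) by reflexivity.
          replace (exp ((s + 1) * ln (chord x))) with (Rpower (chord x) (s + 1)) by reflexivity.
          rewrite E1; unfold Rdiv; field; lra.
        * unfold chord; auto_derive; auto. unfold Rdiv, Rminus; field.
      + unfold plus, mult; simpl. rewrite E1.
        unfold Rdiv.
        assert (T := sin2_cos2 (x * / 2)); unfold Rsqr in T.
        set (S := sin (x * / 2)) in *; set (C := cos (x * / 2)) in *.
        set (P := Rpower _ s); clearbody P.
        replace (chord x) with (2 * S) by reflexivity.
        unfold Rminus.
        assert (T' : C * C = 1 - S * S) by lra.
        set (c := cos (d * (x + - PI) + th)); set (sn := sin (d * (x + - PI) + th)); clearbody c sn S C.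
        transitivity (P * ((s + 2) * ((s + 1) * (C * C) * c) - (s+2) * S * S * c + d * d * 4 * S * S * c)).
        * field.
        * rewrite T'; field.
    - eapply filterlim_0_le; [typeclasses eauto | apply filter_forall; exact B | auto].
    - eapply filterlim_0_le; [typeclasses eauto | apply filter_forall; exact B | auto].
    - ring. }
  assert (HI : has_int (chord_cos (s + 2) d th) v) by (exists G, l0, l1; auto).
  generalize (has_int_lin _ _ _ _ (/ ((s + 1) * (s + 2))) (((s / 2 + 1) ^ 2 - d ^ 2) / ((s + 1) * (s + 2))) Hb HI).
  intros K.
  replace (((s / 2 + 1) ^ 2 - d ^ 2) / ((s + 1) * (s + 2)) * v) with
   (/ ((s + 1) * (s + 2)) * 0 + ((s / 2 + 1) ^ 2 - d ^ 2) / ((s + 1) * (s + 2)) * v) by ring.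
  eapply has_int_ext; [ | exact K].
  intros x Hx; simpl; field; lra.
Qed.

(** * Iteration of the recurrence in the exponent *)

Fixpoint prod1 (f : nat -> R) (N : nat) : R :=
  match N with O => 1 | S k => prod1 f k * f (S k) end.

Lemma prod1_pos f N : (forall k, (1 <= k)%nat -> 0 < f k) -> 0 < prod1 f N.
Proof.
  intros H; induction N as [ | N IH]; simpl; [lra | ].
  apply Rmult_lt_0_compat; auto; apply H; lia.
Qed.

Lemma INR_ge_1 k : (1 <= k)%nat -> 1 <= INR k.
Proof. intros H; apply (le_INR 1) in H; simpl in H; lra. Qed.

Lemma chord_int_step s d th : 0 < s ->
  chord_int s d th = ((s / 2 + 1) ^ 2 - d ^ 2) / ((s + 1) * (s + 2)) * chord_int (s + 2) d th.
Proof.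
  intros Hs; apply (has_int_unique (chord_cos s d th)).
  - apply chord_cos_has_int; auto.
  - apply chord_cos_step; [lra | apply chord_cos_has_int; lra].
Qed.

(** The coefficient of [chord_cos_step] at exponent [s + 2 * (k - 1)]. For s = a + b and d = (a - b)
    / 2 its numerator is (a + k)(b + k). *)
Definition step_factor (s d : R) (k : nat) : R :=
  ((s / 2 + INR k) ^ 2 - d ^ 2) / ((s + 2 * INR k - 1) * (s + 2 * INR k)).

(** [chord_int] is known to represent the integral only at positive exponents, so the first step
    stays with [has_int]; hence [1 <= N]. *)
Lemma chord_cos_iter s d th N : -1 < s -> (1 <= N)%nat ->
  has_int (chord_cos s d th) (prod1 (step_factor s d) N * chord_int (s + 2 * INR N) d th).
Proof.
  intros Hs; induction N as [ | N IH]; [lia | intros _].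
  destruct N as [ | N].
  - replace (prod1 (step_factor s d) 1) with (((s / 2 + 1) ^ 2 - d ^ 2) / ((s + 1) * (s + 2))).
    + apply chord_cos_step; auto. replace (s + 2 * INR 1) with (s + 2) by (simpl; ring). apply chord_cos_has_int; lra.
    + unfold prod1, step_factor; simpl INR; field; lra.
  - assert (P : (1 <= S N)%nat) by lia; specialize (IH P); apply INR_ge_1 in P.
    replace (prod1 (step_factor s d) (S (S N)) * chord_int (s + 2 * INR (S (S N))) d th)
      with (prod1 (step_factor s d) (S N) * chord_int (s + 2 * INR (S N)) d th); auto.
    change (prod1 (step_factor s d) (S (S N))) with (prod1 (step_factor s d) (S N) * step_factor s d (S (S N))).
    rewrite (chord_int_step (s + 2 * INR (S N))) by lra.
    rewrite (S_INR (S N)); unfold step_factor at 3.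
    rewrite (S_INR (S N)); set (n := INR (S N)) in *.
    replace (s + 2 * (n + 1)) with (s + 2 * n + 2) by ring. field. lra.
Qed.

(** At s = d = 0 the integrand is 1. This Wallis-type identity normalises the asymptotics of the
    other integrals. *)
Lemma chord_int_2N N : (1 <= N)%nat -> 2 * PI = prod1 (step_factor 0 0) N * chord_int (2 * INR N) 0 0.
Proof.
  intros HN; generalize (chord_cos_iter 0 0 0 N ltac:(lra) HN); rewrite Rplus_0_l; intros H.
  apply (has_int_unique (chord_cos 0 0 0)); auto.
  apply (has_int_ext (fun _ => 1)).
  - intros x Hx; unfold chord_cos; rewrite Rpower_O by (apply chord_pos; auto).
    rewrite Rmult_0_l, Rplus_0_r, cos_0; ring.
  - exists (fun x => x), 0, (2 * PI); split; [ | split; [ | split]].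
    + intros; auto_derive; auto.
    + apply filter_le_within; apply filter_filter.
    + apply filter_le_within; apply filter_filter.
    + ring.
Qed.

Lemma chord_int_mono s t : 0 < s <= t -> chord_int t 0 0 <= Rpower 2 (t - s) * chord_int s 0 0.
Proof.
  intros H; unfold chord_int.
  destruct (chord_cos_has_int t 0 0) as [Et _]; [lra | ]; destruct (chord_cos_has_int s 0 0) as [Es _]; [lra | ].
  generalize two_pi_pos; intros HP.
  rewrite <- (RInt_scal (V := R_CompleteNormedModule)) by auto.
  apply RInt_le; [lra | auto | apply (ex_RInt_scal (V := R_NormedModule)); auto | ].
  intros x Hx; unfold chord_cos, scal; simpl; unfold mult; simpl.
  rewrite Rmult_0_l, Rplus_0_r, cos_0, !Rmult_1_r.
  replace t with ((t - s) + s) at 1 by ring; rewrite Rpower_plus.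
  apply Rmult_le_compat_r; [left; apply Rpower_pos | ].
  apply Rle_Rpower_l; [lra | split; [apply chord_pos; auto | apply chord_le_2]].
Qed.

Lemma chord_int_2N_pos N : (1 <= N)%nat -> 0 < chord_int (2 * INR N) 0 0.
Proof.
  intros HN; generalize (chord_int_2N N HN); intros E.
  assert (P : 0 < prod1 (step_factor 0 0) N).
  { apply prod1_pos; intros k Hk; apply INR_ge_1 in Hk; unfold step_factor.
    apply Rdiv_lt_0_compat; nra. }
  generalize two_pi_pos; intros; nra.
Qed.

(** At even exponents positivity is read off from [chord_int_2N]; any other exponent lies below an
    even one, and [chord_int_mono] transfers it. *)
Lemma chord_int_pos s : 0 < s -> 0 < chord_int s 0 0.
Proof.
  intros Hs; destruct (nfloor_ex s) as [N HN]; [lra | ].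
  assert (K : 0 < chord_int (2 * INR (S N)) 0 0) by (apply chord_int_2N_pos; lia).
  generalize (chord_int_mono s (2 * INR (S N))); rewrite S_INR in *; generalize (pos_INR N); intros P M.
  assert (Q := M ltac:(lra)). generalize (Rpower_pos 2 (2 * (INR N + 1) - s)); intros; nra.
Qed.

Lemma chord_int_next s : 0 < s -> chord_int (s + 2) 0 0 = 4 * (s + 1) / (s + 2) * chord_int s 0 0.
Proof. intros Hs; rewrite (chord_int_step s 0 0 Hs); field; lra. Qed.

(** Each step multiplies by at least 4(1 - 1/(s+2)), and a Bernoulli inequality collects the K
    factors. Up to a factor tending to 1 as s grows, this reverses the bound 4^K of
    [chord_int_mono]. *)
Lemma chord_int_shift_lower s K : 0 < s ->
  4 ^ K * (1 - INR K / (s + 2)) * chord_int s 0 0 <= chord_int (s + 2 * INR K) 0 0.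
Proof.
  intros Hs; induction K as [ | K IH].
  - simpl; rewrite Rmult_0_r, Rplus_0_r; unfold Rdiv; lra.
  - rewrite S_INR; replace (s + 2 * (INR K + 1)) with (s + 2 * INR K + 2) by ring.
    generalize (pos_INR K); intros HK.
    rewrite chord_int_next by lra.
    assert (PI1 := chord_int_pos s Hs).
    assert (PI2 := chord_int_pos (s + 2 * INR K) ltac:(lra)).
    assert (P4 : 0 < 4 ^ K) by (apply pow_lt; lra).
    set (k := INR K) in *; set (I1 := chord_int s 0 0) in *; set (I2 := chord_int (s + 2 * k) 0 0) in *.
    assert (R1 : 4 * (s + 1) / (s + 2) <= 4 * (s + 2 * k + 1) / (s + 2 * k + 2)).
    { apply Rmult_le_reg_r with ((s + 2) * (s + 2 * k + 2)); [nra | ].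
      field_simplify; [ nra | lra | lra]. }
    assert (R2 : 4 * (s + 1) / (s + 2) * I2 <= 4 * (s + 2 * k + 1) / (s + 2 * k + 2) * I2)
      by (apply Rmult_le_compat_r; lra).
    eapply Rle_trans; [ | exact R2].
    assert (R3 : 0 <= 4 * (s + 1) / (s + 2)) by (apply Rmult_le_pos; [lra | left; apply Rinv_0_lt_compat; lra]).
    eapply Rle_trans; [ | apply Rmult_le_compat_l; [exact R3 | exact IH]].
    replace (4 ^ S K * (1 - (k + 1) / (s + 2)) * I1) with ((4 ^ K * I1) * (4 * (1 - (k + 1) / (s + 2)))) by (simpl; ring).
    replace (4 * (s + 1) / (s + 2) * (4 ^ K * (1 - k / (s + 2)) * I1))
      with ((4 ^ K * I1) * (4 * ((1 - k / (s + 2)) * (1 - / (s + 2))))) by (field; lra).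
    apply Rmult_le_compat_l; [nra | ].
    assert (0 <= k / (s + 2) * / (s + 2)).
    { assert (0 < / (s + 2)) by (apply Rinv_0_lt_compat; lra). unfold Rdiv; apply Rmult_le_pos; nra. }
    replace ((k + 1) / (s + 2)) with (k / (s + 2) + / (s + 2)) by (field; lra). nra.
Qed.

(** Lower bound: 2N + s lies below 2N + 2K, which the recurrence reaches from 2N with a factor close
    to 4^K. Upper bound: 2N + s lies above 2N - 2, from which one step reaches 2N. Monotonicity
    bridges the gaps, and its powers of 2 combine to [2^s] in the limit. *)
Lemma chord_int_ratio_lim s : -1 < s ->
  is_lim_seq (fun N => chord_int (s + 2 * INR N) 0 0 / chord_int (2 * INR N) 0 0) (Rpower 2 s).
Proof.
  intros Hs.
  destruct (nfloor_ex (s + 1)) as [K0 HK0]; [lra | ].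
  set (K := S K0). assert (HK : s <= 2 * INR K) by (unfold K; rewrite S_INR; generalize (pos_INR K0); lra).
  clearbody K; clear K0 HK0.
  apply (is_lim_seq_le_le_loc (fun N => Rpower 2 s * (1 - INR K / (2 * INR N + 2))) _
           (fun N => Rpower 2 s * (1 + / (2 * INR N - 1)))).
  - exists 2%nat; intros N HN.
    assert (HN' : 2 <= INR N) by (apply (le_INR 2) in HN; simpl in HN; lra).
    set (n := INR N) in *. assert (P := chord_int_pos (2 * n) ltac:(lra)).
    split.
    + apply Rmult_le_reg_r with (chord_int (2 * n) 0 0); auto.
      unfold Rdiv at 2; rewrite Rmult_assoc, (Rmult_assoc _ (/ _)), Rinv_l, Rmult_1_r by lra.
      generalize (chord_int_shift_lower (2 * n) K ltac:(lra)) (chord_int_mono (s + 2 * n) (2 * n + 2 * INR K) ltac:(lra)).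
      intros A1 A2.
      replace (2 * n + 2 * INR K - (s + 2 * n)) with (INR K + INR K - s) in A2 by ring.
      assert (E : Rpower 2 (INR K + INR K - s) * Rpower 2 s = 4 ^ K).
      { rewrite <- Rpower_plus. replace (INR K + INR K - s + s) with (INR K + INR K) by ring.
        rewrite Rpower_plus, Rpower_pow by lra. replace 4 with (2 * 2) by ring.
        rewrite Rpow_mult_distr; auto. }
      assert (Pk := Rpower_pos 2 (INR K + INR K - s)).
      apply Rmult_le_reg_l with (Rpower 2 (INR K + INR K - s)); auto.
      rewrite <- !Rmult_assoc, E. eapply Rle_trans; [ | exact A2]. exact A1.
    + apply Rmult_le_reg_r with (chord_int (2 * n) 0 0); auto.
      unfold Rdiv; rewrite (Rmult_assoc _ (/ _)), Rinv_l, Rmult_1_r by lra.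
      generalize (chord_int_mono (2 * n - 2) (s + 2 * n) ltac:(lra)).
      replace (s + 2 * n - (2 * n - 2)) with (s + 2) by ring.
      rewrite Rpower_plus. replace (Rpower 2 2) with 4
        by (replace 2 with (INR 2) at 2 by (simpl; ring); rewrite Rpower_pow by lra; simpl; ring).
      generalize (chord_int_next (2 * n - 2) ltac:(lra)); replace (2 * n - 2 + 2) with (2 * n) by ring.
      intros ->. intros H; eapply Rle_trans; [exact H | ]. right; field. lra.
  - replace (Finite (Rpower 2 s)) with (Finite (Rpower 2 s * (1 - INR K * 0))) by (f_equal; ring).
    apply (is_lim_seq_mult' (fun _ => Rpower 2 s)); [apply is_lim_seq_const | ].
    apply (is_lim_seq_minus' (fun _ => 1)); [apply is_lim_seq_const | ].
    unfold Rdiv; apply (is_lim_seq_mult' (fun _ => INR K)); [apply is_lim_seq_const | ].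
    replace (Finite 0) with (Rbar_inv p_infty) by reflexivity.
    apply is_lim_seq_inv; [ | discriminate].
    apply (is_lim_seq_le_p_loc INR); [ | apply is_lim_seq_INR].
    exists 0%nat; intros n _; generalize (pos_INR n); lra.
  - replace (Finite (Rpower 2 s)) with (Finite (Rpower 2 s * (1 + 0))) by (f_equal; ring).
    apply (is_lim_seq_mult' (fun _ => Rpower 2 s)); [apply is_lim_seq_const | ].
    apply (is_lim_seq_plus' (fun _ => 1)); [apply is_lim_seq_const | ].
    replace (Finite 0) with (Rbar_inv p_infty) by reflexivity.
    apply is_lim_seq_inv; [ | discriminate].
    apply (is_lim_seq_le_p_loc INR); [ | apply is_lim_seq_INR].
    exists 1%nat; intros n Hn; apply INR_ge_1 in Hn; lra.
Qed.

(** * Concentration of the powers of [chord] at z = -1 *)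

Lemma cos_lipschitz x y : Rabs (cos (x + y) - cos y) <= Rabs x.
Proof.
  destruct (MVT_abs cos (fun z => - sin z) y (x + y)) as (c & Hc & _).
  - intros c _; apply derivable_pt_lim_cos.
  - rewrite Hc. replace (x + y - y) with x by ring. rewrite Rabs_Ropp.
    generalize (SIN_bound c); intros; assert (Rabs (sin c) <= 1) by (apply Rabs_le; lra).
    generalize (Rabs_pos x); nra.
Qed.

Lemma sin_ge_third t : 0 <= t <= PI / 2 -> t / 3 <= sin t.
Proof.
  intros Ht; generalize PI_4; intros P4.
  destruct (sin_bound t 0) as [L _]; [lra | lra | ].
  unfold sin_approx, sin_term in L; simpl in L.
  eapply Rle_trans; [ | exact L].
  replace (1 * (t * 1 / 1) + -1 * 1 * (t * (t * (t * 1)) / (1+1+1+1+1+1))) with (t * (1 - t * t / 6)) by field.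
  assert (t * t <= 4) by nra. nra.
Qed.

(** The defect 4 - chord^2 is 4 sin((x - PI)/2)^2, so it controls the squared distance to PI. The
    constant 9 is the square of the crude 3 in [sin_ge_third]. *)
Lemma sq_le_chord x : 0 < x < 2 * PI -> (x - PI) ^ 2 <= 9 * (4 - chord x ^ 2).
Proof.
  intros Hx; set (t := Rabs (x - PI) / 2).
  assert (Ht : 0 <= t <= PI / 2).
  { unfold t; generalize (Rabs_pos (x - PI)); split; [lra | ].
    assert (Rabs (x - PI) <= PI) by (apply Rabs_le; lra); lra. }
  assert (S := sin_ge_third t Ht).
  assert (E : 4 - chord x ^ 2 = 4 * (sin t) ^ 2).
  { unfold chord. assert (E1 : (sin t) ^ 2 = (cos (x / 2)) ^ 2).
    { unfold t; unfold Rabs; destruct (Rcase_abs (x - PI)).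
      - replace (- (x - PI) / 2) with (PI / 2 - x / 2) by field. rewrite sin_shift; auto.
      - replace ((x - PI) / 2) with (- (PI / 2 - x / 2)) by field. rewrite sin_neg, sin_shift; ring. }
    rewrite E1; generalize (sin2_cos2 (x / 2)); unfold Rsqr; intros; simpl; nra. }
  rewrite E. replace ((x - PI) ^ 2) with (4 * t ^ 2).
  - simpl; nra.
  - unfold t; replace (4 * (Rabs (x - PI) / 2) ^ 2) with ((Rabs (x - PI)) ^ 2) by field.
    rewrite RPow_abs, Rabs_pos_eq; auto. apply pow2_ge_0.
Qed.

(* [chord ^ s] concentrates at [x = PI]: the defect [4 - chord ^ 2] has average
   [4 / (s + 2)] with respect to it. *)
Lemma chord_int_concentration s d th eta : 0 < s -> 0 < eta ->
  Rabs (chord_int s d th - cos th * chord_int s 0 0) <= (eta + 9 * d ^ 2 / (eta * (s + 2))) * chord_int s 0 0.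
Proof.
  intros Hs He.
  (* [C] combines [|y| <= eta + y^2 / (4 * eta)] at [y = d * (x - PI)] with the 9 of [sq_le_chord].
     The coefficients [4 * C] and [- C] spread [C * (4 - chord^2)] over the exponents s and s +
     2. *)
  set (C := 9 * d ^ 2 / (4 * eta)).
  assert (HC : 0 <= C) by (apply Rmult_le_pos; [generalize (pow2_ge_0 d); lra | left; apply Rinv_0_lt_compat; lra]).
  assert (E : (eta + 9 * d ^ 2 / (eta * (s + 2))) * chord_int s 0 0 =
              (eta + 4 * C) * chord_int s 0 0 + (- C) * chord_int (s + 2) 0 0).
  { rewrite chord_int_next by auto; unfold C; field; lra. }
  rewrite E; clear E.
  destruct (chord_cos_has_int s d th Hs) as [E1 _]; destruct (chord_cos_has_int s 0 0 Hs) as [E2 _];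
  destruct (chord_cos_has_int (s + 2) 0 0) as [E3 _]; [lra | ].
  unfold chord_int.
  generalize (RInt_correct (V := R_CompleteNormedModule) _ _ _ E1) (RInt_correct (V := R_CompleteNormedModule) _ _ _ E2)
    (RInt_correct (V := R_CompleteNormedModule) _ _ _ E3).
  set (J1 := RInt _ _ _); set (J2 := RInt _ _ _); set (J3 := RInt _ _ _); intros I1 I2 I3.
  assert (I12 : is_RInt (fun x => chord_cos s d th x - cos th * chord_cos s 0 0 x) 0 (2 * PI) (J1 - cos th * J2)).
  { apply (is_RInt_minus (V := R_NormedModule)); auto. apply (is_RInt_scal (V := R_NormedModule)); auto. }
  assert (I23 : is_RInt (fun x => (eta + 4 * C) * chord_cos s 0 0 x + (- C) * chord_cos (s + 2) 0 0 x) 0 (2 * PI)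
       ((eta + 4 * C) * J2 + (- C) * J3)).
  { apply (is_RInt_plus (V := R_NormedModule)); apply (is_RInt_scal (V := R_NormedModule)); auto. }
  generalize two_pi_pos; intros HP.
  assert (B : forall x, 0 < x < 2 * PI -> Rabs (chord_cos s d th x - cos th * chord_cos s 0 0 x) <=
      (eta + 4 * C) * chord_cos s 0 0 x + (- C) * chord_cos (s + 2) 0 0 x).
  { intros x Hx; assert (Hu := chord_pos x Hx); unfold chord_cos.
    rewrite Rmult_0_l, Rplus_0_r, cos_0, !Rmult_1_r.
    assert (E2' : Rpower (chord x) (s + 2) = Rpower (chord x) s * (chord x) ^ 2)
        by (rewrite Rpower_plus; f_equal; rewrite <- (Rpower_pow 2 (chord x)) by auto; f_equal; simpl; ring).
    rewrite E2'. assert (P := Rpower_pos (chord x) s). set (w := Rpower (chord x) s) in *; clearbody w.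
    replace (w * cos (d * (x - PI) + th) - cos th * w) with (w * (cos (d * (x - PI) + th) - cos th)) by ring.
    rewrite Rabs_mult, (Rabs_pos_eq w) by lra.
    replace ((eta + 4 * C) * w + - C * (w * chord x ^ 2)) with (w * (eta + C * (4 - chord x ^ 2))) by ring.
    apply Rmult_le_compat_l; [lra | ].
    eapply Rle_trans; [apply cos_lipschitz | ].
    assert (Q := sq_le_chord x Hx).
    assert (A : Rabs (d * (x - PI)) <= eta + (d * (x - PI)) ^ 2 / (4 * eta)).
    { set (y := d * (x - PI)). rewrite <- (Rabs_pos_eq (y ^ 2)) by (apply pow2_ge_0).
      rewrite <- RPow_abs. set (z := Rabs y).
      assert (0 <= (2 * eta - z) ^ 2 / (4 * eta))
        by (apply Rmult_le_pos; [apply pow2_ge_0 | left; apply Rinv_0_lt_compat; lra]).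
      replace ((2 * eta - z) ^ 2 / (4 * eta)) with (eta - z + z ^ 2 / (4 * eta)) in H by (field; lra). lra. }
    eapply Rle_trans; [exact A | ]. apply Rplus_le_compat_l.
    replace ((d * (x - PI)) ^ 2 / (4 * eta)) with (d ^ 2 / (4 * eta) * (x - PI) ^ 2) by (field; lra).
    replace (C * (4 - chord x ^ 2)) with (d ^ 2 / (4 * eta) * (9 * (4 - chord x ^ 2))) by (unfold C; field; lra).
    apply Rmult_le_compat_l; auto.
    apply Rmult_le_pos; [apply pow2_ge_0 | left; apply Rinv_0_lt_compat; lra]. }
  apply Rabs_le; split.
  - assert (In : is_RInt (fun x => - ((eta + 4 * C) * chord_cos s 0 0 x + (- C) * chord_cos (s + 2) 0 0 x)) 0 (2 * PI)
       (- ((eta + 4 * C) * J2 + (- C) * J3))) by (apply (is_RInt_opp (V := R_NormedModule)); auto).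
    apply (is_RInt_le _ _ 0 (2 * PI) _ _ ltac:(lra) In I12).
    intros x Hx; generalize (B x Hx); intros K; apply Rabs_le_between in K; lra.
  - apply (is_RInt_le _ _ 0 (2 * PI) _ _ ltac:(lra) I12 I23).
    intros x Hx; generalize (B x Hx); intros K; apply Rabs_le_between in K; lra.
Qed.

Lemma chord_int_concentration_lim s d th : -1 < s ->
  is_lim_seq (fun N => chord_int (s + 2 * INR N) d th / chord_int (s + 2 * INR N) 0 0) (cos th).
Proof.
  intros Hs; apply is_lim_seq_spec; intros eps.
  assert (He := cond_pos eps); set (e := eps / 2).
  destruct (nfloor_ex (9 * d ^ 2 / (e * e) + 1)) as [M HM].
  { assert (0 <= 9 * d ^ 2 / (e * e)); [ | lra].
    apply Rmult_le_pos; [generalize (pow2_ge_0 d); lra | left; apply Rinv_0_lt_compat; unfold e; nra]. }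
  exists (S M); intros N HN; apply le_INR in HN; rewrite S_INR in HN; generalize (pos_INR M); intros HM0.
  set (n := INR N) in *. assert (P := chord_int_pos (s + 2 * n) ltac:(lra)).
  assert (C := chord_int_concentration (s + 2 * n) d th e ltac:(lra) ltac:(unfold e; lra)).
  replace (chord_int (s + 2 * n) d th / chord_int (s + 2 * n) 0 0 - cos th) with
    ((chord_int (s + 2 * n) d th - cos th * chord_int (s + 2 * n) 0 0) * / chord_int (s + 2 * n) 0 0) by (field; lra).
  rewrite Rabs_mult, (Rabs_pos_eq (/ _)) by (left; apply Rinv_0_lt_compat; auto).
  apply Rmult_lt_reg_r with (chord_int (s + 2 * n) 0 0); auto.
  rewrite Rmult_assoc, Rinv_l, Rmult_1_r by lra.
  eapply Rle_lt_trans; [exact C | ]. apply Rmult_lt_compat_r; auto.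
  assert (e * e > 0) by (unfold e; nra).
  assert (L : 9 * d ^ 2 / (e * (s + 2 * n + 2)) < e).
  { apply Rmult_lt_reg_r with (s + 2 * n + 2); [lra | ].
    replace (9 * d ^ 2 / (e * (s + 2 * n + 2)) * (s + 2 * n + 2)) with (e * (9 * d ^ 2 / (e * e))) by (field; unfold e in *; split; lra).
    apply Rmult_lt_compat_l; [unfold e; lra | lra]. }
  replace (pos eps) with (e + e) by (unfold e; field). lra.
Qed.

(** * Asymptotics of a product over a doubling range *)

Lemma ln_1p_le x : -1 < x -> ln (1 + x) <= x.
Proof.
  intros Hx; destruct (Req_dec x 0) as [-> | Hn].
  - rewrite Rplus_0_r, ln_1; lra.
  - left; rewrite <- (ln_exp x) at 2; apply ln_increasing; [lra | apply exp_ineq1; auto].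
Qed.

Lemma ln_1p_ge x : -1 < x -> x / (1 + x) <= ln (1 + x).
Proof.
  intros Hx; generalize (ln_1p_le (- (x / (1 + x)))); intros H.
  replace (1 + - (x / (1 + x))) with (/ (1 + x)) in H by (field; lra).
  rewrite ln_Rinv in H by lra.
  assert (0 < / (1 + x)) by (apply Rinv_0_lt_compat; lra).
  assert (-1 < - (x / (1 + x))).
  { replace (- (x / (1 + x))) with (-1 + / (1 + x)) by (field; lra). lra. }
  specialize (H H1). lra.
Qed.

(* The product of these factors over [N < k <= 2N] tends to [2^-s]. *)
Definition shift_ratio (s : R) (k : nat) : R := INR k / (INR k + s).

Lemma shift_ratio_pos s k : -1 < s -> (1 <= k)%nat -> 0 < shift_ratio s k.
Proof. intros Hs Hk; apply INR_ge_1 in Hk; apply Rdiv_lt_0_compat; lra. Qed.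

(** Both ln(1 + s/(k+1)) and s ln(1 + 1/k) differ from s/(k+1) by O(1/N^2); over the N factors of a
    doubling the errors add up to O(1/N). *)
Lemma shift_ratio_log_bound s N k : -1 < s -> 1 <= INR N -> 2 * Rabs s <= INR N -> (N <= k)%nat ->
  Rabs (ln (shift_ratio s (S k)) + s * (ln (INR (S k)) - ln (INR k))) <= (2 * s ^ 2 + Rabs s) / (INR N) ^ 2.
Proof.
  intros Hs HN1 HN2 Hk; apply le_INR in Hk.
  unfold shift_ratio; rewrite S_INR. set (n := INR N) in *; set (x := INR k) in *.
  assert (Bs := Rle_abs s); assert (Bs' := Rle_abs (- s)); rewrite Rabs_Ropp in Bs'.
  set (as' := Rabs s) in *.
  assert (Has : 0 <= as') by apply Rabs_pos.
  assert (E1 : ln ((x + 1) / (x + 1 + s)) = - ln (1 + s / (x + 1))).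
  { replace ((x + 1) / (x + 1 + s)) with (/ (1 + s / (x + 1))).
    - apply ln_Rinv. replace (1 + s / (x + 1)) with ((x + 1 + s) / (x + 1)) by (field; lra).
      apply Rdiv_lt_0_compat; lra.
    - field; lra. }
  assert (E2 : ln (x + 1) - ln x = ln (1 + / x)).
  { rewrite <- ln_div by lra; f_equal; field; lra. }
  rewrite E1, E2.
  assert (C0 : -1 < s / (x + 1)).
  { apply Rmult_lt_reg_r with (x + 1); [lra | ]. unfold Rdiv; rewrite Rmult_assoc, Rinv_l by lra. lra. }
  assert (L1 := ln_1p_le _ C0); assert (L2 := ln_1p_ge _ C0).
  assert (Hix : 0 < / x) by (apply Rinv_0_lt_compat; lra).
  assert (L3 := ln_1p_le (/ x) ltac:(lra)); assert (L4 := ln_1p_ge (/ x) ltac:(lra)).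
  set (A := ln (1 + s / (x + 1))) in *; set (B := ln (1 + / x)) in *; clearbody A B.
  replace (s / (x + 1) / (1 + s / (x + 1))) with (s / (x + 1 + s)) in L2 by (field; lra).
  replace (/ x / (1 + / x)) with (/ (x + 1)) in L4 by (field; lra).
  assert (N2 : 0 < / n ^ 2) by (apply Rinv_0_lt_compat; nra).
  assert (D1 : Rabs (s / (x + 1) - A) <= 2 * s ^ 2 / n ^ 2).
  { rewrite Rabs_pos_eq by lra.
    apply Rle_trans with (s / (x + 1) - s / (x + 1 + s)); [lra | ].
    replace (s / (x + 1) - s / (x + 1 + s)) with (s ^ 2 * / ((x + 1) * (x + 1 + s))) by (field; lra).
    replace (2 * s ^ 2 / n ^ 2) with (s ^ 2 * / (n ^ 2 / 2)) by (field; lra).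
    apply Rmult_le_compat_l; [apply pow2_ge_0 | ].
    apply Rinv_le_contravar; nra. }
  assert (D2 : Rabs (s * B - s / (x + 1)) <= as' / n ^ 2).
  { replace (s * B - s / (x + 1)) with (s * (B - / (x + 1))) by (field; lra).
    rewrite Rabs_mult; unfold Rdiv; apply Rmult_le_compat_l; auto.
    rewrite Rabs_pos_eq by lra. apply Rle_trans with (/ x - / (x + 1)); [lra | ].
    replace (/ x - / (x + 1)) with (/ (x * (x + 1))) by (field; lra).
    apply Rinv_le_contravar; nra. }
  replace (- A + s * B) with ((s / (x + 1) - A) + (s * B - s / (x + 1))) by ring.
  eapply Rle_trans; [apply Rabs_triang | ].
  replace ((2 * s ^ 2 + as') / n ^ 2) with (2 * s ^ 2 / n ^ 2 + as' / n ^ 2) by (field; lra). lra.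
Qed.

Lemma shift_ratio_tail_bound s N M : -1 < s -> 1 <= INR N -> 2 * Rabs s <= INR N ->
  Rabs (ln (prod1 (shift_ratio s) (N + M) / prod1 (shift_ratio s) N) + s * (ln (INR (N + M)) - ln (INR N)))
    <= INR M * ((2 * s ^ 2 + Rabs s) / (INR N) ^ 2).
Proof.
  intros Hs HN1 HN2.
  assert (P : forall K, 0 < prod1 (shift_ratio s) K) by (intros K; apply prod1_pos; intros; apply shift_ratio_pos; auto).
  induction M as [ | M IH].
  - rewrite Nat.add_0_r. simpl INR. unfold Rdiv at 1; rewrite Rinv_r by (apply Rgt_not_eq, P).
    rewrite ln_1; replace (0 + s * (ln (INR N) - ln (INR N))) with 0 by ring; rewrite Rabs_R0; lra.
  - replace (N + S M)%nat with (S (N + M)) by lia.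
    change (prod1 (shift_ratio s) (S (N + M))) with (prod1 (shift_ratio s) (N + M) * shift_ratio s (S (N + M))).
    replace (prod1 (shift_ratio s) (N + M) * shift_ratio s (S (N + M)) / prod1 (shift_ratio s) N)
      with (prod1 (shift_ratio s) (N + M) / prod1 (shift_ratio s) N * shift_ratio s (S (N + M))) by (field; apply Rgt_not_eq, P).
    rewrite ln_mult; [ | apply Rdiv_lt_0_compat; apply P | apply shift_ratio_pos; [auto | lia] ].
    assert (B := shift_ratio_log_bound s N (N + M) Hs HN1 HN2 ltac:(lia)).
    rewrite (S_INR M).
    replace (ln (prod1 (shift_ratio s) (N + M) / prod1 (shift_ratio s) N) + ln (shift_ratio s (S (N + M))) + s * (ln (INR (S (N + M))) - ln (INR N)))
     with ((ln (prod1 (shift_ratio s) (N + M) / prod1 (shift_ratio s) N) + s * (ln (INR (N + M)) - ln (INR N))) +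
        (ln (shift_ratio s (S (N + M))) + s * (ln (INR (S (N + M))) - ln (INR (N + M))))) by ring.
    eapply Rle_trans; [apply Rabs_triang | ]. lra.
Qed.

Lemma shift_ratio_lim s : -1 < s ->
  is_lim_seq (fun N => prod1 (shift_ratio s) (N + N) / prod1 (shift_ratio s) N) (Rpower 2 (- s)).
Proof.
  intros Hs.
  assert (P : forall K, 0 < prod1 (shift_ratio s) K) by (intros K; apply prod1_pos; intros; apply shift_ratio_pos; auto).
  unfold Rpower.
  apply (is_lim_seq_ext (fun N => exp (ln (prod1 (shift_ratio s) (N + N) / prod1 (shift_ratio s) N)))).
  { intros N; apply exp_ln; apply Rdiv_lt_0_compat; apply P. }
  apply (is_lim_seq_continuous exp _ (- s * ln 2)).
  { apply derivable_continuous_pt, derivable_pt_exp. }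
  set (C := 2 * s ^ 2 + Rabs s).
  assert (L : is_lim_seq (fun N => C * / INR N) 0).
  { replace (Finite 0) with (Finite (C * 0)) by (f_equal; ring).
    apply (is_lim_seq_mult' (fun _ => C)); [apply is_lim_seq_const | ].
    replace (Finite 0) with (Rbar_inv p_infty) by reflexivity.
    apply is_lim_seq_inv; [apply is_lim_seq_INR | discriminate]. }
  apply (is_lim_seq_le_le_loc (fun N => - s * ln 2 - C * / INR N) _ (fun N => - s * ln 2 + C * / INR N)).
  - destruct (nfloor_ex (2 * Rabs s)) as [K HK]; [generalize (Rabs_pos s); lra | ].
    exists (S K); intros N HN.
    assert (H1 : 1 <= INR N) by (apply INR_ge_1; lia).
    assert (H2 : 2 * Rabs s <= INR N) by (apply le_INR in HN; rewrite S_INR in HN; lra).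
    generalize (shift_ratio_tail_bound s N N Hs H1 H2).
    replace (ln (INR (N + N)) - ln (INR N)) with (ln 2).
    + fold C. replace (INR N * (C / INR N ^ 2)) with (C * / INR N) by (field; lra).
      intros K1; apply Rabs_le_between in K1; lra.
    + rewrite <- ln_div; [f_equal; rewrite plus_INR; field; lra | rewrite plus_INR; lra | lra].
  - replace (Finite (- s * ln 2)) with (Finite (- s * ln 2 - 0)) by (f_equal; ring).
    apply is_lim_seq_minus'; [apply is_lim_seq_const | auto].
  - replace (Finite (- s * ln 2)) with (Finite (- s * ln 2 + 0)) by (f_equal; ring).
    apply is_lim_seq_plus'; [apply is_lim_seq_const | auto].
Qed.

(* The factors of the product [h_0 = Gamma(a+b+1) / (Gamma(a+1) Gamma(b+1))]. *)
Definition beta_factor (a b : R) (k : nat) : R :=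
  (a + INR k) * (b + INR k) / (INR k * (a + b + INR k)).

(** The numerators factor as (a + k)(b + k), and the denominators (s + 2k - 1)(s + 2k) use two
    consecutive factors of [shift_ratio], hence the index [N + N]. The Wallis part is
    [step_factor 0 0]. *)
Lemma beta_factor_split a b N : -1 < a + b ->
  prod1 (step_factor (a + b) ((a - b) / 2)) N * prod1 (shift_ratio (a + b)) N =
  prod1 (beta_factor a b) N * prod1 (shift_ratio (a + b)) (N + N) * prod1 (step_factor 0 0) N.
Proof.
  intros Hs; induction N as [ | N IH]; [simpl; ring | ].
  replace (S N + S N)%nat with (S (S (N + N))) by lia.
  cbn [prod1].
  assert (E : step_factor (a + b) ((a - b) / 2) (S N) * shift_ratio (a + b) (S N) =
    beta_factor a b (S N) * (shift_ratio (a + b) (S (N + N)) * shift_ratio (a + b) (S (S (N + N)))) * step_factor 0 0 (S N)).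
  { unfold step_factor, shift_ratio, beta_factor. repeat rewrite ?S_INR, ?plus_INR. generalize (pos_INR N); intros.
    field. repeat split; lra. }
  replace (prod1 (step_factor (a + b) ((a - b) / 2)) N * step_factor (a + b) ((a - b) / 2) (S N) *
     (prod1 (shift_ratio (a + b)) N * shift_ratio (a + b) (S N))) with
   ((prod1 (step_factor (a + b) ((a - b) / 2)) N * prod1 (shift_ratio (a + b)) N) *
     (step_factor (a + b) ((a - b) / 2) (S N) * shift_ratio (a + b) (S N))) by ring.
  rewrite IH, E; ring.
Qed.

(* [T_N X_N] is constant in [N], where [T_N] is the partial product and
   [X_N -> cos th]; this gives both the convergence of [T_N] and the value. *)
Lemma chord_cos_moment a b : -1 < a + b ->
  exists v : R, is_lim_seq (prod1 (beta_factor a b)) v /\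
    forall th, has_int (chord_cos (a + b) ((a - b) / 2) th) (2 * PI * (v * cos th)).
Proof.
  intros Hs; set (s := a + b) in *; set (d := (a - b) / 2).
  set (X := fun th N => prod1 (shift_ratio s) (N + N) / prod1 (shift_ratio s) N * (chord_int (s + 2 * INR N) d th / chord_int (2 * INR N) 0 0)).
  assert (P : forall K, 0 < prod1 (shift_ratio s) K) by (intros K; apply prod1_pos; intros; apply shift_ratio_pos; auto).
  assert (LX : forall th, is_lim_seq (X th) (cos th)).
  { intros th; unfold X.
    replace (Finite (cos th)) with (Finite (Rpower 2 (- s) * (cos th * Rpower 2 s))).
    - apply is_lim_seq_mult'; [apply shift_ratio_lim; auto | ].
      apply (is_lim_seq_ext_loc (fun N => chord_int (s + 2 * INR N) d th / chord_int (s + 2 * INR N) 0 0 *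
              (chord_int (s + 2 * INR N) 0 0 / chord_int (2 * INR N) 0 0))).
      + exists 1%nat; intros N HN; apply INR_ge_1 in HN; field.
        split; apply Rgt_not_eq, chord_int_pos; lra.
      + apply is_lim_seq_mult'; [apply chord_int_concentration_lim; auto | apply chord_int_ratio_lim; auto].
    - f_equal. rewrite Rmult_comm, Rmult_assoc, <- Rpower_plus, Rplus_opp_r, Rpower_O by lra; ring. }
  assert (HV : forall N th, (1 <= N)%nat -> has_int (chord_cos s d th) (2 * PI * (prod1 (beta_factor a b) N * X th N))).
  { intros N th HN.
    replace (2 * PI * (prod1 (beta_factor a b) N * X th N)) with (prod1 (step_factor s d) N * chord_int (s + 2 * INR N) d th);
      [apply chord_cos_iter; auto | ].
    assert (G := beta_factor_split a b N Hs); fold s d in G.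
    rewrite (chord_int_2N N HN).
    assert (I0 := chord_int_2N_pos N HN). assert (P1 := P N).
    unfold X; set (I1 := chord_int _ d th).
    apply Rmult_eq_reg_r with (prod1 (shift_ratio s) N); [ | lra].
    replace (prod1 (step_factor s d) N * I1 * prod1 (shift_ratio s) N) with ((prod1 (step_factor s d) N * prod1 (shift_ratio s) N) * I1) by ring.
    rewrite G; field; split; lra. }
  (* Convergence of the product is obtained at [th = 0], where the limit of [X] is 1 and can be
     divided out; the other phases reuse it. *)
  destruct (ex_intro (fun v => has_int (chord_cos s d 0) v) _ (HV 1%nat 0 (le_n _))) as [V0 H0].
  set (v := V0 / (2 * PI)).
  assert (HP := two_pi_pos).
  assert (E0 : forall N, (1 <= N)%nat -> prod1 (beta_factor a b) N * X 0 N = v).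
  { intros N HN; assert (E := has_int_unique _ _ _ (HV N 0 HN) H0); unfold v; rewrite <- E; field.
    generalize PI_RGT_0; lra. }
  assert (LT : is_lim_seq (prod1 (beta_factor a b)) v).
  { apply (is_lim_seq_ext_loc (fun N => v / X 0 N)).
    - destruct (LX 0 (fun y => 0 < y)) as [M HM].
      { rewrite cos_0; exists (mkposreal 1 Rlt_0_1); intros y Hy; unfold ball in Hy; simpl in Hy.
        unfold AbsRing_ball, abs, minus, plus, opp in Hy; simpl in Hy. apply Rabs_def2 in Hy; lra. }
      exists (S M); intros N HN. rewrite <- (E0 N) by lia. specialize (HM N ltac:(lia)). field; lra.
    - replace (Finite v) with (Finite (v / cos 0)) by (rewrite cos_0; f_equal; field).
      apply is_lim_seq_div'; [apply is_lim_seq_const | apply LX | rewrite cos_0; lra]. }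
  exists v; split; auto.
  intros th.
  destruct (ex_intro (fun v => has_int (chord_cos s d th) v) _ (HV 1%nat th (le_n _))) as [Vt Ht].
  assert (E : Vt / (2 * PI) = v * cos th).
  { assert (L : is_lim_seq (fun N => prod1 (beta_factor a b) N * X th N) (v * cos th)) by (apply is_lim_seq_mult'; auto).
    assert (L2 : is_lim_seq (fun N => prod1 (beta_factor a b) N * X th N) (Vt / (2 * PI))).
    { apply (is_lim_seq_ext_loc (fun _ => Vt / (2 * PI))); [ | apply is_lim_seq_const].
      exists 1%nat; intros N HN. rewrite <- (has_int_unique _ _ _ (HV N th HN) Ht); field.
      generalize PI_RGT_0; lra. }
    apply is_lim_seq_unique in L; apply is_lim_seq_unique in L2; rewrite L in L2; injection L2; auto. }
  assert (E2 : 2 * PI * (v * cos th) = Vt) by (rewrite <- E; field; generalize PI_RGT_0; lra).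
  exact (eq_ind_r (has_int (chord_cos s d th)) Ht E2).
Qed.

(** * Complex calculus on the unit circle *)

(* The derivation is [-i d/dx], which is [z d/dz] along [z = cis x]. *)
Definition cder (f : R -> C) (x : R) (l : C) : Prop :=
  is_derive (fun t => Re (f t)) x (- Im l) /\ is_derive (fun t => Im (f t)) x (Re l).

Lemma cder_eq (f : R -> C) x l l' : cder f x l -> l = l' -> cder f x l'.
Proof. intros H <-; auto. Qed.

Lemma cder_ext_loc (f g : R -> C) x l : 0 < x < 2 * PI -> (forall t, 0 < t < 2 * PI -> f t = g t) ->
  cder f x l -> cder g x l.
Proof.
  intros Hx E [H1 H2].
  assert (L : locally x (fun t => 0 < t < 2 * PI)).
  { apply (locally_interval _ x 0 (2 * PI)); simpl; try lra; auto. }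
  split.
  - apply (is_derive_ext_loc (fun t => Re (f t))); auto.
    generalize L; apply filter_imp; intros t Ht; rewrite E; auto.
  - apply (is_derive_ext_loc (fun t => Im (f t))); auto.
    generalize L; apply filter_imp; intros t Ht; rewrite E; auto.
Qed.

Lemma cder_const c x : cder (fun _ => c) x 0%C.
Proof. split; simpl; [rewrite Ropp_0 | ]; apply @is_derive_const. Qed.

Lemma cder_plus (f g : R -> C) x l k : cder f x l -> cder g x k -> cder (fun t => f t + g t)%C x (l + k)%C.
Proof.
  intros [F1 F2] [G1 G2]; split; simpl.
  - rewrite Ropp_plus_distr. apply (is_derive_plus (fun t => Re (f t)) (fun t => Re (g t))); auto.
  - apply (is_derive_plus (fun t => Im (f t)) (fun t => Im (g t))); auto.
Qed.

Lemma cder_opp (f : R -> C) x l : cder f x l -> cder (fun t => - f t)%C x (- l)%C.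
Proof.
  intros [F1 F2]; split; simpl.
  - apply (is_derive_opp (fun t => Re (f t))); auto.
  - apply (is_derive_opp (fun t => Im (f t))); auto.
Qed.

Lemma cder_minus (f g : R -> C) x l k : cder f x l -> cder g x k -> cder (fun t => f t - g t)%C x (l - k)%C.
Proof. intros H1 H2; apply cder_plus; auto; apply cder_opp; auto. Qed.

Lemma is_derive_mult_R (f g : R -> R) x a b : is_derive f x a -> is_derive g x b ->
  is_derive (fun t => f t * g t) x (a * g x + f x * b).
Proof. intros H1 H2; apply (is_derive_mult f g x a b); auto; intros; apply Rmult_comm. Qed.

Lemma cder_mult (f g : R -> C) x l k : cder f x l -> cder g x k ->
  cder (fun t => f t * g t)%C x (l * g x + f x * k)%C.
Proof.
  intros [F1 F2] [G1 G2]; split.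
  - evar_last.
    + apply (is_derive_minus (fun t => Re (f t) * Re (g t)) (fun t => Im (f t) * Im (g t)));
      apply is_derive_mult_R; eauto.
    + unfold minus, plus, opp; destruct l, k, (f x), (g x); simpl; ring.
  - evar_last.
    + apply (is_derive_plus (fun t => Re (f t) * Im (g t)) (fun t => Im (f t) * Re (g t)));
      apply is_derive_mult_R; eauto.
    + unfold plus; destruct l, k, (f x), (g x); simpl; ring.
Qed.

Lemma norm2_pos (z : C) : z <> RtoC 0 -> 0 < Re z ^ 2 + Im z ^ 2.
Proof.
  intros H; destruct z as [a b]; simpl.
  destruct (Req_dec a 0) as [-> | Ha]; [ | nra].
  destruct (Req_dec b 0) as [-> | Hb]; [ | nra].
  exfalso; apply H; auto.
Qed.

Lemma cder_inv (f : R -> C) x l : f x <> RtoC 0 -> cder f x l -> cder (fun t => / f t)%C x (- l / (f x * f x))%C.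
Proof.
  intros H [F1 F2]; assert (N := norm2_pos _ H).
  assert (N' : Re (f x) ^ 2 + Im (f x) ^ 2 <> 0) by lra.
  assert (ND : is_derive (fun t => Re (f t) ^ 2 + Im (f t) ^ 2) x
     (2 * Re (f x) * (- Im l) + 2 * Im (f x) * Re l)).
  { evar_last.
    - apply (is_derive_plus (fun t => Re (f t) ^ 2) (fun t => Im (f t) ^ 2));
       apply is_derive_pow; eauto.
    - unfold plus; simpl; ring. }
  assert (E : (- l / (f x * f x))%C = (- (l * Cconj (f x * f x)) * RtoC (/ (Re (f x) ^ 2 + Im (f x) ^ 2) ^ 2))%C).
  { rewrite RtoC_inv, RtoC_pow by (apply pow_nonzero; auto).
    assert (M : (f x * Cconj (f x))%C = RtoC (Re (f x) ^ 2 + Im (f x) ^ 2)).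
    { destruct (f x); unfold Cconj, Cmult, RtoC; simpl; f_equal; ring. }
    rewrite <- M, Cmult_conj. 
    assert (Cconj (f x) <> RtoC 0) by (intros K; apply H; destruct (f x); injection K; intros; apply injective_projections; simpl; lra).
    simpl; field; auto. }
  rewrite E; split.
  - evar_last.
    + apply (is_derive_div (fun t => Re (f t)) (fun t => Re (f t) ^ 2 + Im (f t) ^ 2)); eauto.
    + destruct (f x), l; simpl in *; field; nra.
  - evar_last.
    + apply (is_derive_div (fun t => - Im (f t)) (fun t => Re (f t) ^ 2 + Im (f t) ^ 2)); eauto.
      apply (is_derive_opp (fun t => Im (f t))); eauto.
    + unfold opp; destruct (f x), l; simpl in *; field; nra.
Qed.

Lemma cder_cis x : cder cis x (cis x).
Proof. split; unfold cis; simpl; auto_derive; auto; ring. Qed.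

Lemma cder_pow (f : R -> C) x l n : cder f x l -> cder (fun t => Cpow (f t) n) x (INR n * Cpow (f x) (n - 1) * l)%C.
Proof.
  intros H; induction n as [ | n IH].
  - eapply cder_eq; [apply (cder_const 1%C) | simpl; ring].
  - apply (cder_eq _ _ (l * Cpow (f x) n + f x * (INR n * Cpow (f x) (n - 1) * l))%C).
    + apply (cder_mult f (fun t => Cpow (f t) n)); auto.
    + rewrite S_INR, RtoC_plus. destruct n as [ | n]; simpl.
      * ring.
      * rewrite Nat.sub_0_r; ring.
Qed.

Lemma cder_cont (f : R -> C) x l : cder f x l -> continuous (fun t => Re (f t)) x /\ continuous (fun t => Im (f t)) x.
Proof.
  intros [H1 H2]; split.
  - apply (ex_derive_continuous (fun t => Re (f t))); eexists; eauto.
  - apply (ex_derive_continuous (fun t => Im (f t))); eexists; eauto.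
Qed.

(** * Complex improper integrals: exact integrands, convergence, divergence *)

Definition has_int_C (f : R -> C) (v : C) : Prop :=
  has_int (fun x => Re (f x)) (Re v) /\ has_int (fun x => Im (f x)) (Im v).

Lemma has_int_C_ext f g v : (forall x, 0 < x < 2 * PI -> f x = g x) -> has_int_C f v -> has_int_C g v.
Proof.
  intros E [H1 H2]; split.
  - apply (has_int_ext (fun x => Re (f x))); auto; intros x Hx; rewrite E; auto.
  - apply (has_int_ext (fun x => Im (f x))); auto; intros x Hx; rewrite E; auto.
Qed.

Lemma has_int_C_plus f g v w : has_int_C f v -> has_int_C g w -> has_int_C (fun x => f x + g x)%C (v + w)%C.
Proof.
  intros [F1 F2] [G1 G2]; split.
  - assert (H := has_int_lin _ _ _ _ 1 1 F1 G1).
    replace (Re (v + w)%C) with (1 * Re v + 1 * Re w) by (unfold Re, Im; simpl; ring).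
    eapply has_int_ext; [ | exact H]. intros; unfold Re, Im; simpl; ring.
  - assert (H := has_int_lin _ _ _ _ 1 1 F2 G2).
    replace (Im (v + w)%C) with (1 * Im v + 1 * Im w) by (unfold Re, Im; simpl; ring).
    eapply has_int_ext; [ | exact H]. intros; unfold Re, Im; simpl; ring.
Qed.

Lemma has_int_C_scal c f v : has_int_C f v -> has_int_C (fun x => c * f x)%C (c * v)%C.
Proof.
  intros [F1 F2]; split.
  - assert (H := has_int_lin _ _ _ _ (Re c) (- Im c) F1 F2).
    replace (Re (c * v)%C) with (Re c * Re v + - Im c * Im v) by (destruct c, v; simpl; ring).
    eapply has_int_ext; [ | exact H]. intros; destruct c, (f x); simpl; ring.
  - assert (H := has_int_lin _ _ _ _ (Re c) (Im c) F2 F1).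
    replace (Im (c * v)%C) with (Re c * Im v + Im c * Re v) by (destruct c, v; simpl; ring).
    eapply has_int_ext; [ | exact H]. intros; destruct c, (f x); simpl; ring.
Qed.

Definition vanishes_at_ends (f : R -> C) : Prop :=
  filterlim (fun x => Cmod (f x)) (at_right 0) (locally 0) /\
  filterlim (fun x => Cmod (f x)) (at_left (2 * PI)) (locally 0).

Lemma Re_le_Cmod (z : C) : Rabs (Re z) <= Cmod z.
Proof. eapply Rle_trans; [ | apply Rmax_Cmod]. apply Rmax_l. Qed.

Lemma Im_le_Cmod (z : C) : Rabs (Im z) <= Cmod z.
Proof. eapply Rle_trans; [ | apply Rmax_Cmod]. apply Rmax_r. Qed.

(** Since [f] is -i dF/dx, Im F is an antiderivative of its real part and - Re F one of its
    imaginary part. *)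
Lemma has_int_C_exact (F f : R -> C) :
  (forall x, 0 < x < 2 * PI -> cder F x (f x)) -> vanishes_at_ends F -> has_int_C f 0%C.
Proof.
  intros H [V0 V1].
  assert (A : forall x, Rabs (Im (F x)) <= 1 * Cmod (F x)) by (intros; rewrite Rmult_1_l; apply Im_le_Cmod).
  assert (B : forall x, Rabs (- Re (F x)) <= 1 * Cmod (F x)) by (intros; rewrite Rabs_Ropp, Rmult_1_l; apply Re_le_Cmod).
  split.
  - exists (fun x => Im (F x)), 0, 0; split; [ | split; [ | split]].
    + intros x Hx; apply H; auto.
    + eapply filterlim_0_le; [typeclasses eauto | apply filter_forall; exact A | exact V0].
    + eapply filterlim_0_le; [typeclasses eauto | apply filter_forall; exact A | exact V1].
    + simpl; ring.
  - exists (fun x => - Re (F x)), 0, 0; split; [ | split; [ | split]].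
    + intros x Hx; destruct (H x Hx) as [D _]. apply (is_derive_opp (fun x => Re (F x))) in D.
      unfold opp in D; simpl in D; rewrite Ropp_involutive in D; auto.
    + eapply filterlim_0_le; [typeclasses eauto | apply filter_forall; exact B | exact V0].
    + eapply filterlim_0_le; [typeclasses eauto | apply filter_forall; exact B | exact V1].
    + simpl; ring.
Qed.

Lemma has_int_approx (f : R -> R) v : has_int f v ->
  (forall x, 0 < x < 2 * PI -> continuous f x) ->
  forall eps : posreal, filter_prod (at_right 0) (at_left (2 * PI))
    (fun ab => exists y, is_RInt f (fst ab) (snd ab) y /\ ball v eps y).
Proof.
  intros (G & l0 & l1 & HG & H0 & H1 & Hv) Hc eps.
  set (e2 := mkposreal (eps / 2) (is_pos_div_2 eps)).
  exists (fun a => 0 < a < 2 * PI /\ ball l0 e2 (G a)) (fun b => 0 < b < 2 * PI /\ ball l1 e2 (G b)).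
  - apply filter_and; [apply at_right_0_interval | apply (H0 _ (locally_ball l0 e2))].
  - apply filter_and; [apply at_left_2pi_interval | apply (H1 _ (locally_ball l1 e2))].
  - intros a b [Ha Ba] [Hb Bb]; exists (G b - G a); simpl; split.
    + apply (is_RInt_derive (V := R_CompleteNormedModule) G f).
      * intros x Hx; apply HG; unfold Rmin, Rmax in Hx; destruct (Rle_dec a b); lra.
      * intros x Hx; apply Hc; unfold Rmin, Rmax in Hx; destruct (Rle_dec a b); lra.
    + unfold ball in *; simpl in *; unfold AbsRing_ball, abs, minus, plus, opp in *; simpl in *.
      apply Rabs_def2 in Ba; apply Rabs_def2 in Bb; apply Rabs_def1; lra.
Qed.

Definition cdiff (f : R -> C) (x : R) : Prop := exists l, cder f x l.

Lemma has_int_C_is_RInt_gen (f : R -> C) v : has_int_C f v ->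
  (forall x, 0 < x < 2 * PI -> cdiff f x) ->
  is_RInt_gen (V := C_R_CompleteNormedModule) f (at_right 0) (at_left (2 * PI)) v.
Proof.
  intros [H1 H2] Hd P [eps HP]; unfold filtermapi.
  assert (Hc : forall x, 0 < x < 2 * PI -> continuous (fun x => Re (f x)) x /\ continuous (fun x => Im (f x)) x).
  { intros x Hx; destruct (Hd x Hx) as [l D]; apply (cder_cont f x l D). }
  assert (A1 := has_int_approx _ _ H1 (fun x Hx => proj1 (Hc x Hx)) eps).
  assert (A2 := has_int_approx _ _ H2 (fun x Hx => proj2 (Hc x Hx)) eps).
  generalize (filter_and _ _ A1 A2); apply filter_imp.
  intros [a b] [(y1 & I1 & B1) (y2 & I2 & B2)]; exists (y1, y2); split.
  - apply (is_RInt_fct_extend_pair (U := R_NormedModule) (V := R_NormedModule) f a b y1 y2); auto.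
  - apply HP; split; auto.
Qed.

Lemma has_int_C_integral (f : R -> C) v : has_int_C f v ->
  (forall x, 0 < x < 2 * PI -> cdiff f x) -> integral f = v.
Proof.
  intros H Hd; unfold integral.
  exact (is_RInt_gen_unique (V := C_R_CompleteNormedModule) f v (has_int_C_is_RInt_gen f v H Hd)).
Qed.

Lemma chord_le x : 0 < x < 2 * PI -> chord x <= x.
Proof. intros Hx; unfold chord; generalize (sin_lt_x (x / 2)); lra. Qed.

(** Projected on the direction of [Q 0], the integrand is at least c/x near 0, because
    [chord x <= x] and [t <= -1]. Convergence would bound the integrals between two points near 0,
    whereas the logarithm is unbounded there. *)
Lemma not_ex_integral (f Q : R -> C) t : t <= -1 ->
  (forall x, 0 < x < 2 * PI -> f x = RtoC (Rpower (chord x) t) * Q x)%C ->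
  continuous (fun x => Re (Q x)) 0 -> continuous (fun x => Im (Q x)) 0 -> Q 0 <> RtoC 0 ->
  ~ ex_integral f.
Proof.
  intros Ht Ef C1 C2 HQ [l Hl].
  set (q0 := Re (Q 0)); set (q1 := Im (Q 0)).
  assert (Hc : 0 < q0 ^ 2 + q1 ^ 2) by (apply norm2_pos; auto).
  set (c := (q0 ^ 2 + q1 ^ 2) / 2).
  assert (Pc : 0 < c) by (unfold c; lra).
  set (q := fun x => q0 * Re (Q x) + q1 * Im (Q x)).
  assert (Cq : continuous q 0).
  { apply (continuous_plus (V := R_NormedModule)); apply (continuous_scal_r (V := R_NormedModule)); auto. }
  assert (Hq : at_right 0 (fun x => c < q x)).
  { apply filter_le_within. apply (Cq (fun y => c < y)). apply open_gt.
    unfold q; fold q0 q1; unfold c; simpl; simpl in Hc; lra. }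
  assert (HB := Hl _ (locally_ball l (mkposreal 1 Rlt_0_1))).
  destruct HB as [PA PB HA HB' HPQ].
  destruct (filter_ex (F := at_left (2 * PI)) _ (filter_and _ _ at_left_2pi_interval HB')) as [b [Hb PBb]].
  assert (K : at_right 0 (fun x => (0 < x < 2 * PI /\ x < 1) /\ PA x /\ c < q x)).
  { refine (filter_and _ _ (filter_and _ _ at_right_0_interval _) (filter_and _ _ HA Hq)).
    exists (mkposreal 1 Rlt_0_1); intros y Hy _; unfold ball in Hy; simpl in Hy.
    unfold AbsRing_ball, abs, minus, plus, opp in Hy; simpl in Hy; apply Rabs_def2 in Hy; lra. }
  destruct K as [del HK].
  assert (HK' : forall x, 0 < x < del -> (0 < x < 2 * PI /\ x < 1) /\ PA x /\ c < q x).
  { intros x Hx; apply HK; [ | lra]. unfold ball; simpl; unfold AbsRing_ball, abs, minus, plus, opp; simpl.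
    apply Rabs_def1; lra. }
  clear HK HA HB' Hq Cq.
  set (a2 := del / 2). assert (Ha2 : 0 < a2 < del) by (unfold a2; generalize (cond_pos del); lra).
  set (Bd := 2 * (Rabs q0 + Rabs q1)).
  assert (KB : forall a1, 0 < a1 < a2 -> c * (ln a2 - ln a1) <= Bd).
  { intros a1 Ha1.
    destruct (HK' a1 ltac:(lra)) as ((I1 & L1) & P1 & _).
    destruct (HK' a2 Ha2) as ((I2 & L2) & P2 & _).
    destruct (HPQ a1 b P1 PBb) as ([y1 z1] & J1 & [B1 B1']).
    destruct (HPQ a2 b P2 PBb) as ([y2 z2] & J2 & [B2 B2']).
    simpl fst in *; simpl snd in *.
    assert (J := is_RInt_Chasles (V := C_R_CompleteNormedModule) f a1 b a2 _ _ J1 (is_RInt_swap (V := C_R_CompleteNormedModule) _ _ _ _ J2)).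
    assert (JR := is_RInt_fct_extend_fst (U := R_NormedModule) (V := R_NormedModule) f a1 a2 _ J).
    assert (JI := is_RInt_fct_extend_snd (U := R_NormedModule) (V := R_NormedModule) f a1 a2 _ J).
    simpl in JR, JI; unfold plus, opp in JR, JI; simpl in JR, JI.
    assert (JC : is_RInt (fun x => q0 * fst (f x) + q1 * snd (f x)) a1 a2 (q0 * (y1 + - y2) + q1 * (z1 + - z2))).
    { apply (is_RInt_plus (V := R_NormedModule)); apply (is_RInt_scal (V := R_NormedModule)); auto. }
    assert (JL : is_RInt (fun x => c * / x) a1 a2 (c * (ln a2 - ln a1))).
    { apply (is_RInt_scal (V := R_NormedModule) (fun x => / x)).
      apply (is_RInt_derive (V := R_CompleteNormedModule) ln).
      - rewrite Rmin_left, Rmax_right by lra; intros x Hx; auto_derive; [lra | field; lra].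
      - rewrite Rmin_left, Rmax_right by lra; intros x Hx.
        apply (ex_derive_continuous (fun x => / x)); auto_derive; lra. }
    eapply Rle_trans.
    - apply (is_RInt_le _ _ a1 a2 _ _ ltac:(lra) JL JC).
      intros x Hx; destruct (HK' x ltac:(lra)) as ((I & L) & _ & Hqx).
      rewrite (Ef x I). assert (Hu := chord_pos x I); assert (Hux := chord_le x I).
      assert (Pw : / x <= Rpower (chord x) t).
      { apply Rle_trans with (/ chord x); [apply Rinv_le_contravar; auto | ].
        rewrite <- (Rpower_1 (chord x)) at 1 by auto; rewrite <- Rpower_Ropp.
        unfold Rpower; assert (ln (chord x) <= 0).
        { rewrite <- ln_1; destruct (Rle_lt_or_eq_dec (chord x) 1) as [L3 | ->]; [lra | | lra].
          left; apply ln_increasing; auto. }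
        destruct (Req_dec (- (1) * ln (chord x)) (t * ln (chord x))) as [-> | Nn]; [lra | ].
        left; apply exp_increasing; nra. }
      assert (0 < / x) by (apply Rinv_0_lt_compat; lra).
      replace (q0 * fst (Rpower (chord x) t * Q x)%C + q1 * snd (Rpower (chord x) t * Q x)%C)
        with (q x * Rpower (chord x) t) by (unfold q; destruct (Q x); simpl; ring).
      apply Rmult_le_compat; lra.
    - unfold ball in *; simpl in *; unfold AbsRing_ball, abs, minus, plus, opp in *; simpl in *.
      apply Rabs_def2 in B1; apply Rabs_def2 in B1'; apply Rabs_def2 in B2; apply Rabs_def2 in B2'.
      assert (Y : Rabs (y1 + - y2) <= 2) by (apply Rabs_le; lra).
      assert (Z : Rabs (z1 + - z2) <= 2) by (apply Rabs_le; lra).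
      eapply Rle_trans; [apply Rle_abs | eapply Rle_trans; [apply Rabs_triang | ]].
      rewrite !Rabs_mult; unfold Bd; generalize (Rabs_pos q0) (Rabs_pos q1); nra. }
  assert (HBd : 0 <= Bd) by (unfold Bd; generalize (Rabs_pos q0) (Rabs_pos q1); lra).
  (* Chosen so that [c * (ln a2 - ln a1)] exceeds [Bd] by exactly [c]. *)
  set (a1 := a2 * exp (- (Bd / c + 1))).
  assert (X : 0 < exp (- (Bd / c + 1)) < 1).
  { split; [apply exp_pos | rewrite <- exp_0 at 2; apply exp_increasing].
    assert (0 <= Bd / c) by (apply Rmult_le_pos; [exact HBd | left; apply Rinv_0_lt_compat; exact Pc]). lra. }
  assert (Y := KB a1 ltac:(unfold a1; split; nra)).
  unfold a1 in Y; rewrite ln_mult, ln_exp in Y by lra.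
  replace (c * (ln a2 - (ln a2 + - (Bd / c + 1)))) with (Bd + c) in Y by (field; lra). lra.
Qed.

(** * Hendriksen-van Rossum polynomials *)

Lemma poch_shift a n : poch a (S n) = a * poch (a + 1) n.
Proof.
  induction n as [ | n IH]; [simpl; ring | ].
  change (poch a (S (S n))) with (poch a (S n) * (a + INR (S n))).
  rewrite IH; simpl poch; rewrite S_INR; ring.
Qed.

Lemma poch_neq_0_le a m n : (m <= n)%nat -> poch a n <> 0 -> poch a m <> 0.
Proof.
  induction 1 as [ | n H IH]; auto; simpl; intros K; apply IH; intros E; apply K; rewrite E; ring.
Qed.

Lemma poch_factor_neq_0 a n k : poch a n <> 0 -> (k < n)%nat -> a + INR k <> 0.
Proof.
  intros H Hk E; apply (poch_neq_0_le a (S k) n); auto; simpl; rewrite E; ring.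
Qed.

Fixpoint csum (f : nat -> C) (n : nat) : C :=
  match n with O => f O | S k => (csum f k + f (S k))%C end.

Lemma sum_n_csum (f : nat -> C) n : sum_n f n = csum f n.
Proof.
  induction n as [ | n IH]; [rewrite sum_O; auto | rewrite sum_Sn, IH; auto].
Qed.

Lemma csum_ext f g n : (forall k, (k <= n)%nat -> f k = g k) -> csum f n = csum g n.
Proof.
  induction n as [ | n IH]; intros H; simpl; [apply H; lia | rewrite IH, H; auto].
Qed.

Lemma csum_scal (c : C) f n : csum (fun k => c * f k)%C n = (c * csum f n)%C.
Proof. induction n as [ | n IH]; simpl; auto; rewrite IH; ring. Qed.

Lemma csum_plus f g n : csum (fun k => f k + g k)%C n = (csum f n + csum g n)%C.
Proof. induction n as [ | n IH]; simpl; auto; rewrite IH; ring. Qed.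

Lemma csum_opp f n : csum (fun k => - f k)%C n = (- csum f n)%C.
Proof. induction n as [ | n IH]; simpl; auto; rewrite IH; ring. Qed.

Lemma csum_split0 f n : csum f (S n) = (f O + csum (fun k => f (S k)) n)%C.
Proof.
  induction n as [ | n IH]; auto.
  change (csum f (S (S n))) with (csum f (S n) + f (S (S n)))%C; rewrite IH; simpl; ring.
Qed.

Lemma csum_rev f n : csum f n = csum (fun k => f (n - k)%nat) n.
Proof.
  revert f; induction n as [ | n IH]; intros f; auto.
  rewrite (csum_split0 (fun k => f (S n - k)%nat)); simpl.
  rewrite (IH f), Cplus_comm; auto.
Qed.

Lemma INR_fact_pos n : 0 < INR (fact n).
Proof. apply lt_0_INR, lt_O_fact. Qed.

Lemma INR_fact_S n : INR (fact (S n)) = INR (S n) * INR (fact n).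
Proof. rewrite fact_simpl, mult_INR; auto. Qed.

(** Binomial form of the coefficients: (1 - b - n)_k has disappeared, and the exchange of k and n -
    k, which gives the symmetry under z -> 1/z, becomes visible. *)
Definition HR_coef (n : nat) (a b : R) (k : nat) : R :=
  INR (fact n) / (INR (fact k) * INR (fact (n - k))) * poch (a + 1) k * poch b (n - k) / poch (a + 1) n.

(* [(z d/dz)^i P_n(z; a, b)]. *)
Definition thHR (i n : nat) (a b : R) (z : C) : C :=
  csum (fun k => RtoC (INR k ^ i * HR_coef n a b k) * Cpow z k)%C n.

Lemma HR_coef_step n a b k : (k < n)%nat ->
  (INR k + 1) * (b + INR n - 1 - INR k) * HR_coef n a b (S k) = (INR n - INR k) * (a + 1 + INR k) * HR_coef n a b k.
Proof.
  intros Hk; unfold HR_coef.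
  set (m := (n - S k)%nat); assert (E : (n - k)%nat = S m) by (unfold m; lia). rewrite E.
  assert (En : INR n = INR m + INR k + 1).
  { replace n with (m + S k)%nat by (unfold m; lia). rewrite plus_INR, S_INR; ring. }
  rewrite !INR_fact_S, !S_INR, En; simpl poch. unfold Rdiv.
  generalize (INR_fact_pos k) (INR_fact_pos m) (pos_INR k) (pos_INR m); intros.
  set (q := / poch (a + 1) n). field; repeat split; lra.
Qed.

Lemma HR_coef_hyp n a b k : poch b n <> 0 -> (k <= n)%nat ->
  poch b n / poch (a + 1) n * (poch (- INR n) k * poch (a + 1) k / (poch (1 - b - INR n) k * INR (fact k)))
    = HR_coef n a b k.
Proof.
  intros Hb; induction k as [ | k IH]; intros Hk.
  - unfold HR_coef; rewrite Nat.sub_0_r; simpl. unfold Rdiv.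
    generalize (INR_fact_pos n); intros. set (q := / poch (a + 1) n). field; lra.
  - specialize (IH ltac:(lia)).
    assert (F : forall j, (j < n)%nat -> b + INR j <> 0) by (intros; eapply poch_factor_neq_0; eauto).
    assert (G : b + INR n - 1 - INR k <> 0).
    { replace (b + INR n - 1 - INR k) with (b + INR (n - S k)); [apply F; lia | rewrite minus_INR, S_INR by lia; ring]. }
    assert (G' : forall j, (j <= k)%nat -> poch (1 - b - INR n) j <> 0).
    { induction j as [ | j IHj]; intros Hj; simpl; [lra | ].
      apply Rmult_integral_contrapositive; split; [apply IHj; lia | ].
      replace (1 - b - INR n + INR j) with (- (b + INR (n - S j))) by (rewrite minus_INR, S_INR by lia; ring).
      apply Ropp_neq_0_compat, F; lia. }
    generalize (pos_INR k); intros Pk. assert (S := HR_coef_step n a b k ltac:(lia)).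
    apply (Rmult_eq_reg_l ((INR k + 1) * (b + INR n - 1 - INR k))); [ | apply Rmult_integral_contrapositive; lra].
    rewrite S, <- IH, INR_fact_S, S_INR; simpl poch; unfold Rdiv.
    generalize (INR_fact_pos k) (G' k (le_n k)); intros.
    set (q := / poch (a + 1) n). field; repeat split; lra.
Qed.

Lemma HR_thHR n a b z : poch b n <> 0 -> HR n a b z = thHR 0 n a b z.
Proof.
  intros Hb; unfold HR, hyp2F1_term, thHR. rewrite sum_n_csum, <- csum_scal; apply csum_ext.
  intros k Hk; rewrite Cmult_assoc, <- RtoC_mult, HR_coef_hyp by auto.
  simpl pow; rewrite Rmult_1_l; auto.
Qed.

Lemma cder_csum (f : nat -> R -> C) (l : nat -> C) x n :
  (forall k, cder (f k) x (l k)) -> cder (fun t => csum (fun k => f k t) n) x (csum l n).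
Proof.
  intros H; induction n as [ | n IH]; simpl; auto; apply cder_plus; auto.
Qed.

Lemma cder_thHR i n a b x : cder (fun t => thHR i n a b (cis t)) x (thHR (S i) n a b (cis x)).
Proof.
  unfold thHR; apply (cder_csum (fun k t => RtoC (INR k ^ i * HR_coef n a b k) * Cpow (cis t) k)%C); intros k.
  eapply cder_eq.
  - apply cder_mult; [apply cder_const | apply cder_pow, cder_cis].
  - rewrite <- tech_pow_Rmult, !RtoC_mult. destruct k as [ | k].
    + simpl INR; simpl; ring.
    + replace (S k - 1)%nat with k by lia. simpl; ring.
Qed.

Lemma thHR_0 n a b z : thHR 0 n a b z = csum (fun k => RtoC (HR_coef n a b k) * Cpow z k)%C n.
Proof. apply csum_ext; intros; simpl; rewrite Rmult_1_l; auto. Qed.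

Lemma thHR_O a b z : thHR 0 0 a b z = RtoC 1.
Proof. rewrite thHR_0; unfold HR_coef; simpl. rewrite <- RtoC_mult; f_equal; field. Qed.

(** This is z times [L P_n = n M P_n], written with z d/dz. By [HR_coef_step] the sum over the
    coefficients telescopes: its part up to [N] is a single monomial with the factor n - N, which
    vanishes at the end. *)
Lemma thHR_ode n a b z :
  ((1 - z) * thHR 2 n a b z)%C =
  ((b + INR n + (a + 1 - INR n) * z) * thHR 1 n a b z - INR n * (a + 1) * z * thHR 0 n a b z)%C.
Proof.
  set (f := fun k => (((1 - z) * RtoC (INR k ^ 2) - ((b + INR n) + (a + 1 - INR n) * z) * RtoC (INR k)
           + INR n * (a + 1) * z) * (RtoC (HR_coef n a b k) * Cpow z k))%C).
  assert (T : forall N, (N <= n)%nat ->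
    csum f N = (RtoC ((INR n - INR N) * (a + 1 + INR N) * HR_coef n a b N) * Cpow z (S N))%C).
  { induction N as [ | N IH]; intros HN; simpl csum; unfold f.
    - simpl INR. repeat rewrite ?RtoC_mult, ?RtoC_minus, ?RtoC_plus, ?RtoC_pow. simpl. ring.
    - fold f; rewrite IH by lia. rewrite <- HR_coef_step by lia.
      rewrite (S_INR N). repeat rewrite ?RtoC_mult, ?RtoC_minus, ?RtoC_plus, ?RtoC_pow. simpl Cpow. ring. }
  assert (Z := T n (le_n n)). replace (INR n - INR n) with 0 in Z by ring.
  rewrite !Rmult_0_l, Cmult_0_l in Z.
  assert (E : csum f n = ((1 - z) * thHR 2 n a b z - (((b + INR n) + (a + 1 - INR n) * z) * thHR 1 n a b z
            - INR n * (a + 1) * z * thHR 0 n a b z))%C).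
  { unfold thHR. rewrite <- !csum_scal.
    replace (csum f n) with (csum (fun k => ((1 - z) * (RtoC (INR k ^ 2 * HR_coef n a b k) * Cpow z k))
      + ((- (((b + INR n) + (a + 1 - INR n) * z) * (RtoC (INR k ^ 1 * HR_coef n a b k) * Cpow z k)))
       + INR n * (a + 1) * z * (RtoC (INR k ^ 0 * HR_coef n a b k) * Cpow z k)))%C n).
    - rewrite !csum_plus. 
      rewrite csum_opp; ring.
    - apply csum_ext; intros k _; unfold f. rewrite !RtoC_mult. simpl pow. rewrite !Rmult_1_r. ring. }
  rewrite Z in E. 
  transitivity (0 + (((b + INR n) + (a + 1 - INR n) * z) * thHR 1 n a b z
            - INR n * (a + 1) * z * thHR 0 n a b z))%C; [ | ring].
  rewrite E; ring.
Qed.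

Lemma thHR_1_deriv n a b z : a + 1 <> 0 ->
  thHR 1 n a b z = (INR n * (z * thHR 0 (n - 1) (a + 1) b z))%C.
Proof.
  intros Ha; destruct n as [ | n].
  - unfold thHR; simpl. rewrite !Rmult_0_l. ring.
  - rewrite thHR_0. replace (S n - 1)%nat with n by lia.
    rewrite <- !csum_scal. unfold thHR; rewrite csum_split0.
    change (INR 0) with 0. rewrite pow_ne_zero, Rmult_0_l, Cmult_0_l, Cplus_0_l by discriminate.
    apply csum_ext; intros k Hk.
    assert (E : INR (S k) ^ 1 * HR_coef (S n) a b (S k) = INR (S n) * HR_coef n (a + 1) b k).
    { unfold HR_coef; rewrite pow_1. replace (S n - S k)%nat with (n - k)%nat by lia.
      rewrite !INR_fact_S, !poch_shift; unfold Rdiv; rewrite (Rinv_mult (a + 1)).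
      generalize (INR_fact_pos k) (INR_fact_pos (n - k)) (pos_INR k); intros.
      rewrite !S_INR; set (q := / poch (a + 1 + 1) n). field; repeat split; lra. }
    rewrite E, RtoC_mult; simpl; ring.
Qed.

(** The operator n - z d/dz kills the top coefficient. It is the mirror image of [thHR_1_deriv]
    under reversal, hence raises b instead of a. *)
Lemma thHR_lower i n a b z : a + INR n <> 0 -> (1 <= n)%nat ->
  (INR n * thHR i n a b z - thHR (S i) n a b z)%C =
  (RtoC (INR n * b / (a + INR n)) * thHR i (n - 1) a (b + 1) z)%C.
Proof.
  intros Ha Hn; destruct n as [ | n]; [lia | ]. replace (S n - 1)%nat with n by lia.
  unfold thHR; unfold Cminus; rewrite <- csum_scal, <- csum_opp, <- csum_plus, <- csum_scal.
  cbn [csum].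
  match goal with |- (csum ?f n + ?y)%C = csum ?g n => assert (E0 : y = RtoC 0) end.
  { rewrite <- tech_pow_Rmult, !RtoC_mult; ring. }
  rewrite E0, Cplus_0_r; apply csum_ext; intros k Hk.
  assert (E : (INR (S n) - INR k) * HR_coef (S n) a b k = INR (S n) * b / (a + INR (S n)) * HR_coef n a (b + 1) k).
  { unfold HR_coef. replace (S n - k)%nat with (S (n - k)) by lia.
    rewrite (poch_shift b), (INR_fact_S n), (INR_fact_S (n - k)).
    change (poch (a + 1) (S n)) with (poch (a + 1) n * (a + 1 + INR n)).
    unfold Rdiv; rewrite (Rinv_mult (poch (a + 1) n)).
    generalize (INR_fact_pos k) (INR_fact_pos (n - k)) (pos_INR (n - k)); intros.
    rewrite !S_INR in *. rewrite minus_INR in * by auto. set (q := / poch (a + 1) n). field; repeat split; lra. }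
  replace (RtoC (INR (S n) * b / (a + INR (S n))) * (RtoC (INR k ^ i * HR_coef n a (b + 1) k) * Cpow z k))%C with
    (RtoC (INR k ^ i) * RtoC (INR (S n) * b / (a + INR (S n)) * HR_coef n a (b + 1) k) * Cpow z k)%C by (rewrite !RtoC_mult; ring).
  rewrite <- E, <- tech_pow_Rmult, !RtoC_mult, RtoC_minus; ring.
Qed.

(** * Reversal z -> 1/z, and the exceptional polynomials as Wronskians *)

Definition rev_const (a b : R) (n : nat) : R := poch (a + 1) n / poch b n.

Lemma HR_coef_rev n a b k : (k <= n)%nat -> poch (a + 1) n <> 0 -> poch b n <> 0 ->
  HR_coef n (b - 1) (a + 1) (n - k) = rev_const a b n * HR_coef n a b k.
Proof.
  intros Hk H1 H2; unfold HR_coef, rev_const. replace (n - (n - k))%nat with k by lia.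
  replace (b - 1 + 1) with b by ring.
  generalize (INR_fact_pos k) (INR_fact_pos (n - k)); intros. field; repeat split; auto; lra.
Qed.

Lemma Cpow_inv_sub z n k : z <> RtoC 0 -> (k <= n)%nat -> Cpow (/ z) (n - k) = (Cpow z k / Cpow z n)%C.
Proof.
  intros Hz Hk. rewrite Cpow_inv by auto.
  replace (Cpow z n) with (Cpow z (n - k) * Cpow z k)%C by (rewrite <- Cpow_add_r; f_equal; lia).
  field; split; apply Cpow_nz; auto.
Qed.

Lemma thHR_0_rev n a b z : poch (a + 1) n <> 0 -> poch b n <> 0 -> z <> RtoC 0 ->
  thHR 0 n (b - 1) (a + 1) (/ z) = (RtoC (rev_const a b n) * thHR 0 n a b z / Cpow z n)%C.
Proof.
  intros H1 H2 Hz; rewrite !thHR_0, csum_rev.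
  transitivity (csum (fun k => (RtoC (rev_const a b n) / Cpow z n) * (RtoC (HR_coef n a b k) * Cpow z k))%C n).
  - apply csum_ext; intros k Hk; rewrite HR_coef_rev, Cpow_inv_sub, RtoC_mult by auto.
    field; apply Cpow_nz; auto.
  - rewrite csum_scal; field; apply Cpow_nz; auto.
Qed.

Lemma thHR_1_rev n a b z : poch (a + 1) n <> 0 -> poch b n <> 0 -> z <> RtoC 0 ->
  thHR 1 n (b - 1) (a + 1) (/ z) =
  (RtoC (rev_const a b n) * (INR n * thHR 0 n a b z - thHR 1 n a b z) / Cpow z n)%C.
Proof.
  intros H1 H2 Hz; rewrite !thHR_0. unfold thHR; rewrite csum_rev.
  transitivity (csum (fun k => (RtoC (rev_const a b n) / Cpow z n) * (INR n * (RtoC (HR_coef n a b k) * Cpow z k) +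
       - (RtoC (INR k ^ 1 * HR_coef n a b k) * Cpow z k)))%C n).
  - apply csum_ext; intros k Hk. rewrite HR_coef_rev, Cpow_inv_sub, !RtoC_mult, minus_INR by auto.
    rewrite !pow_1, RtoC_minus. field; apply Cpow_nz; auto.
  - rewrite csum_scal, csum_plus, csum_scal, csum_opp; field; apply Cpow_nz; auto.
Qed.

Lemma deriv_HR n a b z : a + 1 <> 0 -> poch b n <> 0 ->
  (INR n * (z * HR (n - 1) (a + 1) b z))%C = thHR 1 n a b z.
Proof.
  intros Ha Hb; rewrite HR_thHR by (apply (poch_neq_0_le b (n - 1) n); [lia | auto]).
  rewrite thHR_1_deriv; auto.
Qed.

Lemma XHR1_form l n a b z : a + 1 <> 0 -> poch b l <> 0 -> poch b n <> 0 ->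
  (z * XHR1 l n a b z)%C = (thHR 0 l a b z * thHR 1 n a b z - thHR 1 l a b z * thHR 0 n a b z)%C.
Proof.
  intros Ha Hl Hn; unfold XHR1.
  rewrite <- !deriv_HR by auto. rewrite <- !HR_thHR by auto. ring.
Qed.

Lemma XHR2_form l n a b z : a + 1 <> 0 -> - b + 1 <> 0 -> poch (- a) l <> 0 -> poch b n <> 0 ->
  (z * XHR2 l n a b z)%C =
  ((1 - z) * (thHR 0 l (- b) (- a) z * thHR 1 n a b z - thHR 1 l (- b) (- a) z * thHR 0 n a b z)
    - RtoC (a + b) * z * thHR 0 l (- b) (- a) z * thHR 0 n a b z)%C.
Proof.
  intros Ha Hb Hl Hn; unfold XHR2.
  rewrite <- !deriv_HR by auto. rewrite <- !HR_thHR by auto. 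
  replace (1 - b) with (- b + 1) by ring. ring.
Qed.

(** Applied to the seed polynomial, [thHR_lower] turns the term of degree l - 1 into l times the
    seed minus its z d/dz, which exposes the Wronskian. The remaining coefficient l + 1 + a becomes
    the power of z in the seed. [XHR4_form] works in the same way. *)
Lemma XHR3_form l n a b z : a + 1 <> 0 -> b + INR l - 1 <> 0 -> (1 <= l)%nat ->
  poch (a + 1) l <> 0 -> poch b n <> 0 ->
  XHR3 l n a b z =
  (RtoC (poch b l / poch (a + 1) l) *
    (thHR 0 l (b - 1) (a + 1) z * thHR 1 n a b z - thHR 1 l (b - 1) (a + 1) z * thHR 0 n a b z
     + RtoC (INR l + 1 + a) * thHR 0 l (b - 1) (a + 1) z * thHR 0 n a b z))%C.
Proof.
  intros Ha Hb H1 Hl Hn; unfold XHR3.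
  assert (E := thHR_lower 0 l (b - 1) (a + 1) z ltac:(lra) H1).
  rewrite <- deriv_HR by auto.
  replace (a + 2) with (a + 1 + 1) by ring.
  rewrite (HR_thHR (l - 1) (b - 1)).
  2: { destruct l as [ | l]; [lia | ]. replace (S l - 1)%nat with l by lia.
       rewrite poch_shift in Hl; intros K; apply Hl; rewrite K; ring. }
  replace (INR l * (a + 1) / (b - 1 + INR l)) with ((a + 1) * INR l / (b + INR l - 1)) in E by (field; lra).
  rewrite (HR_thHR l), (HR_thHR n) by auto.
  rewrite <- E. rewrite !RtoC_plus. ring.
Qed.

Lemma XHR4_form l n a b z : a + 1 <> 0 -> - a + INR l - 1 <> 0 -> (1 <= l)%nat ->
  poch (- b + 1) l <> 0 -> poch b n <> 0 ->
  XHR4 l n a b z =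
  (RtoC (poch (- a) l / poch (- b + 1) l) *
    ((z - 1) * (thHR 0 l (- a - 1) (- b + 1) z * thHR 1 n a b z - thHR 1 l (- a - 1) (- b + 1) z * thHR 0 n a b z
     + RtoC (INR l + 1 - b) * thHR 0 l (- a - 1) (- b + 1) z * thHR 0 n a b z)
     + RtoC (a + b) * z * thHR 0 l (- a - 1) (- b + 1) z * thHR 0 n a b z))%C.
Proof.
  intros Ha Hb H1 Hl Hn; unfold XHR4.
  assert (E := thHR_lower 0 l (- a - 1) (- b + 1) z ltac:(lra) H1).
  rewrite <- deriv_HR by auto.
  replace (- b + 2) with (- b + 1 + 1) by ring.
  rewrite (HR_thHR (l - 1) (- a - 1)).
  2: { destruct l as [ | l]; [lia | ]. replace (S l - 1)%nat with l by lia.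
       rewrite poch_shift in Hl; intros K; apply Hl; rewrite K; ring. }
  replace (INR l * (- b + 1) / (- a - 1 + INR l)) with ((- b + 1) * INR l / (- a + INR l - 1)) in E by (field; lra).
  rewrite (HR_thHR l), (HR_thHR n) by auto.
  rewrite <- E. rewrite !RtoC_plus, !RtoC_minus, !RtoC_plus. ring.
Qed.

(** * The weight on the circle *)

Definition cweight (a b x : R) : C := weight0 a b (cis x).

Lemma sin_half x : sin x = 2 * sin (x / 2) * cos (x / 2).
Proof. rewrite <- sin_2a; f_equal; field. Qed.

Lemma cos_half x : cos x = 1 - 2 * sin (x / 2) * sin (x / 2).
Proof. rewrite <- cos_2a_sin; f_equal; field. Qed.

Lemma Cmod_cis t : Cmod (cis t) = 1.
Proof.
  unfold Cmod, cis; simpl. replace (_ + _) with 1; [apply sqrt_1 | ].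
  generalize (sin2_cos2 t); unfold Rsqr; lra.
Qed.

Lemma Cmod_one_minus_cis x : 0 < x < 2 * PI -> Cmod (1 - cis x) = chord x.
Proof.
  intros Hx; assert (Hu := chord_pos x Hx).
  unfold Cmod, cis; simpl. rewrite (sin_half x), (cos_half x).
  rewrite <- (sqrt_Rsqr (chord x)) by lra. f_equal; unfold Rsqr, chord.
  generalize (sin2_cos2 (x / 2)); unfold Rsqr.
  set (S := sin (x / 2)); set (c := cos (x / 2)); intros H.
  transitivity (4 * S * S * (S * S + c * c)); [ring | rewrite H; ring].
Qed.

Lemma Carg_opp_cis x : 0 < x < 2 * PI -> Carg (- cis x) = x - PI.
Proof.
  intros Hx; unfold Carg. rewrite Cmod_opp, Cmod_cis. unfold cis; simpl.
  replace (- cos x / 1) with (- cos x) by field.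
  destruct (Rlt_dec (- sin x) 0) as [L | L].
  - assert (x < PI). { destruct (Rlt_or_le x PI); auto. assert (sin x <= 0) by (apply sin_le_0; lra). lra. }
    replace (- cos x) with (cos (PI - x)) by (rewrite cos_minus, cos_PI, sin_PI; ring).
    rewrite acos_cos by lra; ring.
  - assert (PI <= x). { destruct (Rle_or_lt PI x); auto. assert (0 < sin x) by (apply sin_gt_0; lra). lra. }
    replace (- cos x) with (cos (x - PI)) by (rewrite cos_minus, cos_PI, sin_PI; ring).
    apply acos_cos; lra.
Qed.

Lemma Carg_one_minus_cis x : 0 < x < 2 * PI -> Carg (1 - cis x) = (x - PI) / 2.
Proof.
  intros Hx; assert (Hu := chord_pos x Hx). unfold Carg. rewrite Cmod_one_minus_cis by auto. unfold cis; simpl.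
  rewrite (sin_half x), (cos_half x).
  replace ((1 + - (1 - 2 * sin (x / 2) * sin (x / 2))) / chord x) with (sin (x / 2)) by (unfold chord in *; field; lra).
  replace (0 + - (2 * sin (x / 2) * cos (x / 2))) with (- (chord x * cos (x / 2))) by (unfold chord; ring).
  rewrite <- cos_shift.
  destruct (Rlt_dec (- (chord x * cos (x / 2))) 0) as [L | L].
  - assert (x < PI).
    { destruct (Rlt_or_le x PI); auto. assert (cos (x / 2) <= 0) by (apply cos_le_0; lra). nra. }
    rewrite acos_cos by lra; field.
  - assert (PI <= x).
    { destruct (Rle_or_lt PI x); auto. assert (0 < cos (x / 2)) by (apply cos_gt_0; lra). nra. }
    rewrite <- cos_neg, acos_cos by lra; field.
Qed.

Lemma cis_plus s t : cis (s + t) = (cis s * cis t)%C.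
Proof. unfold cis, Cmult; simpl; rewrite cos_plus, sin_plus; f_equal; ring. Qed.

(** On the open arc the arguments of -z and 1 - z are x - PI and (x - PI)/2, both linear in x; so
    the weight takes the form of the Cauchy beta integrand. *)
Lemma cweight_polar a b x : 0 < x < 2 * PI ->
  cweight a b x = (RtoC (Rpower (chord x) (a + b)) * cis ((a - b) / 2 * (x - PI)))%C.
Proof.
  intros Hx; unfold cweight, weight0, Cpowr.
  rewrite Cmod_opp, Cmod_cis, Carg_opp_cis, Cmod_one_minus_cis, Carg_one_minus_cis by auto.
  replace (Rpower 1 (- b)) with 1 by (unfold Rpower; rewrite ln_1, Rmult_0_r, exp_0; auto).
  replace ((a - b) / 2 * (x - PI)) with (- b * (x - PI) + (a + b) * ((x - PI) / 2)) by field.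
  rewrite cis_plus; ring.
Qed.

Lemma cweight_components a b x : 0 < x < 2 * PI ->
  cweight a b x = (chord_cos (a + b) ((a - b) / 2) 0 x, chord_cos (a + b) ((a - b) / 2) (- (PI / 2)) x).
Proof.
  intros Hx; rewrite cweight_polar by auto; unfold chord_cos, cis, Cmult; simpl.
  rewrite Rplus_0_r. f_equal; [ring | ].
  rewrite <- (cos_neg (_ + - _)). 
  replace (- ((a - b) / 2 * (x - PI) + - (PI / 2))) with (PI / 2 - (a - b) / 2 * (x - PI)) by ring.
  rewrite cos_shift; ring.
Qed.

Lemma Cmod_cweight a b x : 0 < x < 2 * PI -> Cmod (cweight a b x) = Rpower (chord x) (a + b).
Proof.
  intros Hx; rewrite cweight_polar, Cmod_mult, Cmod_cis, Cmod_R, Rmult_1_r by auto.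
  apply Rabs_pos_eq; left; apply Rpower_pos.
Qed.

Lemma one_minus_cis_neq_0 x : 0 < x < 2 * PI -> (1 - cis x)%C <> RtoC 0.
Proof.
  intros Hx E; assert (H := Cmod_one_minus_cis x Hx). rewrite E, Cmod_0 in H.
  generalize (chord_pos x Hx); lra.
Qed.

Lemma cis_neq_0 x : cis x <> RtoC 0.
Proof. intros E; generalize (Cmod_cis x); rewrite E, Cmod_0; lra. Qed.

Lemma one_minus_cis_polar x : (1 - cis x)%C = (RtoC (chord x) * cis ((x - PI) / 2))%C.
Proof.
  unfold cis, Cmult, chord; simpl. rewrite (sin_half x), (cos_half x).
  replace ((x - PI) / 2) with (- (PI / 2 - x / 2)) by field.
  rewrite cos_neg, sin_neg, cos_shift, sin_shift. unfold Cminus, Cplus, Copp; simpl. f_equal; ring.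
Qed.

Lemma cweight_succ a b x : 0 < x < 2 * PI -> cweight (a + 1) b x = ((1 - cis x) * cweight a b x)%C.
Proof.
  intros Hx; rewrite !cweight_polar, one_minus_cis_polar by auto.
  replace (a + 1 + b) with (1 + (a + b)) by ring. rewrite Rpower_plus, Rpower_1 by (apply chord_pos; auto).
  replace ((a + 1 - b) / 2 * (x - PI)) with ((x - PI) / 2 + (a - b) / 2 * (x - PI)) by field.
  rewrite cis_plus, RtoC_mult; ring.
Qed.

Lemma cder_cweight a b x : 0 < x < 2 * PI ->
  cder (cweight a b) x (cweight a b x * (- RtoC b - RtoC (a + b) * cis x / (1 - cis x)))%C.
Proof.
  intros Hx; assert (Hu := chord_pos x Hx).
  (* This is z/(1-z) = -1/2 + (i/2) cot(x/2). The real part accounts for the phase of 1 - z, the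
     imaginary part for its modulus. *)
  assert (Z : (cis x / (1 - cis x))%C = ((- / 2)%R, (cos (x / 2) / chord x)%R)).
  { assert (N := one_minus_cis_neq_0 x Hx).
    assert (E : cis x = (((- / 2)%R, (cos (x / 2) / chord x)%R) * (1 - cis x))%C).
    { unfold cis, Cmult; simpl. rewrite (sin_half x), (cos_half x). unfold chord in *.
      generalize (sin2_cos2 (x / 2)); unfold Rsqr.
      set (S := sin (x / 2)) in *; set (c := cos (x / 2)); intros H.
      assert (Hc : c * c = 1 - S * S) by lra.
      f_equal.
      - replace (- / 2 * (1 + - (1 - 2 * S * S)) - c / (2 * S) * (0 + - (2 * S * c))) with (- (S * S) + c * c) by (field; lra).
        rewrite Hc; ring.
      - field; lra. }
    rewrite E at 1. field; auto. }
  replace (- RtoC b - RtoC (a + b) * cis x / (1 - cis x))%C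
    with (RtoC (- b) - RtoC (a + b) * (cis x / (1 - cis x)))%C
    by (rewrite RtoC_opp; field; apply one_minus_cis_neq_0; auto).
  rewrite Z; clear Z.
  apply (cder_ext_loc (fun x => RtoC (Rpower (chord x) (a + b)) * cis ((a - b) / 2 * (x - PI)))%C); auto.
  { intros t Ht; rewrite cweight_polar; auto. }
  rewrite cweight_polar by auto.
  assert (DR : is_derive (fun t => Rpower (chord t) (a + b)) x ((a + b) * cos (x / 2) / chord x * Rpower (chord x) (a + b))).
  { evar_last; [unfold Rpower, chord; auto_derive; [exact Hu | reflexivity] | ].
    unfold Rpower, chord in *. change (x * / 2) with (x / 2). field; lra. }
  set (P := Rpower (chord x) (a + b)) in *.
  split; simpl.
  - evar_last.
    + apply (is_derive_minus (fun t => Rpower (chord t) (a + b) * cos ((a - b) / 2 * (t - PI)))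
        (fun t => 0 * sin ((a - b) / 2 * (t - PI)))).
      * apply is_derive_mult_R; [exact DR | auto_derive; [auto | reflexivity]].
      * apply is_derive_scal; auto_derive; [auto | reflexivity].
    + unfold minus, plus, opp; simpl. replace (x + - PI) with (x - PI) by ring.
      set (c := cos (_ * (x - PI))); set (s := sin (_ * (x - PI))).
      change (Rpower (chord x) (a + b)) with P. field; lra.
  - evar_last.
    + apply (is_derive_plus (fun t => Rpower (chord t) (a + b) * sin ((a - b) / 2 * (t - PI)))
        (fun t => 0 * cos ((a - b) / 2 * (t - PI)))).
      * apply is_derive_mult_R; [exact DR | auto_derive; [auto | reflexivity]].
      * apply is_derive_scal; auto_derive; [auto | reflexivity].
    + unfold minus, plus, opp; simpl. replace (x + - PI) with (x - PI) by ring.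
      set (c := cos (_ * (x - PI))); set (s := sin (_ * (x - PI))).
      change (Rpower (chord x) (a + b)) with P. field; lra.
Qed.

Lemma cweight_moment a b : -1 < a + b ->
  exists v : R, is_lim_seq (prod1 (beta_factor a b)) v /\ has_int_C (cweight a b) (RtoC (2 * PI * v)).
Proof.
  intros Hs; destruct (chord_cos_moment a b Hs) as (v & L & M); exists v; split; auto. split.
  - apply (has_int_ext (chord_cos (a + b) ((a - b) / 2) 0)).
    + intros x Hx; rewrite cweight_components; auto.
    + generalize (M 0); rewrite cos_0, Rmult_1_r; auto.
  - apply (has_int_ext (chord_cos (a + b) ((a - b) / 2) (- (PI / 2)))).
    + intros x Hx; rewrite cweight_components; auto.
    + generalize (M (- (PI / 2))); rewrite cos_neg, cos_PI2, !Rmult_0_r; auto.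
Qed.

(** * Boundary behaviour at z = 1 *)

Lemma cweight_vanishes a b t K (p : R -> C) : 0 < a + b + t ->
  at_right 0 (fun x => Cmod (p x) <= K * Rpower (chord x) t) ->
  at_left (2 * PI) (fun x => Cmod (p x) <= K * Rpower (chord x) t) ->
  vanishes_at_ends (fun x => cweight a b x * p x)%C.
Proof.
  intros Ht H0 H1; destruct (chord_power_lim (a + b + t) Ht) as [L0 L1].
  assert (B : forall x, 0 < x < 2 * PI -> Cmod (p x) <= K * Rpower (chord x) t ->
     Rabs (Cmod (cweight a b x * p x)) <= K * Rpower (chord x) (a + b + t)).
  { intros x Hx Hp; rewrite Rabs_pos_eq, Cmod_mult, Cmod_cweight, (Rpower_plus (a + b) t) by (auto using Cmod_ge_0).
    replace (K * (Rpower (chord x) (a + b) * Rpower (chord x) t)) with (Rpower (chord x) (a + b) * (K * Rpower (chord x) t)) by ring.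
    apply Rmult_le_compat_l; auto; left; apply Rpower_pos. }
  split; (eapply filterlim_0_le; [typeclasses eauto | | eassumption]).
  - generalize (filter_and _ _ at_right_0_interval H0); apply filter_imp; intros x [Hx Hp]; auto.
  - generalize (filter_and _ _ at_left_2pi_interval H1); apply filter_imp; intros x [Hx Hp]; auto.
Qed.

Lemma cder_bounded p e l : cder p e l -> exists K, locally e (fun x => Cmod (p x) <= K).
Proof.
  intros D; destruct (cder_cont _ _ _ D) as [C1 C2].
  set (r := Rabs (Re (p e)) + 1); set (s := Rabs (Im (p e)) + 1).
  exists (r + s).
  assert (L1 : locally e (fun x => ball (Re (p e)) 1 (Re (p x))))
    by exact (C1 _ (locally_ball _ (mkposreal 1 Rlt_0_1))).
  assert (L2 : locally e (fun x => ball (Im (p e)) 1 (Im (p x))))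
    by exact (C2 _ (locally_ball _ (mkposreal 1 Rlt_0_1))).
  generalize (filter_and _ _ L1 L2); apply filter_imp; intros x [B1 B2].
  unfold ball in *; simpl in *; unfold AbsRing_ball, abs, minus, plus, opp in *; simpl in *.
  assert (R1 : Rabs (Re (p x)) <= r).
  { unfold r. replace (Re (p x)) with (Re (p x) + - Re (p e) + Re (p e)) by ring.
    eapply Rle_trans; [apply Rabs_triang | ]. lra. }
  assert (R2 : Rabs (Im (p x)) <= s).
  { unfold s. replace (Im (p x)) with (Im (p x) + - Im (p e) + Im (p e)) by ring.
    eapply Rle_trans; [apply Rabs_triang | ]. lra. }
  replace (p x) with (RtoC (Re (p x)) + Ci * RtoC (Im (p x)))%C
   by (destruct (p x); unfold Ci, RtoC, Cplus, Cmult; simpl; f_equal; ring).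
  eapply Rle_trans; [apply Cmod_triangle | ].
  rewrite Cmod_mult, !Cmod_R, Cmod_Ci. lra.
Qed.

Lemma is_derive_lipschitz (f : R -> R) e l : is_derive f e l -> f e = 0 ->
  locally e (fun x => Rabs (f x) <= (Rabs l + 1) * Rabs (x - e)).
Proof.
  intros D E; apply is_derive_Reals in D; destruct (D 1 Rlt_0_1) as [del Hd].
  exists del.
  enough (G : forall x : R, Rabs (x - e) < del -> Rabs (f x) <= (Rabs l + 1) * Rabs (x - e))
    by (intros x Hx; apply G; exact Hx).
  intros x Hx.
  destruct (Req_dec x e) as [-> | N]; [rewrite E, Rabs_R0; unfold Rminus; rewrite Rplus_opp_r, Rabs_R0; lra | ].
  assert (H := Hd (x - e) ltac:(lra) Hx). replace (e + (x - e)) with x in H by ring.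
  rewrite E, Rminus_0_r in H.
  assert (Q : Rabs (f x / (x - e)) <= Rabs l + 1).
  { replace (f x / (x - e)) with ((f x / (x - e) - l) + l) by ring.
    eapply Rle_trans; [apply Rabs_triang | ]. lra. }
  replace (f x) with (f x / (x - e) * (x - e)) by (field; lra).
  rewrite Rabs_mult; apply Rmult_le_compat_r; auto; apply Rabs_pos.
Qed.

Lemma cder_lipschitz p e l : cder p e l -> p e = RtoC 0 ->
  exists K, 0 <= K /\ locally e (fun x => Cmod (p x) <= K * Rabs (x - e)).
Proof.
  intros [D1 D2] E.
  assert (E1 : Re (p e) = 0) by (rewrite E; auto).
  assert (E2 : Im (p e) = 0) by (rewrite E; auto).
  assert (L1 := is_derive_lipschitz _ _ _ D1 E1).
  assert (L2 := is_derive_lipschitz _ _ _ D2 E2).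
  exists ((Rabs (- Im l) + 1) + (Rabs (Re l) + 1)); split.
  { generalize (Rabs_pos (- Im l)) (Rabs_pos (Re l)); lra. }
  generalize (filter_and _ _ L1 L2); apply filter_imp; intros x [B1 B2].
  replace (p x) with (RtoC (Re (p x)) + Ci * RtoC (Im (p x)))%C
   by (destruct (p x); unfold Ci, RtoC, Cplus, Cmult; simpl; f_equal; ring).
  eapply Rle_trans; [apply Cmod_triangle | ].
  rewrite Cmod_mult, !Cmod_R, Cmod_Ci. rewrite Rmult_plus_distr_r. lra.
Qed.

Lemma cweight_vanishes_bounded a b p l0 l1 : 0 < a + b -> cder p 0 l0 -> cder p (2 * PI) l1 ->
  vanishes_at_ends (fun x => cweight a b x * p x)%C.
Proof.
  intros Hs D0 D1; destruct (cder_bounded _ _ _ D0) as [K0 B0]; destruct (cder_bounded _ _ _ D1) as [K1 B1].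
  apply (cweight_vanishes a b 0 (Rmax K0 K1)); [lra | | ].
  - generalize (filter_and _ _ at_right_0_interval (filter_le_within _ _ B0)); apply filter_imp.
    intros x [Hx Hb]; rewrite Rpower_O, Rmult_1_r by (apply chord_pos; auto).
    eapply Rle_trans; [apply Hb | apply Rmax_l].
  - generalize (filter_and _ _ at_left_2pi_interval (filter_le_within _ _ B1)); apply filter_imp.
    intros x [Hx Hb]; rewrite Rpower_O, Rmult_1_r by (apply chord_pos; auto).
    eapply Rle_trans; [apply Hb | apply Rmax_r].
Qed.

(** A zero of [p] gains one power of [chord]: near either end the distance to it is at most
    [3 * chord], by [sin_ge_third]. *)
Lemma cweight_vanishes_zero a b p l0 l1 : 0 < a + b + 1 -> cder p 0 l0 -> cder p (2 * PI) l1 ->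
  p 0 = RtoC 0 -> p (2 * PI) = RtoC 0 ->
  vanishes_at_ends (fun x => cweight a b x * p x)%C.
Proof.
  intros Hs D0 D1 E0 E1; generalize PI_RGT_0; intros HP.
  destruct (cder_lipschitz _ _ _ D0 E0) as (K0 & P0 & B0); destruct (cder_lipschitz _ _ _ D1 E1) as (K1 & P1 & B1).
  assert (M0 : K0 <= Rmax K0 K1) by apply Rmax_l. assert (M1 : K1 <= Rmax K0 K1) by apply Rmax_r.
  assert (A0 : at_right 0 (fun x => x < PI)).
  { exists (mkposreal _ HP); intros y Hy Hy0. unfold ball in Hy; simpl in *.
    unfold AbsRing_ball, abs, minus, plus, opp in Hy; simpl in Hy; apply Rabs_def2 in Hy; lra. }
  assert (A1 : at_left (2 * PI) (fun x => PI < x)).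
  { exists (mkposreal _ HP); intros y Hy Hy0. unfold ball in Hy; simpl in *.
    unfold AbsRing_ball, abs, minus, plus, opp in Hy; simpl in Hy; apply Rabs_def2 in Hy; lra. }
  apply (cweight_vanishes a b 1 (3 * Rmax K0 K1)); [lra | | ].
  - generalize (filter_and _ _ A0 (filter_and _ _ at_right_0_interval (filter_le_within _ _ B0))); apply filter_imp.
    intros x [Hp [Hx Hb]]; rewrite Rpower_1 by (apply chord_pos; auto).
    eapply Rle_trans; [apply Hb | ]. rewrite Rminus_0_r, Rabs_pos_eq by lra.
    assert (S := sin_ge_third (x / 2) ltac:(lra)). unfold chord; nra.
  - generalize (filter_and _ _ A1 (filter_and _ _ at_left_2pi_interval (filter_le_within _ _ B1))); apply filter_imp.
    intros x [Hp [Hx Hb]]; rewrite Rpower_1 by (apply chord_pos; auto).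
    eapply Rle_trans; [apply Hb | ]. rewrite <- Rabs_Ropp, Rabs_pos_eq by lra.
    assert (S := sin_ge_third (PI - x / 2) ltac:(lra)). rewrite sin_PI_x in S. unfold chord; nra.
Qed.

(** * Reduction to a single moment *)

(* As for [cder], [q] is [z dp/dz] on the circle. *)
Definition zder (p q : C -> C) : Prop := forall x, cder (fun t => p (cis t)) x (q (cis x)).

(** Solution of the recursion that [base_relation_diag] produces from (n; a, b+1) to (n+1; a, b),
    with initial value b(a+1)/(a+b+1) at n = 0. *)
Definition diag_const (n : nat) (a b : R) : R :=
  b * INR (fact n) * poch (a + b + 1) n / (poch (a + 1) n) ^ 2 * ((a + 1) / (a + b + 1)).

Lemma RtoC_neq_0 r : r <> 0 -> RtoC r <> RtoC 0.
Proof. intros H E; apply H; apply (RtoC_inj _ _ E). Qed.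

Lemma zder_thHR i n a b : zder (thHR i n a b) (thHR (S i) n a b).
Proof. intros x; apply cder_thHR. Qed.

Lemma zder_mult p p' q q' : zder p p' -> zder q q' ->
  zder (fun z => p z * q z)%C (fun z => p' z * q z + p z * q' z)%C.
Proof. intros H1 H2 x; apply (cder_mult (fun t => p (cis t)) (fun t => q (cis t))); auto. Qed.

Lemma zder_plus p p' q q' : zder p p' -> zder q q' ->
  zder (fun z => p z + q z)%C (fun z => p' z + q' z)%C.
Proof. intros H1 H2 x; apply (cder_plus (fun t => p (cis t)) (fun t => q (cis t))); auto. Qed.

Lemma zder_const c : zder (fun _ => c) (fun _ => RtoC 0).
Proof. intros x; apply cder_const. Qed.

Lemma zder_id : zder (fun z => z) (fun z => z).
Proof. intros x; apply cder_cis. Qed.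

Lemma zder_minus p p' q q' : zder p p' -> zder q q' ->
  zder (fun z => p z - q z)%C (fun z => p' z - q' z)%C.
Proof. intros H1 H2 x; apply (cder_minus (fun t => p (cis t)) (fun t => q (cis t))); auto. Qed.

Lemma zder_inv_pow n : zder (fun z => / Cpow z n)%C (fun z => - INR n / Cpow z n)%C.
Proof.
  intros x; eapply cder_eq.
  - apply (cder_inv (fun t => Cpow (cis t) n)); [apply Cpow_nz, cis_neq_0 | apply cder_pow, cder_cis].
  - assert (H := cis_neq_0 x). destruct n as [ | n]; [simpl; field | ].
    replace (S n - 1)%nat with n by lia. simpl Cpow. field. split; auto; apply Cpow_nz; auto.
Qed.

(* Times the weight, the right-hand side is [z d/dz] of [w (1-z) p]: this is
   biorthogonality before any integration. *)
Lemma base_relation_offdiag m n a b : m <> n -> exists p q, zder p q /\ forall x, let z := cis x in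
  (thHR 0 n a b z / Cpow z n * ((1 - z) * thHR 1 m a b z - (a + 1) * z * thHR 0 m a b z))%C =
  ((1 - z) * q z - (b + (a + 1) * z) * p z)%C.
Proof.
  intros Hmn; assert (N : RtoC (INR m - INR n) <> RtoC 0).
  { apply RtoC_neq_0; intros E; apply Hmn, INR_eq; lra. }
  eexists; eexists; split.
  (* Lagrange's identity: the two differential equations differ only in the eigenvalue, so the
     weighted derivative of the Wronskian of P_m and P_n over z^n is m - n times the left-hand
     side. *)
  - apply (zder_mult _ _ _ _ (zder_const (/ RtoC (INR m - INR n))%C)
      (zder_mult _ _ _ _ (zder_minus _ _ _ _
         (zder_mult _ _ _ _ (zder_thHR 0 n a b) (zder_thHR 1 m a b))
         (zder_mult _ _ _ _ (zder_thHR 0 m a b) (zder_thHR 1 n a b))) (zder_inv_pow n))).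
  - intros x; cbv beta zeta; assert (Hz := cis_neq_0 x); set (z := cis x) in *; clearbody z.
    assert (Om := thHR_ode m a b z); assert (On := thHR_ode n a b z).
    assert (HZ := Cpow_nz z n Hz).
    set (Z := Cpow z n) in *; clearbody Z.
    set (m2 := thHR 2 m a b z) in *; set (m1 := thHR 1 m a b z) in *; set (m0 := thHR 0 m a b z) in *.
    set (n2 := thHR 2 n a b z) in *; set (n1 := thHR 1 n a b z) in *; set (n0 := thHR 0 n a b z) in *.
    clearbody m0 m1 m2 n0 n1 n2.
    (* Second derivatives are grouped with their factor [1 - z], so that [thHR_ode] rewrites them
       without a division by [1 - z]; later identities use the same device. *)
    transitivity (/ RtoC (INR m - INR n) / Z * (n0 * ((1 - z) * m2) - m0 * ((1 - z) * n2)
       - (b + (a + 1) * z + (1 - z) * INR n) * (n0 * m1 - m0 * n1)))%C.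
    + rewrite Om, On. rewrite RtoC_minus in *. field. auto.
    + rewrite RtoC_minus in *. field; auto.
Qed.

(* The step goes from [(n; a, b+1)] to [(n+1; a, b)]: the summand [P0 P1 / z^n]
   of [p] performs the integration by parts against [D P_n], and the contiguous
   relations lower the degree of both factors. *)
Lemma base_relation_diag n : forall a b,
  (forall k, poch (a + 1) k <> 0) -> (forall k, poch b k <> 0) -> (forall k, poch (a + b + 1) k <> 0) ->
  exists p q, zder p q /\ forall x, let z := cis x in
  (thHR 0 n a b z / Cpow z n * ((1 - z) * thHR 1 n a b z - (a + 1) * z * thHR 0 n a b z))%C =
  ((1 - z) * q z - (b + (a + 1) * z) * p z + diag_const n a b * (1 - z))%C.
Proof.
  induction n as [ | n IH]; intros a b Ha Hb Hs.
  - assert (a1 : a + 1 <> 0) by (generalize (Ha 1%nat); simpl; lra).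
    assert (s1 : a + b + 1 <> 0) by (generalize (Hs 1%nat); simpl; lra).
    exists (fun _ => RtoC ((a + 1) / (a + b + 1))), (fun _ => RtoC 0); split; [apply zder_const | ].
    intros x; cbv zeta. rewrite !thHR_O. unfold thHR, diag_const; simpl.
    set (z := cis x); clearbody z. assert (s1' := RtoC_neq_0 _ s1).
    replace (b * 1 * 1 / (1 * (1 * 1)) * ((a + 1) / (a + b + 1))) with (b * ((a + 1) / (a + b + 1))) by (field; auto).
    rewrite !RtoC_plus in s1'. repeat rewrite ?RtoC_mult, ?RtoC_div, ?RtoC_plus by auto. field; auto.
  - assert (Hb' : forall k, poch (b + 1) k <> 0)
      by (intros k E; apply (Hb (S k)); rewrite poch_shift, E; ring).
    assert (Hs' : forall k, poch (a + (b + 1) + 1) k <> 0).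
    { intros k E; apply (Hs (S k)); rewrite poch_shift. replace (a + b + 1 + 1) with (a + (b + 1) + 1) by ring.
      rewrite E; ring. }
    destruct (IH a (b + 1) Ha Hb' Hs') as (q & q1 & Dq & Eq); clear IH.
    assert (aN : a + INR (S n) <> 0).
    { rewrite S_INR. replace (a + (INR n + 1)) with (a + 1 + INR n) by ring. apply (poch_factor_neq_0 _ (S n)); auto. }
    assert (a1 : a + 1 <> 0) by (generalize (Ha 1%nat); simpl; lra).
    assert (b0 : b <> 0) by (generalize (Hb 1%nat); simpl; lra).
    assert (b1 : b + 1 <> 0) by (generalize (Hb' 1%nat); simpl; lra).
    assert (s1 : a + b + 1 <> 0) by (generalize (Hs 1%nat); simpl; lra).
    assert (s2 : a + b + 2 <> 0) by (generalize (Hs' 1%nat); simpl; lra).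
    assert (Nn : INR (S n) <> 0) by (rewrite S_INR; generalize (pos_INR n); lra).
    set (N := INR (S n)) in *. set (k' := diag_const n a (b + 1)) in *.
    set (c := N * b / (a + N)).
    assert (Ek : diag_const (S n) a b = c * c / (N * b) * ((a + b + 2) / (b + 1)) * k').
    { unfold k', diag_const, c. rewrite (INR_fact_S n), (poch_shift (a + b + 1)).
      change (poch (a + 1) (S n)) with (poch (a + 1) n * (a + 1 + INR n)).
      replace (a + (b + 1) + 1) with (a + b + 1 + 1) by ring. fold N.
      replace (a + 1 + INR n) with (a + N) by (unfold N; rewrite S_INR; ring).
      generalize (Ha n); intros. field. repeat split; auto. lra. }
    eexists; eexists; split.
    (* The weight for b + 1 is -(1-z)/z times the one for b, which explains the factor (1-z)/z on
       [q]. The multiple of 1 - 1/z reduces the leftover (1-z)^2/z, modulo exact terms, to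
       -(a+b+2)/(b+1) times 1 - z. *)
    + apply (zder_mult _ _ _ _ (zder_const (RtoC (/ N)))
       (zder_minus _ _ _ _
         (zder_mult _ _ _ _ (zder_mult _ _ _ _ (zder_thHR 0 (S n) a b) (zder_thHR 1 (S n) a b)) (zder_inv_pow (S n)))
         (zder_mult _ _ _ _ (zder_const (RtoC (c * c / b)))
           (zder_plus _ _ _ _
             (zder_mult _ _ _ _ (zder_mult _ _ _ _ (zder_minus _ _ _ _ (zder_const (RtoC 1)) zder_id) (zder_inv_pow 1)) Dq)
             (zder_mult _ _ _ _ (zder_const (RtoC (k' / (b + 1))))
                (zder_minus _ _ _ _ (zder_const (RtoC 1)) (zder_inv_pow 1))))))).
    + intros x; cbv beta zeta; specialize (Eq x); cbv zeta in Eq.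
      assert (Hz := cis_neq_0 x); set (z := cis x) in *; clearbody z.
      rewrite Ek; clear Ek.
      assert (O := thHR_ode (S n) a b z); fold N in O.
      assert (L0 := thHR_lower 0 (S n) a b z aN ltac:(lia)).
      assert (L1 := thHR_lower 1 (S n) a b z aN ltac:(lia)).
      replace (S n - 1)%nat with n in L0, L1 by lia. fold N c in L0, L1.
      assert (HZ := Cpow_nz z n Hz).
      change (Cpow z (S n)) with (z * Cpow z n)%C. change (Cpow z 1) with (z * 1)%C.
      fold N; change (INR 1) with 1.
      set (Z := Cpow z n) in *; clearbody Z.
      set (P2 := thHR 2 (S n) a b z) in *; set (P1 := thHR 1 (S n) a b z) in *; set (P0 := thHR 0 (S n) a b z) in *.
      set (Q0 := thHR 0 n a (b + 1) z) in *; set (Q1 := thHR 1 n a (b + 1) z) in *.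
      set (y := q z) in *; set (y1 := q1 z) in *.
      clearbody P0 P1 P2 Q0 Q1 y y1.
      assert (K1 : (RtoC c * ((1 - z) * Q1 - (a + 1) * z * Q0))%C = (- (b * P1))%C).
      { transitivity ((1 - z) * (RtoC c * Q1) - (a + 1) * z * (RtoC c * Q0))%C; [ring | ].
        rewrite <- L0, <- L1.
        transitivity ((1 - z) * N * P1 - (1 - z) * P2 - (a + 1) * z * (N * P0 - P1))%C; [ring | ].
        rewrite O; ring. }
      assert (K2 : (RtoC (c * c) * (Q0 / Z * ((1 - z) * Q1 - (a + 1) * z * Q0)))%C = (- (b * P1) * (N * P0 - P1) / Z)%C).
      { transitivity ((RtoC c * Q0) / Z * (RtoC c * ((1 - z) * Q1 - (a + 1) * z * Q0)))%C;
          [rewrite RtoC_mult; field; auto | ].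
        rewrite K1, <- L0; field; auto. }
      rewrite Eq in K2.
      assert (K3 : (RtoC (c * c) * ((1 - z) * y1))%C =
        (- (b * P1) * (N * P0 - P1) / Z + RtoC (c * c) * ((RtoC (b + 1) + (a + 1) * z) * y - k' * (1 - z)))%C)
        by (rewrite <- K2; ring).
      apply RtoC_neq_0 in Nn; apply RtoC_neq_0 in b0; apply RtoC_neq_0 in b1.
      clearbody k' c N. clear Eq K2 K1 L0 L1 aN a1 s1 s2 Dq Ha Hb Hs Hb' Hs'.
      assert (n0 : N <> 0) by (intros E; apply Nn; rewrite E; auto).
      assert (b0' : b <> 0) by (intros E; apply b0; rewrite E; auto).
      assert (b1' : b + 1 <> 0) by (intros E; apply b1; rewrite E; auto).
      rewrite ?RtoC_inv, ?RtoC_div by auto.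
      rewrite ?RtoC_inv, ?RtoC_div, ?RtoC_plus, ?RtoC_mult, ?RtoC_div, ?RtoC_plus in * by auto.
      transitivity (/ N / (z * Z) * ((1 - z) * P1 * P1 + P0 * ((1 - z) * P2) - N * (1 - z) * P0 * P1
           - (b + (a + 1) * z) * P0 * P1)
         - / N / b * ((1 - z) / z * (c * c * ((1 - z) * y1) - c * c * (b + 1 + (a + 1) * z) * y)
              + c * c * k' / (b + 1) * ((1 - z) / z - (b + (a + 1) * z) * (1 - / z)))
         + c * c / (N * b) * ((a + b + 2) / (b + 1)) * k' * (1 - z))%C.
      * rewrite O, K3. field. repeat split; auto.
      * rewrite !RtoC_mult. field. repeat split; auto.
Qed.

Definition params (a b : R) : Prop :=
  forall k, poch (a + 1) k <> 0 /\ poch b k <> 0 /\ poch (a + b + 1) k <> 0.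

Definition base_const (m n : nat) (a b : R) : R := if Nat.eq_dec m n then diag_const n a b else 0.

Lemma base_relation m n a b : params a b -> exists p q, zder p q /\ forall x, let z := cis x in
  (thHR 0 n a b z / Cpow z n * ((1 - z) * thHR 1 m a b z - (a + 1) * z * thHR 0 m a b z))%C =
  ((1 - z) * q z - (b + (a + 1) * z) * p z + base_const m n a b * (1 - z))%C.
Proof.
  intros H; unfold base_const; destruct (Nat.eq_dec m n) as [-> | N].
  - apply base_relation_diag; apply H.
  - destruct (base_relation_offdiag m n a b N) as (p & q & D & E); exists p, q; split; auto.
    intros x; cbv zeta; rewrite E; ring.
Qed.

(** * Integration by parts against the seed *)

Definition bterm (G : C -> C) (m n : nat) (a b : R) (z : C) : C :=
  (thHR 0 n a b z * / Cpow z n * ((1 - z) * thHR 1 m a b z - G z * thHR 0 m a b z))%C.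

(* [P_m] and [P_n] enter through their Wronskians with a seed whose logarithmic
   derivative [z phi' / phi] is [G z / (1 - z)]. *)
Definition reduced (G : C -> C) (lam : R) (m n : nat) (a b x : R) : C :=
  let z := cis x in
  (cweight a b x * ((1 - z) / Cpow z n * (thHR 1 m a b z - G z / (1 - z) * thHR 0 m a b z)
     * (thHR 1 n a b z - RtoC (INR n - lam) * thHR 0 n a b z - G z / (1 - z) * thHR 0 n a b z)))%C.

(* The equation [L phi = lam M phi] for [z phi' / phi = G / (1 - z)]. *)
Definition riccati (G G1 : C -> C) (lam a b : R) : Prop := forall x, let z := cis x in
  ((1 - z) * G1 z + z * G z + G z * G z)%C =
  ((RtoC (b + lam) + RtoC (a + 1 - lam) * z) * G z - RtoC (lam * (a + 1)) * z * (1 - z))%C.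

Definition bterm' (G G1 : C -> C) (m n : nat) (a b : R) (z : C) : C :=
  ((thHR 1 n a b z * / Cpow z n + thHR 0 n a b z * (- INR n / Cpow z n))
     * ((1 - z) * thHR 1 m a b z - G z * thHR 0 m a b z)
   + thHR 0 n a b z * / Cpow z n *
     (((0 - z) * thHR 1 m a b z + (1 - z) * thHR 2 m a b z) - (G1 z * thHR 0 m a b z + G z * thHR 1 m a b z)))%C.

Lemma zder_bterm G G1 m n a b : zder G G1 -> zder (bterm G m n a b) (bterm' G G1 m n a b).
Proof.
  intros HG.
  apply (zder_mult _ _ _ _ (zder_mult _ _ _ _ (zder_thHR 0 n a b) (zder_inv_pow n))
    (zder_minus _ _ _ _ (zder_mult _ _ _ _ (zder_minus _ _ _ _ (zder_const (RtoC 1)) zder_id) (zder_thHR 1 m a b))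
       (zder_mult _ _ _ _ HG (zder_thHR 0 m a b)))).
Qed.

Lemma cder_cweight_mult a b p q x : 0 < x < 2 * PI -> zder p q ->
  cder (fun t => cweight a b t * p (cis t))%C x
    (cweight a b x * ((- RtoC b - RtoC (a + b) * cis x / (1 - cis x)) * p (cis x) + q (cis x)))%C.
Proof.
  intros Hx D; eapply cder_eq; [apply (cder_mult (cweight a b) (fun t => p (cis t))); [apply cder_cweight; auto | apply D] | ].
  ring.
Qed.

(** With ' for z d/dz, [bterm] is (1-z) phi (P_m/phi)' P_n/z^n. Its weighted derivative involves G'
    and G^2 only in a combination that [riccati] resolves; beside the reduced integrand, a seed-free
    multiple of m - lam remains. *)
Lemma reduced_exact G G1 lam m n a b x : 0 < x < 2 * PI -> riccati G G1 lam a b -> let z := cis x in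
  ((- RtoC b - RtoC (a + b) * z / (1 - z)) * bterm G m n a b z + bterm' G G1 m n a b z)%C =
  ((1 - z) / Cpow z n * (thHR 1 m a b z - G z / (1 - z) * thHR 0 m a b z)
     * (thHR 1 n a b z - RtoC (INR n - lam) * thHR 0 n a b z - G z / (1 - z) * thHR 0 n a b z)
   + RtoC (INR m - lam) * (thHR 0 n a b z / Cpow z n * ((1 - z) * thHR 1 m a b z - (a + 1) * z * thHR 0 m a b z)))%C.
Proof.
  intros Hx R; cbv zeta; specialize (R x); cbv zeta in R.
  assert (O := thHR_ode m a b (cis x)).
  assert (Hz := cis_neq_0 x); assert (H1 := one_minus_cis_neq_0 x Hx).
  unfold bterm, bterm'. set (z := cis x) in *; clearbody z.
  assert (HZ := Cpow_nz z n Hz). set (Z := Cpow z n) in *; clearbody Z.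
  set (g := G z) in *; set (g1 := G1 z) in *.
  set (m2 := thHR 2 m a b z) in *; set (m1 := thHR 1 m a b z) in *; set (m0 := thHR 0 m a b z) in *.
  set (n1 := thHR 1 n a b z) in *; set (n0 := thHR 0 n a b z) in *.
  clearbody m0 m1 m2 n0 n1 g g1.
  assert (R' : ((1 - z) * g1)%C = ((RtoC (b + lam) + RtoC (a + 1 - lam) * z) * g - RtoC (lam * (a + 1)) * z * (1 - z) - z * g - g * g)%C)
    by (rewrite <- R; ring).
  transitivity ((- RtoC b - RtoC (a + b) * z / (1 - z)) * (n0 * / Z * ((1 - z) * m1 - g * m0))
    + (n1 * / Z + n0 * (- INR n / Z)) * ((1 - z) * m1 - g * m0)
    + n0 / Z * ((0 - z) * m1 + (1 - z) * m2 - (((1 - z) * g1) / (1 - z) * m0 + g * m1)))%C.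
  - field; auto.
  - rewrite O, R'. rewrite ?RtoC_plus, ?RtoC_minus, ?RtoC_mult, ?RtoC_plus. field; auto.
Qed.

(** The integration by parts and the base relation are merged into one exact derivative before
    integrating, because their boundary terms may diverge separately and cancel only in the
    combination. What is left is a moment of [(1 - z) w]. *)
Lemma reduced_has_int G G1 lam m n a b p q v : zder G G1 -> riccati G G1 lam a b ->
  zder p q ->
  (forall x, let z := cis x in
  (thHR 0 n a b z / Cpow z n * ((1 - z) * thHR 1 m a b z - (a + 1) * z * thHR 0 m a b z))%C =
  ((1 - z) * q z - (b + (a + 1) * z) * p z + base_const m n a b * (1 - z))%C) ->
  vanishes_at_ends (fun x => cweight a b x * (bterm G m n a b (cis x) - RtoC (INR m - lam) * ((1 - cis x) * p (cis x))))%C ->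
  has_int_C (cweight (a + 1) b) v ->
  has_int_C (reduced G lam m n a b) (RtoC (- (INR m - lam) * base_const m n a b) * v)%C.
Proof.
  intros DG RG Dp Ep V M.
  assert (D : zder (fun z => bterm G m n a b z - RtoC (INR m - lam) * ((1 - z) * p z))%C
    (fun z => bterm' G G1 m n a b z - (0 * ((1 - z) * p z) + RtoC (INR m - lam) * ((0 - z) * p z + (1 - z) * q z)))%C).
  { apply (zder_minus _ _ _ _ (zder_bterm G G1 m n a b DG)
       (zder_mult _ _ _ _ (zder_const (RtoC (INR m - lam)))
          (zder_mult _ _ _ _ (zder_minus _ _ _ _ (zder_const (RtoC 1)) zder_id) Dp))). }
  assert (E := has_int_C_exact _ _ (fun x Hx => cder_cweight_mult a b _ _ x Hx D) V).
  assert (S := has_int_C_plus _ _ _ _ E (has_int_C_scal (RtoC (- (INR m - lam) * base_const m n a b)) _ _ M)).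
  rewrite Cplus_0_l in S. eapply has_int_C_ext; [ | exact S].
  intros x Hx; cbv beta. rewrite cweight_succ by auto. unfold reduced; cbv zeta.
  assert (X := reduced_exact G G1 lam m n a b x Hx RG); cbv zeta in X. specialize (Ep x); cbv zeta in Ep.
  rewrite Ep in X. assert (H1 := one_minus_cis_neq_0 x Hx).
  rewrite RtoC_mult, RtoC_opp.
  set (F := ((1 - cis x) / Cpow (cis x) n * (thHR 1 m a b (cis x) - G (cis x) / (1 - cis x) * thHR 0 m a b (cis x))
     * (thHR 1 n a b (cis x) - RtoC (INR n - lam) * thHR 0 n a b (cis x) - G (cis x) / (1 - cis x) * thHR 0 n a b (cis x)))%C) in *.
  set (z := cis x) in *. set (k := RtoC (base_const m n a b)) in *. set (L := RtoC (INR m - lam)) in *.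
  set (y := bterm G m n a b z) in *; set (y1 := bterm' G G1 m n a b z) in *.
  assert (X' : F = (((- RtoC b - RtoC (a + b) * z / (1 - z)) * y + y1)
      - L * ((1 - z) * q z - (b + (a + 1) * z) * p z + k * (1 - z)))%C) by (rewrite X; ring).
  rewrite X'. clear X X'. rewrite RtoC_plus. field; auto.
Qed.

Lemma vanish_bounded G G1 p q L m n a b : 0 < a + b -> zder G G1 -> zder p q ->
  vanishes_at_ends (fun x => cweight a b x * (bterm G m n a b (cis x) - L * ((1 - cis x) * p (cis x))))%C.
Proof.
  intros Hs DG Dp.
  assert (D := zder_minus _ _ _ _ (zder_bterm G G1 m n a b DG)
       (zder_mult _ _ _ _ (zder_const L)
          (zder_mult _ _ _ _ (zder_minus _ _ _ _ (zder_const (RtoC 1)) zder_id) Dp))).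
  apply (cweight_vanishes_bounded a b _ _ _ Hs (D 0) (D (2 * PI))).
Qed.

(** The combined boundary term divided by 1 - z, available when the seed has no pole at z = 1; the
    weight then gains one power of 1 - z. *)
Definition bfactor (g p : C -> C) (L : C) (m n : nat) (a b : R) (z : C) : C :=
  (thHR 0 n a b z * / Cpow z n * (thHR 1 m a b z - g z * thHR 0 m a b z) - L * p z)%C.

Lemma zder_bfactor g g1 p q L m n a b : zder g g1 -> zder p q -> exists r, zder (bfactor g p L m n a b) r.
Proof.
  intros Dg Dp; eexists.
  apply (zder_minus _ _ _ _ (zder_mult _ _ _ _ (zder_mult _ _ _ _ (zder_thHR 0 n a b) (zder_inv_pow n))
    (zder_minus _ _ _ _ (zder_thHR 1 m a b) (zder_mult _ _ _ _ Dg (zder_thHR 0 m a b))))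
     (zder_mult _ _ _ _ (zder_const L) Dp)).
Qed.

Lemma vanishes_ext (f g : R -> C) : (forall x, 0 < x < 2 * PI -> f x = g x) ->
  vanishes_at_ends f -> vanishes_at_ends g.
Proof.
  intros E [V0 V1]; split.
  - apply (filterlim_ext_loc (fun x => Cmod (f x))); auto.
    generalize at_right_0_interval; apply filter_imp; intros x Hx; rewrite E; auto.
  - apply (filterlim_ext_loc (fun x => Cmod (f x))); auto.
    generalize at_left_2pi_interval; apply filter_imp; intros x Hx; rewrite E; auto.
Qed.

Lemma bterm_bfactor G g p L m n a b x : 0 < x < 2 * PI -> (forall x, G (cis x) = ((1 - cis x) * g (cis x))%C) ->
  (cweight (a + 1) b x * bfactor g p L m n a b (cis x))%C =
  (cweight a b x * (bterm G m n a b (cis x) - L * ((1 - cis x) * p (cis x))))%C.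
Proof. intros Hx EG; rewrite cweight_succ by auto. unfold bterm, bfactor; rewrite EG; ring. Qed.

Lemma vanish_factor G g g1 p q L m n a b : 0 < a + b + 1 ->
  (forall x, G (cis x) = ((1 - cis x) * g (cis x))%C) -> zder g g1 -> zder p q ->
  vanishes_at_ends (fun x => cweight a b x * (bterm G m n a b (cis x) - L * ((1 - cis x) * p (cis x))))%C.
Proof.
  intros Hs EG Dg Dp. destruct (zder_bfactor g g1 p q L m n a b Dg Dp) as [r D].
  apply (vanishes_ext (fun x => cweight (a + 1) b x * bfactor g p L m n a b (cis x))%C).
  - intros x Hx; apply bterm_bfactor; auto.
  - apply (cweight_vanishes_bounded (a + 1) b _ _ _ ltac:(lra) (D 0) (D (2 * PI))).
Qed.

Lemma cis_0 : cis 0 = RtoC 1.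
Proof. unfold cis; rewrite cos_0, sin_0; auto. Qed.

Lemma cis_2PI : cis (2 * PI) = RtoC 1.
Proof. unfold cis; rewrite cos_2PI, sin_2PI; auto. Qed.

Lemma Cmult_eq_0_reg_l (s y : C) : s <> RtoC 0 -> (s * y)%C = RtoC 0 -> y = RtoC 0.
Proof. intros Hs H; transitivity (/ s * (s * y))%C; [field; auto | rewrite H; ring]. Qed.

(* If [-2 < a + b < -1] the boundary factor blows up at the end points, unless
   its coefficient vanishes at [z = 1]; the differential equations of [P_m] and
   of the seed at their singular point [z = 1] show that it does. *)
Lemma vanish_zero G g g1 p q lam m n a b : -2 < a + b -> a + b + 1 <> 0 ->
  (forall x, G (cis x) = ((1 - cis x) * g (cis x))%C) -> zder g g1 -> zder p q ->
  (RtoC (a + b + 1) * g (RtoC 1))%C = RtoC (lam * (a + 1)) ->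
  (forall x, let z := cis x in
  (thHR 0 n a b z / Cpow z n * ((1 - z) * thHR 1 m a b z - (a + 1) * z * thHR 0 m a b z))%C =
  ((1 - z) * q z - (b + (a + 1) * z) * p z + base_const m n a b * (1 - z))%C) ->
  vanishes_at_ends (fun x => cweight a b x * (bterm G m n a b (cis x) - RtoC (INR m - lam) * ((1 - cis x) * p (cis x))))%C.
Proof.
  intros Hs Hs1 EG Dg Dp Hg Ep. set (L := RtoC (INR m - lam)).
  destruct (zder_bfactor g g1 p q L m n a b Dg Dp) as [r D].
  (* At z = 1, [thHR_ode] gives (a+b+1) P_m' = m(a+1) P_m, and the base relation gives (a+b+1) p =
     (a+1) P_n P_m. Together with the hypothesis on [g 1], both summands of [bfactor], times a+b+1,
     become (m - lam)(a+1) P_n P_m. *)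
  assert (Z : bfactor g p L m n a b (RtoC 1) = RtoC 0).
  { unfold bfactor, L. specialize (Ep 0); cbv zeta in Ep; rewrite cis_0 in Ep.
    assert (O := thHR_ode m a b (RtoC 1)).
    assert (N := RtoC_neq_0 _ Hs1).
    replace (Cpow 1 n) with (RtoC 1) in * by (rewrite Cpow_1_l; auto).
    set (m1 := thHR 1 m a b (RtoC 1)) in *; set (m2 := thHR 2 m a b (RtoC 1)) in *; set (m0 := thHR 0 m a b (RtoC 1)) in *.
    set (n0 := thHR 0 n a b (RtoC 1)) in *. set (y := p (RtoC 1)) in *. set (h := g (RtoC 1)) in *.
    clearbody m0 m1 m2 n0 y h. set (s1 := RtoC (a + b + 1)) in *.
    assert (A1 : (s1 * m1)%C = (INR m * (a + 1) * m0)%C).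
    { unfold s1; rewrite !RtoC_plus. transitivity ((b + INR m + (a + 1 - INR m) * 1) * m1)%C; [ring | ].
      transitivity ((1 - 1) * m2 + INR m * (a + 1) * 1 * m0)%C; [rewrite O; ring | ring]. }
    assert (A2 : (s1 * y)%C = ((a + 1) * n0 * m0)%C).
    { unfold s1; rewrite !RtoC_plus.
      transitivity (- (0 - (b + (a + 1) * 1) * y))%C; [ring | ].
      transitivity (- (n0 / 1 * ((1 - 1) * m1 - (a + 1) * 1 * m0)))%C; [rewrite Ep; ring | field]. }
    apply (Cmult_eq_0_reg_l s1); auto.
    transitivity (n0 * ((s1 * m1) - (s1 * h) * m0) - RtoC (INR m - lam) * (s1 * y))%C; [field; intros K; injection K; lra | ].
    rewrite A1, A2, Hg. rewrite RtoC_minus, RtoC_mult, RtoC_plus. ring. }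
  apply (vanishes_ext (fun x => cweight (a + 1) b x * bfactor g p L m n a b (cis x))%C).
  - intros x Hx; apply bterm_bfactor; auto.
  - apply (cweight_vanishes_zero (a + 1) b _ _ _ ltac:(lra) (D 0) (D (2 * PI))).
    + rewrite cis_0; auto.
    + rewrite cis_2PI; auto.
Qed.

(** * The constants h_n as tails of one infinite product *)

Lemma beta_factor_shift a b N : a + b + 1 <> 0 -> (forall k, a + 1 + INR k <> 0) -> (forall k, a + b + 1 + INR k <> 0) ->
  prod1 (beta_factor a b) N = prod1 (beta_factor (a + 1) b) N * ((a + 1) * (a + b + 1 + INR N) / ((a + 1 + INR N) * (a + b + 1))).
Proof.
  intros Hs Ha Hk; induction N as [ | N IH].
  - simpl; generalize (Ha 0%nat); simpl; intros; field; split; auto; lra.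
  - simpl prod1; rewrite IH; unfold beta_factor. generalize (Ha N) (Hk N) (Ha (S N)) (Hk (S N)); rewrite S_INR; generalize (pos_INR N); intros.
    field. repeat split; auto; lra.
Qed.

Lemma beta_factor_poch a b n : (forall k, poch (a + b + 1) k <> 0) ->
  prod1 (beta_factor a b) n = poch (a + 1) n * poch (b + 1) n / (INR (fact n) * poch (a + b + 1) n).
Proof.
  intros H; induction n as [ | n IH]; [simpl; field | ].
  simpl prod1; rewrite IH, INR_fact_S; simpl poch; unfold beta_factor; rewrite S_INR.
  assert (A := H n); assert (B := poch_factor_neq_0 _ (S n) n (H (S n)) ltac:(lia)).
  generalize (INR_fact_pos n) (pos_INR n); intros. field. repeat split; auto; lra.
Qed.

Lemma prod1_split f n N : prod1 f (n + S N) = prod1 f n * prod_f_R0 (fun k => f (n + S k)%nat) N.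
Proof.
  induction N as [ | N IH].
  - rewrite Nat.add_1_r; simpl; rewrite Nat.add_1_r; auto.
  - rewrite Nat.add_succ_r; simpl prod1 at 1; rewrite IH; simpl prod_f_R0. rewrite <- Nat.add_succ_r; ring.
Qed.

(** The product is known at a + 1 only, since the moment lemma for a itself requires a + b > -1;
    [beta_factor_shift] leads back to a. Splitting off the first n factors leaves h_n. *)
Lemma hbase_value n a b (v : R) : params a b -> -2 < a + b -> is_lim_seq (prod1 (beta_factor (a + 1) b)) v ->
  hbase n a b * (poch (a + 1) n * poch (b + 1) n / (INR (fact n) * poch (a + b + 1) n)) =
  (a + 1) / (a + b + 1) * v.
Proof.
  intros HP Hs L.
  assert (Ha : forall k, a + 1 + INR k <> 0) by (intros k; apply (poch_factor_neq_0 _ (S k)); [apply HP | lia]).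
  assert (Hk : forall k, a + b + 1 + INR k <> 0) by (intros k; apply (poch_factor_neq_0 _ (S k)); [apply HP | lia]).
  assert (Hb : forall k, b + INR k <> 0) by (intros k; apply (poch_factor_neq_0 _ (S k)); [apply HP | lia]).
  assert (s1 : a + b + 1 <> 0) by (generalize (Hk 0%nat); simpl; lra).
  assert (a1 : a + 1 <> 0) by (generalize (Ha 0%nat); simpl; lra).
  assert (Hb' : poch (b + 1) n <> 0) by (intros E; apply (proj1 (proj2 (HP (S n)))); rewrite poch_shift, E; ring).
  assert (LT : is_lim_seq (prod1 (beta_factor a b)) ((a + 1) / (a + b + 1) * v)).
  { apply (is_lim_seq_ext (fun N => prod1 (beta_factor (a + 1) b) N * ((a + 1) / (a + b + 1) * (1 + b * / (a + 1 + INR N))))).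
    - intros N; rewrite (beta_factor_shift a b N); auto. field; auto.
    - replace ((a + 1) / (a + b + 1) * v) with (v * ((a + 1) / (a + b + 1) * (1 + b * 0))) by ring.
      apply is_lim_seq_mult'; auto.
      apply is_lim_seq_mult'; [apply is_lim_seq_const | ].
      apply is_lim_seq_plus'; [apply is_lim_seq_const | ].
      apply is_lim_seq_mult'; [apply is_lim_seq_const | ].
      replace (Finite 0) with (Rbar_inv p_infty) by reflexivity.
      apply is_lim_seq_inv; [ | discriminate].
      eapply is_lim_seq_plus; [apply is_lim_seq_const | apply is_lim_seq_INR | reflexivity]. }
  rewrite <- beta_factor_poch by apply HP.
  assert (T0 : prod1 (beta_factor a b) n <> 0).
  { rewrite beta_factor_poch by apply HP. generalize (INR_fact_pos n); intros.
    apply Rmult_integral_contrapositive; split.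
    - apply Rmult_integral_contrapositive; split; auto; apply HP.
    - apply Rinv_neq_0_compat, Rmult_integral_contrapositive; split; [lra | apply HP]. }
  assert (LH : is_lim_seq (fun N => prod_f_R0 (fun k : nat =>
    (a + INR n + 1 + INR k) * (b + INR n + 1 + INR k)
    / ((INR n + 1 + INR k) * (a + b + INR n + 1 + INR k))) N) ((a + 1) / (a + b + 1) * v / prod1 (beta_factor a b) n)).
  (* [prod_f_R0] up to [N] has N + 1 factors, hence [N + S n] and not [N + n]. *)
  { apply (is_lim_seq_ext (fun N => prod1 (beta_factor a b) (N + S n) / prod1 (beta_factor a b) n)).
    - intros N; replace (N + S n)%nat with (n + S N)%nat by lia. rewrite prod1_split.
      set (A := prod_f_R0 _ N). match goal with |- _ = ?B0 => set (B := B0) end.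
      assert (E : A = B); [ | rewrite E; field; auto].
      unfold A, B; clear. induction N as [ | N IH]; [ | cbn [prod_f_R0]; rewrite IH; f_equal].
      + cbn [prod_f_R0]; unfold beta_factor; rewrite plus_INR, S_INR. cbv beta; simpl INR. f_equal; [ring | f_equal; ring].
      + unfold beta_factor; rewrite plus_INR, !S_INR. cbv beta; f_equal; [ring | f_equal; ring].
    - apply is_lim_seq_div'; [ | apply is_lim_seq_const | auto].
      apply (is_lim_seq_incr_n (prod1 (beta_factor a b)) (S n)); auto. }
  unfold hbase; rewrite (is_lim_seq_unique _ _ LH). simpl real. field; auto.
Qed.

(** Identifies the constants of the reduction with those of the theorem; the factor n + b comes from
    b (b+1)_n = (b)_n (b+n). *)
Lemma constant_value n a b (v : R) : params a b -> -2 < a + b -> is_lim_seq (prod1 (beta_factor (a + 1) b)) v ->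
  rev_const a b n * diag_const n a b * v = (INR n + b) * hbase n a b.
Proof.
  intros HP Hs L; assert (H := hbase_value n a b v HP Hs L).
  assert (b0 : b <> 0) by (generalize (proj1 (proj2 (HP 1%nat))); simpl; lra).
  assert (s1 : a + b + 1 <> 0) by (generalize (proj2 (proj2 (HP 1%nat))); simpl; lra).
  assert (Pa := proj1 (HP n)); assert (Pb := proj1 (proj2 (HP n))); assert (Ps := proj2 (proj2 (HP n))).
  assert (E : b * poch (b + 1) n = poch b n * (b + INR n)) by (rewrite <- poch_shift; auto).
  unfold rev_const, diag_const. assert (F := INR_fact_pos n).
  transitivity (b * INR (fact n) * poch (a + b + 1) n / (poch (a + 1) n * poch b n) * ((a + 1) / (a + b + 1) * v)).
  { field; auto. }
  rewrite <- H. 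
  transitivity (hbase n a b * ((b * poch (b + 1) n) / poch b n)); [field; repeat split; auto; lra | ].
  rewrite E; field; auto.
Qed.

(** * The four families *)

(* The seed is [z^seed_shift (1-z)^(-seed_pole) P_l(z; seed_a, seed_b)], with
   eigenvalue [seed_eigen]. *)
Definition seed_a (j : xtype) (a b : R) : R :=
  match j with X1 => a | X2 => - b | X3 => b - 1 | X4 => - a - 1 end.

Definition seed_b (j : xtype) (a b : R) : R :=
  match j with X1 => b | X2 => - a | X3 => a + 1 | X4 => - b + 1 end.

Definition seed_shift (j : xtype) (l : nat) (a b : R) : R :=
  match j with X1 | X2 => 0 | X3 => - (INR l + 1 + a) | X4 => - (INR l + 1 - b) end.

Definition seed_pole (j : xtype) (a b : R) : R :=
  match j with X1 | X3 => 0 | X2 | X4 => a + b end.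

Definition seed_eigen (j : xtype) (l : nat) (a b : R) : R :=
  match j with
  | X1 => INR l | X2 => INR l - (a + b) | X3 => - (INR l + 1 + a + b) | X4 => - (INR l + 1)
  end.

Definition seed (i : nat) (j : xtype) (l : nat) (a b : R) (z : C) : C :=
  thHR i l (seed_a j a b) (seed_b j a b) z.

Definition seed_logd (j : xtype) (l : nat) (a b : R) (z : C) : C :=
  (seed 1 j l a b z * / seed 0 j l a b z + RtoC (seed_shift j l a b))%C.

Definition seed_logd' (j : xtype) (l : nat) (a b : R) (z : C) : C :=
  (seed 2 j l a b z * / seed 0 j l a b z
    + seed 1 j l a b z * (- seed 1 j l a b z / (seed 0 j l a b z * seed 0 j l a b z)) + RtoC 0)%C.

(** This is 1 - z times the logarithmic derivative (for z d/dz) of the whole seed: the power of 1 -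
    z contributes [seed_pole * z], the power of z is part of [seed_logd]. *)
Definition gauge_num (j : xtype) (l : nat) (a b : R) (z : C) : C :=
  ((RtoC 1 - z) * seed_logd j l a b z + RtoC (seed_pole j a b) * z)%C.

Definition gauge_num' (j : xtype) (l : nat) (a b : R) (z : C) : C :=
  (((RtoC 0 - z) * seed_logd j l a b z + (RtoC 1 - z) * seed_logd' j l a b z)
    + (RtoC 0 * z + RtoC (seed_pole j a b) * z))%C.

Definition nonvanishing (j : xtype) (l : nat) (a b : R) : Prop := forall x, seed 0 j l a b (cis x) <> RtoC 0.

Lemma zder_seed_logd j l a b : nonvanishing j l a b -> zder (seed_logd j l a b) (seed_logd' j l a b).
Proof.
  intros H. apply zder_plus; [ | apply zder_const].
  apply zder_mult; [apply zder_thHR | ].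
  intros x; apply (cder_inv (fun t => seed 0 j l a b (cis t))); [apply H | apply zder_thHR].
Qed.

Lemma zder_gauge_num j l a b : nonvanishing j l a b -> zder (gauge_num j l a b) (gauge_num' j l a b).
Proof.
  intros H. apply zder_plus; apply zder_mult.
  - apply (zder_minus _ _ _ _ (zder_const (RtoC 1)) zder_id).
  - apply zder_seed_logd; auto.
  - apply zder_const.
  - apply zder_id.
Qed.

Lemma riccati_gauge_num j l a b : nonvanishing j l a b ->
  riccati (gauge_num j l a b) (gauge_num' j l a b) (seed_eigen j l a b) a b.
Proof.
  intros H x; cbv zeta; specialize (H x). unfold gauge_num, gauge_num', seed_logd, seed_logd'.
  assert (O := thHR_ode l (seed_a j a b) (seed_b j a b) (cis x)). unfold seed in *.
  set (z := cis x) in *; clearbody z.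
  set (h2 := thHR 2 l _ _ z) in *; set (h1 := thHR 1 l _ _ z) in *; set (h0 := thHR 0 l _ _ z) in *.
  clearbody h0 h1 h2.
  set (c := RtoC (seed_shift j l a b)). set (e := RtoC (seed_pole j a b)).
  match goal with |- ?L = ?Rr => transitivity
    ((1 - z) * (((1 - z) * h2) / h0 + (1 - z) * (2 * c * h1 / h0 + c * c)
        + 2 * e * z * (h1 / h0 + c)) + e * z + e * e * z * z)%C end.
  - field; auto.
  - rewrite O; unfold c, e, seed_shift, seed_pole, seed_eigen, seed_a, seed_b; destruct j;
    repeat rewrite ?RtoC_plus, ?RtoC_minus, ?RtoC_opp, ?RtoC_mult; field; auto.
Qed.

Lemma params_defined_swap j l a b : params_defined j l a b -> params_defined j l (b - 1) (a + 1).
Proof.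
  intros [H1 H2]; split.
  - intros n; destruct (H1 n) as (A & B & C0).
    replace (b - 1 + 1) with b by ring. replace (b - 1 + (a + 1) + 1) with (a + b + 1) by ring. auto.
  - destruct j; auto; replace (- (b - 1)) with (- b + 1) by ring; replace (- (a + 1) + 1) with (- a) by ring; tauto.
Qed.

Lemma params_defined_params j l a b : params_defined j l a b -> params a b.
Proof. intros [H _]; exact H. Qed.

Lemma seed_neq_0 j l a b : params_defined j l a b ->
  poch (seed_a j a b + 1) l <> 0 /\ poch (seed_b j a b) l <> 0.
Proof.
  intros [H1 H2]; destruct (H1 l) as (A & B & _).
  destruct j; simpl; auto.
  - tauto.
  - replace (b - 1 + 1) with b by ring; auto.
  - replace (- a - 1 + 1) with (- a) by ring; tauto.
Qed.

Lemma denom_seed j l a b z : params_defined j l a b -> denom j l a b z = seed 0 j l a b z.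
Proof.
  intros H; destruct (seed_neq_0 j l a b H) as [_ B].
  destruct j; simpl; apply HR_thHR; auto.
Qed.

(** The partner substitution commutes with each choice of seed parameters; therefore z -> 1/z acts
    on the seed polynomial exactly as on P_n. *)
Lemma seed_swap j a b :
  seed_a j (b - 1) (a + 1) = seed_b j a b - 1 /\ seed_b j (b - 1) (a + 1) = seed_a j a b + 1.
Proof. destruct j; simpl; split; ring. Qed.

Lemma seed_0_rev j l a b z : params_defined j l a b -> z <> RtoC 0 ->
  seed 0 j l (b - 1) (a + 1) (/ z) =
  (RtoC (rev_const (seed_a j a b) (seed_b j a b) l) * seed 0 j l a b z / Cpow z l)%C.
Proof.
  intros H Hz; destruct (seed_neq_0 j l a b H); destruct (seed_swap j a b) as [E1 E2].
  unfold seed; rewrite E1, E2; apply thHR_0_rev; auto.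
Qed.

Lemma seed_1_rev j l a b z : params_defined j l a b -> z <> RtoC 0 ->
  seed 1 j l (b - 1) (a + 1) (/ z) =
  (RtoC (rev_const (seed_a j a b) (seed_b j a b) l) * (INR l * seed 0 j l a b z - seed 1 j l a b z) / Cpow z l)%C.
Proof.
  intros H Hz; destruct (seed_neq_0 j l a b H); destruct (seed_swap j a b) as [E1 E2].
  unfold seed; rewrite E1, E2; apply thHR_1_rev; auto.
Qed.

Definition gauge_logd (j : xtype) (l : nat) (a b : R) (z : C) : C := (gauge_num j l a b z / (1 - z))%C.

Lemma Cinv_neq_0 z : z <> RtoC 0 -> (/ z)%C <> RtoC 0.
Proof.
  intros Hz E; apply (RtoC_neq_0 1 R1_neq_R0).
  transitivity (z * / z)%C; [field; auto | rewrite E; ring].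
Qed.

Lemma inv_neq_1 z : z <> RtoC 0 -> (1 - z)%C <> RtoC 0 -> (1 - / z)%C <> RtoC 0.
Proof.
  intros Hz H1 E; apply H1. transitivity (- z * (1 - / z))%C; [field; auto | rewrite E; ring].
Qed.

Lemma rev_const_neq_0 a b n : poch (a + 1) n <> 0 -> poch b n <> 0 -> rev_const a b n <> 0.
Proof. intros A B; apply Rmult_integral_contrapositive; split; auto; apply Rinv_neq_0_compat; auto. Qed.

(** The partner's seed at 1/z is a multiple of z^(-lam) phi. Comparing powers of z gives lam = l +
    shift + shift' - pole, where shift' belongs to the partner; this is the origin of
    [seed_eigen]. *)
Lemma gauge_logd_rev j l a b z : params_defined j l a b -> z <> RtoC 0 -> (1 - z)%C <> RtoC 0 ->
  seed 0 j l a b z <> RtoC 0 ->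
  gauge_logd j l (b - 1) (a + 1) (/ z) = (RtoC (seed_eigen j l a b) - gauge_logd j l a b z)%C.
Proof.
  intros H Hz H1 Hh; unfold gauge_logd, gauge_num, seed_logd. rewrite seed_0_rev, seed_1_rev by auto.
  destruct (seed_neq_0 j l a b H) as [A B]; assert (Cn := RtoC_neq_0 _ (rev_const_neq_0 _ _ _ A B)).
  set (k := RtoC (rev_const _ _ l)) in *; clearbody k.
  assert (HZ := Cpow_nz z l Hz); set (Z := Cpow z l) in *; clearbody Z.
  set (h0 := seed 0 j l a b z) in *; set (h1 := seed 1 j l a b z) in *; clearbody h0 h1.
  assert (H2 : (z - 1)%C <> RtoC 0) by (intros E; apply H1; transitivity (- (z - 1))%C; [ring | rewrite E; ring]).
  destruct j; simpl; repeat rewrite ?RtoC_plus, ?RtoC_minus, ?RtoC_opp, ?RtoC_mult; field; repeat split; auto.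
Qed.

(** * The integrand in Wronskian form *)

Definition xprefactor (j : xtype) (l : nat) (a b : R) (z : C) : C :=
  match j with
  | X1 => / z
  | X2 => (1 - z) / z
  | X3 => RtoC (poch b l / poch (a + 1) l)
  | X4 => RtoC (poch (- a) l / poch (- b + 1) l) * (z - 1)
  end%C.

Lemma XP_form j l n a b z : (1 <= l)%nat -> params_defined j l a b -> z <> RtoC 0 -> (1 - z)%C <> RtoC 0 ->
  seed 0 j l a b z <> RtoC 0 ->
  XP j l (Z.of_nat n) a b z =
  (xprefactor j l a b z * seed 0 j l a b z * (thHR 1 n a b z - gauge_logd j l a b z * thHR 0 n a b z))%C.
Proof.
  intros Hl H Hz H1 Hh.
  assert (Hs := seed_neq_0 j l a b H). destruct H as [HP HQ].
  assert (a1 : a + 1 <> 0) by (generalize (proj1 (HP 1%nat)); simpl; lra).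
  assert (Bn := proj1 (proj2 (HP n))). assert (Bl := proj1 (proj2 (HP l))).
  unfold gauge_logd, gauge_num, seed_logd. destruct j; simpl XP; rewrite ?Nat2Z.id.
  - transitivity (/ z * (z * XHR1 l n a b z))%C; [field; auto | ].
    rewrite XHR1_form by auto. unfold seed in *; simpl in *.
    set (h0 := thHR 0 l a b z) in *; clearbody h0. field; auto.
  - transitivity (/ z * (z * XHR2 l n a b z))%C; [field; auto | ].
    simpl in Hs. rewrite XHR2_form; auto; [ | | tauto].
    2: { intros E; apply (poch_neq_0_le (- b + 1) 1 l); [lia | tauto | simpl; lra]. }
    unfold seed in *; simpl in *. set (h0 := thHR 0 l _ _ z) in *; clearbody h0. field; auto.
  - simpl in Hs. rewrite XHR3_form; auto; [ | | tauto].
    2: { assert (Q := poch_factor_neq_0 b l (l - 1) Bl ltac:(lia)). rewrite minus_INR in Q by auto; simpl in Q; lra. }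
    unfold seed in *; simpl in *. set (h0 := thHR 0 l _ _ z) in *; clearbody h0.
    rewrite !RtoC_opp, !RtoC_plus. field; auto.
  - destruct (Z.eq_dec (Z.of_nat n) (- Z.of_nat l - 1)); [lia | ].
    simpl in Hs. rewrite XHR4_form; auto; [ | | tauto].
    2: { assert (Q := poch_factor_neq_0 (- a) l (l - 1) (proj1 HQ) ltac:(lia)). rewrite minus_INR in Q by auto; simpl in Q; lra. }
    unfold seed in *; simpl in *. set (h0 := thHR 0 l _ _ z) in *; clearbody h0.
    rewrite !RtoC_opp, ?RtoC_minus, ?RtoC_plus. field; auto.
Qed.

Lemma cis_opp x : cis (- x) = (/ cis x)%C.
Proof.
  assert (H := cis_neq_0 x).
  transitivity (/ cis x * (cis x * cis (- x)))%C; [field; auto | ].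
  rewrite <- cis_plus. replace (x + - x) with 0 by ring. rewrite cis_0; ring.
Qed.

Lemma XQ_form j l n a b z : (1 <= l)%nat -> params_defined j l a b -> z <> RtoC 0 -> (1 - z)%C <> RtoC 0 ->
  seed 0 j l a b z <> RtoC 0 ->
  XQ j l (Z.of_nat n) a b (/ z) =
  (- xprefactor j l (b - 1) (a + 1) (/ z) * (RtoC (rev_const (seed_a j a b) (seed_b j a b) l) * seed 0 j l a b z / Cpow z l)
    * (RtoC (rev_const a b n) / Cpow z n) *
    (thHR 1 n a b z - RtoC (INR n - seed_eigen j l a b) * thHR 0 n a b z - gauge_logd j l a b z * thHR 0 n a b z))%C.
Proof.
  intros Hl H Hz H1 Hh. destruct (seed_neq_0 j l a b H) as [A B].
  destruct (params_defined_params _ _ _ _ H n) as (Pa & Pb & _).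
  assert (HZl := Cpow_nz z l Hz); assert (HZ := Cpow_nz z n Hz).
  unfold XQ; rewrite XP_form; auto.
  - rewrite gauge_logd_rev, thHR_0_rev, thHR_1_rev, seed_0_rev, RtoC_minus by auto.
    set (Z := Cpow z n) in *; set (Zl := Cpow z l) in *. set (p := xprefactor _ _ _ _ _). field; auto.
  - apply params_defined_swap; auto.
  - apply Cinv_neq_0; auto.
  - apply inv_neq_1; auto.
  - rewrite seed_0_rev by auto. intros E. 
    apply Hh. apply (Cmult_eq_0_reg_l (RtoC (rev_const (seed_a j a b) (seed_b j a b) l) / Cpow z l)%C).
    + intros E2. apply (RtoC_neq_0 _ (rev_const_neq_0 _ _ _ A B)).
      transitivity (RtoC (rev_const (seed_a j a b) (seed_b j a b) l) / Cpow z l * Cpow z l)%C; [field; auto | rewrite E2; ring].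
    + rewrite <- E; field; auto.
Qed.

(** The weights are designed for this cancellation: elementary prefactors, the reversal constant and
    both copies of the seed polynomial disappear, and every type leaves the same [w (1 - z)]. *)
Lemma weight_xprefactor j l a b z : params_defined j l a b -> z <> RtoC 0 -> (1 - z)%C <> RtoC 0 ->
  seed 0 j l a b z <> RtoC 0 ->
  (weight j l a b z * xprefactor j l a b z * (- xprefactor j l (b - 1) (a + 1) (/ z))
    * RtoC (rev_const (seed_a j a b) (seed_b j a b) l) / Cpow z l * (seed 0 j l a b z * seed 0 j l a b z))%C
  = (weight0 a b z * (1 - z))%C.
Proof.
  intros H Hz H1 Hh. destruct (seed_neq_0 j l a b H) as [A B].
  assert (HZl := Cpow_nz z l Hz). unfold weight; rewrite denom_seed by auto.
  change (Cpow (seed 0 j l a b z) 2) with (seed 0 j l a b z * (seed 0 j l a b z * 1))%C.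
  set (h0 := seed 0 j l a b z) in *; clearbody h0. set (w := weight0 a b z); clearbody w.
  change (Cpow z (1 + l)) with (z * Cpow z l)%C.
  set (Zl := Cpow z l) in *; clearbody Zl.
  replace (1 + a) with (a + 1) by ring.
  destruct j; simpl in *; unfold rev_const.
  - assert (A' := RtoC_neq_0 _ A); assert (B' := RtoC_neq_0 _ B).
    rewrite !RtoC_div by auto. field; repeat split; auto.
  - assert (A' := RtoC_neq_0 _ A); assert (B' := RtoC_neq_0 _ B).
    rewrite !RtoC_div by auto. field; repeat split; auto.
  - replace (b - 1 + 1) with b in * by ring.
    assert (A' := RtoC_neq_0 _ A); assert (B' := RtoC_neq_0 _ B).
    rewrite !RtoC_div by auto. field; repeat split; auto.
  - replace (- (b - 1)) with (- b + 1) by ring. replace (- (a + 1) + 1) with (- a) by ring.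
    replace (- a - 1 + 1) with (- a) in * by ring.
    assert (A' := RtoC_neq_0 _ A); assert (B' := RtoC_neq_0 _ B).
    rewrite !RtoC_div by auto. field; repeat split; auto.
Qed.

Lemma integrand_reduced j l m n a b x : (1 <= l)%nat -> params_defined j l a b -> nonvanishing j l a b ->
  0 < x < 2 * PI ->
  integrand j l a b (Z.of_nat m) (Z.of_nat n) x =
  (RtoC (rev_const a b n) * reduced (gauge_num j l a b) (seed_eigen j l a b) m n a b x)%C.
Proof.
  intros Hl H Hh Hx; specialize (Hh x).
  assert (Hz := cis_neq_0 x); assert (H1 := one_minus_cis_neq_0 x Hx).
  unfold integrand; rewrite cis_opp, XQ_form, XP_form by auto.
  unfold reduced, cweight; cbv zeta. fold (gauge_logd j l a b (cis x)).
  assert (E := weight_xprefactor j l a b (cis x) H Hz H1 Hh).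
  set (z := cis x) in *. set (E1 := (thHR 1 m a b z - gauge_logd j l a b z * thHR 0 m a b z)%C).
  set (E2 := (thHR 1 n a b z - RtoC (INR n - seed_eigen j l a b) * thHR 0 n a b z - gauge_logd j l a b z * thHR 0 n a b z)%C).
  assert (HZl := Cpow_nz z l Hz); assert (HZ := Cpow_nz z n Hz).
  transitivity ((weight0 a b z * (1 - z)) * (RtoC (rev_const a b n) / Cpow z n) * (E1 * E2))%C; [ | field; auto].
  rewrite <- E. field; auto.
Qed.

(** * Differentiability along the arc, for the continuity of the integrands *)

Lemma cdiff_const c x : cdiff (fun _ => c) x.
Proof. eexists; apply cder_const. Qed.

Lemma cdiff_cis x : cdiff cis x.
Proof. eexists; apply cder_cis. Qed.

Lemma cdiff_cweight a b x : 0 < x < 2 * PI -> cdiff (cweight a b) x.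
Proof. intros; eexists; apply cder_cweight; auto. Qed.

Lemma cdiff_plus (f g : R -> C) x : cdiff f x -> cdiff g x -> cdiff (fun t => f t + g t)%C x.
Proof. intros [l F] [k G]; eexists; apply cder_plus; eauto. Qed.

Lemma cdiff_minus (f g : R -> C) x : cdiff f x -> cdiff g x -> cdiff (fun t => f t - g t)%C x.
Proof. intros [l F] [k G]; eexists; apply cder_minus; eauto. Qed.

Lemma cdiff_opp (f : R -> C) x : cdiff f x -> cdiff (fun t => - f t)%C x.
Proof. intros [l F]; eexists; apply cder_opp; eauto. Qed.

Lemma cdiff_mult (f g : R -> C) x : cdiff f x -> cdiff g x -> cdiff (fun t => f t * g t)%C x.
Proof. intros [l F] [k G]; eexists; apply cder_mult; eauto. Qed.

Lemma cdiff_inv (f : R -> C) x : f x <> RtoC 0 -> cdiff f x -> cdiff (fun t => / f t)%C x.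
Proof. intros N [l F]; eexists; apply cder_inv; eauto. Qed.

Lemma cdiff_div (f g : R -> C) x : g x <> RtoC 0 -> cdiff f x -> cdiff g x -> cdiff (fun t => f t / g t)%C x.
Proof. intros N F G; apply cdiff_mult; auto; apply cdiff_inv; auto. Qed.

Lemma cdiff_pow (f : R -> C) x n : cdiff f x -> cdiff (fun t => Cpow (f t) n) x.
Proof. intros [l F]; eexists; apply cder_pow; eauto. Qed.

Lemma cdiff_zder p q x : zder p q -> cdiff (fun t => p (cis t)) x.
Proof. intros D; eexists; apply D. Qed.

Lemma cdiff_thHR i n a b x : cdiff (fun t => thHR i n a b (cis t)) x.
Proof. eapply cdiff_zder, zder_thHR. Qed.

Lemma cdiff_cis_lin d c x : cdiff (fun t => cis (d * (t - c))) x.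
Proof.
  exists (RtoC d * cis (d * (x - c)))%C; split; unfold cis; simpl; auto_derive; auto; unfold Rminus; ring.
Qed.

Ltac cdiff_tac := repeat match goal with
  | |- cdiff (fun _ => ?c) _ => apply (cdiff_const c)
  | |- cdiff (fun t => Cplus (@?f t) (@?g t)) _ => apply (cdiff_plus f g)
  | |- cdiff (fun t => Cminus (@?f t) (@?g t)) _ => apply (cdiff_minus f g)
  | |- cdiff (fun t => Cmult (@?f t) (@?g t)) _ => apply (cdiff_mult f g)
  | |- cdiff (fun t => Cdiv (@?f t) (@?g t)) _ => apply (cdiff_div f g)
  | |- cdiff (fun t => Copp (@?f t)) _ => apply (cdiff_opp f)
  | |- cdiff (fun t => Cinv (@?f t)) _ => apply (cdiff_inv f)
  | |- cdiff (fun t => Cpow (@?f t) ?n) _ => apply (cdiff_pow f)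
  | |- cdiff (fun t => thHR ?i ?n ?a ?b (cis t)) _ => apply cdiff_thHR
  | |- cdiff (fun t => cis (?d * (t - ?c))) _ => apply cdiff_cis_lin
  | |- cdiff (fun t => cis t) _ => apply cdiff_cis
  | |- cdiff cis _ => apply cdiff_cis
  end.

Lemma cdiff_ext_loc f g x : 0 < x < 2 * PI -> (forall t, 0 < t < 2 * PI -> f t = g t) -> cdiff f x -> cdiff g x.
Proof. intros Hx E [l D]; exists l; apply (cder_ext_loc f); auto. Qed.

Lemma cdiff_reduced G G1 lam m n a b x : zder G G1 -> 0 < x < 2 * PI -> cdiff (reduced G lam m n a b) x.
Proof.
  intros D Hx. assert (DG := cdiff_zder G G1 x D). assert (DW := cdiff_cweight a b x Hx).
  assert (H1 := one_minus_cis_neq_0 x Hx).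
  assert (HZ := Cpow_nz (cis x) n (cis_neq_0 x)).
  unfold reduced; cbv zeta. cdiff_tac; auto.
Qed.

Lemma cdiff_continuous f x : cdiff f x -> continuous (fun t => Re (f t)) x /\ continuous (fun t => Im (f t)) x.
Proof. intros [l D]; apply (cder_cont f x l D). Qed.

(** The seed equation at its singular point z = 1, where the second-order term drops out. *)
Lemma seed_logd_one j l a b : j = X1 \/ j = X3 -> nonvanishing j l a b ->
  (RtoC (a + b + 1) * seed_logd j l a b (RtoC 1))%C = RtoC (seed_eigen j l a b * (a + 1)).
Proof.
  intros Hj H; specialize (H 0); rewrite cis_0 in H. unfold seed_logd.
  assert (O := thHR_ode l (seed_a j a b) (seed_b j a b) (RtoC 1)). unfold seed in *.
  set (h0 := thHR 0 l _ _ (RtoC 1)) in *. set (h1 := thHR 1 l _ _ (RtoC 1)) in *. set (h2 := thHR 2 l _ _ (RtoC 1)) in *.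
  clearbody h0 h1 h2.
  assert (O' : (RtoC (a + b + 1) * h1)%C = (INR l * (seed_a j a b + 1) * h0)%C).
  { transitivity ((seed_b j a b + INR l + (seed_a j a b + 1 - INR l) * 1) * h1)%C.
    - destruct Hj as [-> | ->]; simpl; rewrite ?RtoC_plus, ?RtoC_minus; ring.
    - transitivity ((1 - 1) * h2 + INR l * (seed_a j a b + 1) * 1 * h0)%C; [rewrite O; ring | ring]. }
  transitivity ((RtoC (a + b + 1) * h1) / h0 + RtoC (a + b + 1) * RtoC (seed_shift j l a b))%C; [field; auto | ].
  rewrite O'. destruct Hj as [-> | ->]; simpl; repeat rewrite ?RtoC_opp, ?RtoC_mult, ?RtoC_plus, ?RtoC_minus; field; auto.
Qed.

Lemma gauge_num_no_pole j l a b z : seed_pole j a b = 0 -> gauge_num j l a b z = ((1 - z) * seed_logd j l a b z)%C.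
Proof. intros E; unfold gauge_num; rewrite E; ring. Qed.

(** * Lower bounds on a + b from convergence *)

Lemma params_facts a b : params a b -> a + 1 <> 0 /\ b <> 0 /\ a + b + 1 <> 0.
Proof. intros H; destruct (H 1%nat) as (A & B & D); simpl in *; repeat split; lra. Qed.

Lemma seed_eigen_neq_0 j l a b : (1 <= l)%nat -> params a b -> j = X1 \/ j = X3 -> seed_eigen j l a b <> 0.
Proof.
  intros Hl H [-> | ->]; simpl; assert (L := INR_ge_1 l Hl); [lra | ].
  assert (Q := poch_factor_neq_0 (a + b + 1) (S l) l (proj2 (proj2 (H (S l)))) ltac:(lia)). lra.
Qed.

Lemma rev_const_0 a b : rev_const a b 0 = 1.
Proof. unfold rev_const; simpl; field. Qed.

Lemma thHR_1_O a b z : thHR 1 0 a b z = RtoC 0.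
Proof. unfold thHR; simpl. rewrite !Rmult_0_l; ring. Qed.

Lemma Cmult_eq_0_r (z w : C) : (z * w)%C = RtoC 0 -> z <> RtoC 0 -> w = RtoC 0.
Proof. intros H N; apply (Cmult_eq_0_reg_l z); auto. Qed.

(* The assumed convergence at [z = 1] bounds [a + b] from below. *)
Lemma integrable_range_X1_X3 j l a b : (1 <= l)%nat -> params_defined j l a b -> nonvanishing j l a b -> j = X1 \/ j = X3 ->
  ex_integral (integrand j l a b 0 0) -> -2 < a + b.
Proof.
  intros Hl H Hh Hj He; destruct (Rlt_or_le (-2) (a + b)) as [ | Hs]; auto; exfalso; revert He.
  assert (Hp := params_defined_params _ _ _ _ H). destruct (params_facts a b Hp) as (A & B & S1).
  assert (E0 := seed_eigen_neq_0 j l a b Hl Hp Hj). assert (LO := seed_logd_one j l a b Hj Hh).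
  assert (Hpole : seed_pole j a b = 0) by (destruct Hj as [-> | ->]; auto).
  assert (DL := fun x => cdiff_zder _ _ x (zder_seed_logd j l a b Hh)).
  set (lam := seed_eigen j l a b) in *.
  (* Since P_0 = 1, the integrand for m = n = 0 is [chord ^ (a + b + 1)] times this [Q], which is
     smooth at z = 1. *)
  set (Q := fun x => (cis ((a + 1 - b) / 2 * (x - PI)) * (- seed_logd j l a b (cis x) * (RtoC lam - seed_logd j l a b (cis x))))%C).
  assert (CQ : cdiff Q 0) by (unfold Q; cdiff_tac; auto).
  destruct (cdiff_continuous Q 0 CQ) as [CQ1 CQ2].
  apply (not_ex_integral (integrand j l a b 0 0) Q (a + 1 + b)); [lra | | exact CQ1 | exact CQ2 | ].
  - intros x Hx. change (integrand j l a b 0 0 x) with (integrand j l a b (Z.of_nat 0) (Z.of_nat 0) x).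
    rewrite integrand_reduced by auto. rewrite rev_const_0.
    unfold reduced; cbv zeta. rewrite thHR_O, thHR_1_O, gauge_num_no_pole by auto.
    unfold Q. rewrite (Cmult_assoc (RtoC (Rpower _ _))), <- cweight_polar, cweight_succ by auto. fold lam. simpl INR; simpl Cpow.
    rewrite RtoC_minus. field. apply one_minus_cis_neq_0; auto.
  (* By [seed_logd_one], the two factors of [Q 0] beside the phase are, after multiplication by
     a+b+1 and up to sign, lam(a+1) and lam b. *)
  - unfold Q; rewrite cis_0. intros E. 
    apply Cmult_eq_0_r in E; [ | apply cis_neq_0].
    set (h := seed_logd j l a b (RtoC 1)) in *.
    assert (Hh0 : h <> RtoC 0).
    { intros E1; rewrite E1, Cmult_0_r in LO. symmetry in LO; revert LO; apply RtoC_neq_0.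
      apply Rmult_integral_contrapositive; auto. }
    apply Cmult_eq_0_r in E.
    + assert (E2 : RtoC (lam * b) = RtoC 0).
      { transitivity (RtoC (a + b + 1) * RtoC lam - RtoC (lam * (a + 1)))%C.
        - rewrite <- RtoC_mult, <- RtoC_minus; f_equal; ring.
        - rewrite <- LO. transitivity (RtoC (a + b + 1) * (RtoC lam - h))%C; [ring | rewrite E; ring]. }
      revert E2; apply RtoC_neq_0, Rmult_integral_contrapositive; auto.
    + intros E1; apply Hh0. transitivity (- - h)%C; [ring | rewrite E1; ring].
Qed.

Lemma cweight_pred a b x : 0 < x < 2 * PI -> cweight a b x = ((1 - cis x) * cweight (a - 1) b x)%C.
Proof. intros Hx; rewrite <- cweight_succ by auto; f_equal; ring. Qed.

(** The pole of the seed lowers the exponent at z = 1 to a + b - 1, with a coefficient proportional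
    to (a + b)^2. It vanishes for a + b = 0, hence the non-strict bound. *)
Lemma integrable_range_X2 l a b : (1 <= l)%nat -> params_defined X2 l a b -> nonvanishing X2 l a b ->
  ex_integral (integrand X2 l a b 0 0) -> 0 <= a + b.
Proof.
  intros Hl H Hh He; destruct (Rle_or_lt 0 (a + b)) as [ | Hs]; auto; exfalso; revert He.
  assert (DG := fun x => cdiff_zder _ _ x (zder_gauge_num X2 l a b Hh)).
  set (lam := seed_eigen X2 l a b) in *.
  set (Q := fun x => (cis ((a - 1 - b) / 2 * (x - PI)) *
      (- gauge_num X2 l a b (cis x) * (RtoC lam * (1 - cis x) - gauge_num X2 l a b (cis x))))%C).
  assert (CQ : cdiff Q 0) by (unfold Q; cdiff_tac; auto).
  destruct (cdiff_continuous Q 0 CQ) as [CQ1 CQ2].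
  apply (not_ex_integral (integrand X2 l a b 0 0) Q (a - 1 + b)); [lra | | exact CQ1 | exact CQ2 | ].
  - intros x Hx. change (integrand X2 l a b 0 0 x) with (integrand X2 l a b (Z.of_nat 0) (Z.of_nat 0) x).
    rewrite integrand_reduced by auto. rewrite rev_const_0.
    unfold reduced; cbv zeta. rewrite thHR_O, thHR_1_O.
    unfold Q. rewrite (Cmult_assoc (RtoC (Rpower _ _))), <- cweight_polar, (cweight_pred a b) by auto. fold lam. simpl INR; simpl Cpow.
    rewrite RtoC_minus. field. apply one_minus_cis_neq_0; auto.
  - unfold Q; rewrite cis_0. assert (E1 : gauge_num X2 l a b (RtoC 1) = RtoC (a + b)).
    { unfold gauge_num; simpl; ring. }
    rewrite E1. intros E. apply Cmult_eq_0_r in E; [ | apply cis_neq_0].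
    assert (E2 : RtoC ((a + b) * (a + b)) = RtoC 0) by (rewrite RtoC_mult, <- E; ring).
    revert E2; apply RtoC_neq_0; nra.
Qed.

Lemma XP4_special l a b z : XP X4 l (- Z.of_nat l - 1) a b z = RtoC 1.
Proof. simpl; destruct (Z.eq_dec _ _); auto; lia. Qed.

Lemma XQ4_special l a b z : XQ X4 l (- Z.of_nat l - 1) a b z = RtoC 1.
Proof. apply XP4_special. Qed.

(** At the additional index both polynomials are 1 and the bare weight is integrated. It behaves
    like [chord ^ (a + b - 1)] with a nonzero coefficient, which excludes a + b = 0 as well. *)
Lemma integrable_range_X4 l a b : params_defined X4 l a b -> nonvanishing X4 l a b ->
  ex_integral (integrand X4 l a b (- Z.of_nat l - 1) (- Z.of_nat l - 1)) -> 0 < a + b.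
Proof.
  intros H Hh He; destruct (Rlt_or_le 0 (a + b)) as [ | Hs]; auto; exfalso; revert He.
  assert (HK : poch (- b + 1) l / poch (- a) l <> 0).
  { destruct H as (_ & A & B). apply Rmult_integral_contrapositive; split; auto; apply Rinv_neq_0_compat; auto. }
  assert (Hd := denom_seed X4 l a b).
  set (K := poch (- b + 1) l / poch (- a) l) in *.
  assert (D0 : forall x, cdiff (fun t => seed 0 X4 l a b (cis t)) x) by (intros; apply cdiff_thHR).
  set (Q := fun x => (cis ((a - 1 - b) / 2 * (x - PI)) *
      (RtoC K * Cpow (cis x) (1 + l) / Cpow (seed 0 X4 l a b (cis x)) 2))%C).
  assert (N2 : forall x, Cpow (seed 0 X4 l a b (cis x)) 2 <> RtoC 0) by (intros; apply Cpow_nz; apply Hh).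
  assert (CQ : cdiff Q 0) by (unfold Q; cdiff_tac; auto).
  destruct (cdiff_continuous Q 0 CQ) as [CQ1 CQ2].
  apply (not_ex_integral (integrand X4 l a b (- Z.of_nat l - 1) (- Z.of_nat l - 1)) Q (a - 1 + b)); [lra | | exact CQ1 | exact CQ2 | ].
  - intros x Hx. unfold integrand, weight. rewrite XP4_special, XQ4_special, Hd by auto.
    unfold Q. rewrite (Cmult_assoc (RtoC (Rpower _ _))), <- cweight_polar by auto. fold K. fold (cweight a b x). rewrite (cweight_pred a b) by auto.
    assert (N := N2 x). set (h := Cpow (seed 0 X4 l a b (cis x)) 2) in *. field. split; auto. apply one_minus_cis_neq_0; auto.
  - unfold Q. intros E. apply Cmult_eq_0_r in E; [ | apply cis_neq_0].
    assert (N := N2 0). set (h := Cpow (seed 0 X4 l a b (cis 0)) 2) in *.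
    assert (E2 : (RtoC K * Cpow (cis 0) (1 + l))%C = RtoC 0).
    { transitivity (h * (RtoC K * Cpow (cis 0) (1 + l) / h))%C; [field; auto | rewrite E; ring]. }
    apply Cmult_eq_0_r in E2; [ | apply RtoC_neq_0; auto].
    revert E2; apply Cpow_nz, cis_neq_0.
Qed.

(** * Evaluation of the integrals *)

Lemma integral_regular j l m n a b v : (1 <= l)%nat -> params_defined j l a b -> nonvanishing j l a b ->
  match j with X1 | X3 => -2 < a + b | X2 => 0 <= a + b | X4 => 0 < a + b end ->
  is_lim_seq (prod1 (beta_factor (a + 1) b)) (Finite v) -> has_int_C (cweight (a + 1) b) (RtoC (2 * PI * v)) ->
  integral (integrand j l a b (Z.of_nat m) (Z.of_nat n)) =
  RtoC (2 * PI * (- (INR m - seed_eigen j l a b) * (rev_const a b n * base_const m n a b * v))).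
Proof.
  intros Hl H Hh Hs L M.
  assert (Hp := params_defined_params _ _ _ _ H). destruct (params_facts a b Hp) as (A & B & S1).
  destruct (base_relation m n a b Hp) as (p & q & Dp & Ep).
  assert (DG := zder_gauge_num j l a b Hh). assert (RG := riccati_gauge_num j l a b Hh). assert (DL := zder_seed_logd j l a b Hh).
  assert (V : vanishes_at_ends (fun x => cweight a b x *
      (bterm (gauge_num j l a b) m n a b (cis x) - RtoC (INR m - seed_eigen j l a b) * ((1 - cis x) * p (cis x))))%C).
  { destruct j.
    - apply (vanish_zero (gauge_num X1 l a b) (seed_logd X1 l a b) (seed_logd' X1 l a b) p q); auto.
      + intros x; apply gauge_num_no_pole; auto.
      + apply seed_logd_one; auto.
    (* At a + b = 0 the weight no longer forces the boundary term to 0, but the seed of type 2 loses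
       its pole and a factor 1 - z appears. *)
    - destruct (Rle_lt_or_eq_dec _ _ Hs) as [Hs' | Hs'].
      + apply (vanish_bounded _ _ _ _ _ _ _ _ _ Hs' DG Dp).
      + apply (vanish_factor (gauge_num X2 l a b) (seed_logd X2 l a b) (seed_logd' X2 l a b) p q); auto; [lra | ].
        intros x; apply gauge_num_no_pole; simpl; auto.
    - apply (vanish_zero (gauge_num X3 l a b) (seed_logd X3 l a b) (seed_logd' X3 l a b) p q); auto.
      + intros x; apply gauge_num_no_pole; auto.
      + apply seed_logd_one; auto.
    - apply (vanish_bounded _ _ _ _ _ _ _ _ _ Hs DG Dp). }
  assert (I := reduced_has_int _ _ _ m n a b p q _ DG RG Dp Ep V M).
  apply has_int_C_integral.
  - eapply has_int_C_ext; [ | replace (RtoC (2 * PI * (- (INR m - seed_eigen j l a b) * (rev_const a b n * base_const m n a b * v))))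
       with (RtoC (rev_const a b n) * (RtoC (- (INR m - seed_eigen j l a b) * base_const m n a b) * RtoC (2 * PI * v)))%C;
       [apply has_int_C_scal, I | rewrite <- !RtoC_mult; f_equal; ring]].
    intros x Hx; symmetry; apply integrand_reduced; auto.
  - intros x Hx. apply (cdiff_ext_loc (fun x => RtoC (rev_const a b n) * reduced (gauge_num j l a b) (seed_eigen j l a b) m n a b x)%C); auto.
    + intros t Ht; symmetry; apply integrand_reduced; auto.
    + apply cdiff_mult; [apply cdiff_const | apply (cdiff_reduced _ _ _ _ _ _ _ _ DG Hx)].
Qed.

Lemma integral_exact (f : R -> C) (c : C) a b p p' : 0 < a + b -> zder p p' ->
  (forall x, 0 < x < 2 * PI ->
     f x = (c * (cweight a b x * ((- RtoC b - RtoC (a + b) * cis x / (1 - cis x)) * p (cis x) + p' (cis x))))%C) ->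
  (forall x, 0 < x < 2 * PI -> cdiff (fun t => p' (cis t)) x) ->
  integral f = RtoC 0.
Proof.
  intros Hs D E Dp'. apply has_int_C_integral.
  - eapply has_int_C_ext; [intros x Hx; symmetry; apply E; auto | ].
    replace (RtoC 0) with (c * 0)%C by ring. apply has_int_C_scal.
    apply (has_int_C_exact _ _ (fun x Hx => cder_cweight_mult a b p p' x Hx D)).
    apply (cweight_vanishes_bounded a b _ _ _ Hs (D 0) (D (2 * PI))).
  - intros x Hx; eapply cdiff_ext_loc; [exact Hx | intros t Ht; symmetry; apply E; auto | ].
    assert (DW := cdiff_cweight a b x Hx). assert (H1 := one_minus_cis_neq_0 x Hx).
    assert (P1 := Dp' x Hx). assert (P0 := cdiff_zder _ _ x D).
    cdiff_tac; auto.
Qed.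

Lemma zder_pow_succ n : zder (fun z => Cpow z (S n)) (fun z => RtoC (INR n + 1) * Cpow z (S n))%C.
Proof.
  intros x; eapply cder_eq; [apply cder_pow, cder_cis | ].
  replace (S n - 1)%nat with n by lia. rewrite S_INR; simpl; ring.
Qed.

Lemma zder_seed_recip j l a b : nonvanishing j l a b ->
  zder (fun z => / seed 0 j l a b z)%C (fun z => - seed 1 j l a b z / (seed 0 j l a b z * seed 0 j l a b z))%C.
Proof.
  intros H x; apply (cder_inv (fun t => seed 0 j l a b (cis t))); [apply H | apply zder_thHR].
Qed.

(* For [n = -l-1 = lam] one of the two Wronskians is a constant, and the
   integrand is the derivative of a quotient [P_n / phi]. *)
Lemma integral_X4_special_left l n a b : (1 <= l)%nat -> params_defined X4 l a b -> nonvanishing X4 l a b ->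
  0 < a + b ->
  integral (integrand X4 l a b (- Z.of_nat l - 1) (Z.of_nat n)) = RtoC 0.
Proof.
  intros Hl H Hh Hs.
  (* With P_l the seed polynomial, w z^(-n) P_n / P_l is, up to a constant, the quotient v_n =
     z^(lam-n) P_n / phi: the weight is absorbed by the seed. *)
  assert (D := zder_mult _ _ _ _ (zder_mult _ _ _ _ (zder_thHR 0 n a b) (zder_inv_pow n)) (zder_seed_recip X4 l a b Hh)).
  apply (integral_exact _ (- (RtoC (poch (- b + 1) l / poch (- a) l) * RtoC (rev_const a b n)))%C a b _ _ Hs D).
  - intros x Hx; cbv beta.
    assert (Hz := cis_neq_0 x); assert (H1 := one_minus_cis_neq_0 x Hx). specialize (Hh x).
    unfold integrand; rewrite cis_opp, XQ_form, XP4_special by auto.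
    assert (E := weight_xprefactor X4 l a b (cis x) H Hz H1 Hh).
    unfold cweight, gauge_logd, gauge_num, seed_logd.
    set (z := cis x) in *; clearbody z. set (w := weight X4 l a b z) in *. set (w0 := weight0 a b z) in *.
    set (r := xprefactor X4 l (b - 1) (a + 1) (/ z)) in *. unfold xprefactor in E.
    assert (HZl := Cpow_nz z l Hz); assert (HZ := Cpow_nz z n Hz).
    set (Zl := Cpow z l) in *; set (Zn := Cpow z n) in *.
    set (k := RtoC (rev_const (seed_a X4 a b) (seed_b X4 a b) l)) in *.
    unfold seed in *.
    set (h0 := thHR 0 l _ _ z) in *. set (h1 := thHR 1 l _ _ z) in *.
    set (q0 := thHR 0 n a b z). set (q1 := thHR 1 n a b z).
    destruct H as (_ & A & B). assert (A' := RtoC_neq_0 _ A); assert (B' := RtoC_neq_0 _ B).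
    assert (H2 : (z - 1)%C <> RtoC 0) by (intros E2; apply H1; transitivity (- (z - 1))%C; [ring | rewrite E2; ring]).
    rewrite RtoC_div in E by auto. rewrite RtoC_div by auto.
    set (cc := RtoC (rev_const a b n)).
    set (pa := RtoC (poch (- a) l)) in *. set (pb := RtoC (poch (- b + 1) l)) in *.
    assert (E' : (w * - r * k / Zl * (h0 * h0))%C = (- w0 * (pb / pa))%C).
    { transitivity (w * (pa / pb * (z - 1)) * - r * k / Zl * (h0 * h0) * (pb / pa) / (z - 1))%C.
      - field; repeat split; auto.
      - rewrite E; field; repeat split; auto. }
    transitivity ((w * - r * k / Zl * (h0 * h0)) * (cc / Zn / h0 * (q1 - RtoC (INR n - seed_eigen X4 l a b) * q0
         - ((1 - z) * (h1 * / h0 + RtoC (seed_shift X4 l a b)) + RtoC (seed_pole X4 a b) * z) / (1 - z) * q0)))%C.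
    + field; repeat split; auto.
    + rewrite E'. simpl. repeat rewrite ?RtoC_plus, ?RtoC_minus, ?RtoC_opp. field; repeat split; auto.
  - intros x Hx; cbv beta. specialize (Hh x).
    assert (HZ := Cpow_nz (cis x) n (cis_neq_0 x)). unfold seed in *. cdiff_tac; auto.
    intros E; apply Cmult_eq_0_r in E; auto.
Qed.

Lemma integral_X4_special_right l m a b : (1 <= l)%nat -> params_defined X4 l a b -> nonvanishing X4 l a b ->
  0 < a + b ->
  integral (integrand X4 l a b (Z.of_nat m) (- Z.of_nat l - 1)) = RtoC 0.
Proof.
  intros Hl H Hh Hs.
  (* Here w z^(l+1) P_m / P_l is, up to a constant, the quotient u_m = P_m / phi. *)
  assert (D := zder_mult _ _ _ _ (zder_mult _ _ _ _ (zder_thHR 0 m a b) (zder_pow_succ l)) (zder_seed_recip X4 l a b Hh)).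
  apply (integral_exact _ (- (1))%C a b _ _ Hs D).
  - intros x Hx; cbv beta.
    assert (Hz := cis_neq_0 x); assert (H1 := one_minus_cis_neq_0 x Hx). specialize (Hh x).
    unfold integrand; rewrite cis_opp, XP_form, XQ4_special by auto.
    unfold weight, xprefactor; rewrite denom_seed by auto. unfold cweight, gauge_logd, gauge_num, seed_logd.
    change (1 + l)%nat with (S l).
    set (z := cis x) in *; clearbody z. set (w0 := weight0 a b z) in *.
    assert (HZl := Cpow_nz z (S l) Hz). set (Zl := Cpow z (S l)) in *.
    unfold seed in *.
    set (h0 := thHR 0 l _ _ z) in *. set (h1 := thHR 1 l _ _ z) in *.
    set (p0 := thHR 0 m a b z). set (p1 := thHR 1 m a b z).
    destruct H as (_ & A & B). assert (A' := RtoC_neq_0 _ A); assert (B' := RtoC_neq_0 _ B).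
    change (Cpow h0 2) with (h0 * (h0 * 1))%C.
    rewrite !RtoC_div by auto. simpl. repeat rewrite ?RtoC_plus, ?RtoC_minus, ?RtoC_opp. field; repeat split; auto.
  - intros x Hx; cbv beta. specialize (Hh x). unfold seed in *. cdiff_tac; auto.
    intros E; apply Cmult_eq_0_r in E; auto.
Qed.

Lemma index_cases j l n : index j l n ->
  (exists k, n = Z.of_nat k) \/ (j = X4 /\ n = (- Z.of_nat l - 1)%Z).
Proof.
  intros H; assert (K : (0 <= n)%Z \/ (j = X4 /\ n = (- Z.of_nat l - 1)%Z)) by (destruct j; simpl in H; tauto).
  destruct K as [K | K]; auto. left; exists (Z.to_nat n); rewrite Z2Nat.id; auto.
Qed.

(** The type enters the constant only through n - lam, the factor left by the integration by
    parts. *)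
Lemma hX_eigen j l n a b : hX j l n a b = - (INR n - seed_eigen j l a b) * ((INR n + b) * hbase n a b).
Proof. destruct j; simpl; ring. Qed.

Theorem theorem4p5 :
  forall (al be : R) (l0 : nat) (j0 : xtype),
    (1 <= l0)%nat ->
    params_defined j0 l0 al be ->
    (forall z : C, Cmod z = 1%R -> denom j0 l0 al be z <> RtoC 0) ->
    (forall m n : Z, index j0 l0 m -> index j0 l0 n ->
       ex_integral (integrand j0 l0 al be m n)) ->
    exists h : Z -> C,
      (forall n : nat, index j0 l0 (Z.of_nat n) ->
         h (Z.of_nat n) = RtoC (hX j0 l0 n al be)) /\
      (forall m n : Z, index j0 l0 m -> index j0 l0 n ->
         (RtoC (/ (2 * PI)) * integral (integrand j0 l0 al be m n))%C
         = if Z.eq_dec m n then h n else RtoC 0).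
Proof.
  intros a b l j Hl H Hd Hex.
  assert (Hh : nonvanishing j l a b).
  { intros x; rewrite <- denom_seed by auto; apply Hd, Cmod_cis. }
  assert (Hp := params_defined_params _ _ _ _ H).
  (* One index per type suffices: 0 for types 1 to 3 (admissible for type 1 because [1 <= l]), and
     -l-1 for type 4. *)
  assert (Hs : match j with X1 | X3 => -2 < a + b | X2 => 0 <= a + b | X4 => 0 < a + b end).
  { destruct j.
    - apply (integrable_range_X1_X3 X1 l); auto; apply Hex; simpl; lia.
    - apply (integrable_range_X2 l); auto; apply Hex; simpl; lia.
    - apply (integrable_range_X1_X3 X3 l); auto; apply Hex; simpl; lia.
    - apply (integrable_range_X4 l); auto; apply Hex; simpl; lia. }
  assert (Hs2 : -2 < a + b) by (destruct j; lra).
  destruct (cweight_moment (a + 1) b ltac:(lra)) as (v & L & M).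
  assert (HP := two_pi_pos).
  assert (Reg : forall m n : nat,
    (RtoC (/ (2 * PI)) * integral (integrand j l a b (Z.of_nat m) (Z.of_nat n)))%C =
    if Nat.eq_dec m n then RtoC (hX j l n a b) else RtoC 0).
  { intros m n; rewrite (integral_regular j l m n a b v) by auto.
    rewrite <- RtoC_mult. unfold base_const. destruct (Nat.eq_dec m n) as [-> | N].
    - f_equal. rewrite hX_eigen, <- (constant_value n a b v) by auto.
      field; lra.
    - f_equal; ring. }
  (* At the negative index of type 4 the constant is taken to be the normalised integral itself. *)
  exists (fun n => if Z_le_dec 0 n then RtoC (hX j l (Z.to_nat n) a b)
    else (RtoC (/ (2 * PI)) * integral (integrand j l a b n n))%C).
  split.
  - intros n Hn; destruct (Z_le_dec 0 (Z.of_nat n)); [ | lia]. rewrite Nat2Z.id; auto.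
  - intros m n Hm Hn.
    destruct (index_cases j l m Hm) as [[m' ->] | [Ej ->]]; destruct (index_cases j l n Hn) as [[n' ->] | [Ej' ->]].
    + rewrite Reg. destruct (Nat.eq_dec m' n') as [-> | N]; destruct (Z.eq_dec _ _) as [E | E]; try lia; auto.
      destruct (Z_le_dec 0 (Z.of_nat n')); [ | lia]. rewrite Nat2Z.id; auto.
    + subst j. destruct (Z.eq_dec _ _); [lia | ]. rewrite integral_X4_special_right by auto; ring.
    + subst j. destruct (Z.eq_dec _ _); [lia | ]. rewrite integral_X4_special_left by auto; ring.
    + destruct (Z.eq_dec _ _); [ | lia]. destruct (Z_le_dec _ _); [lia | auto].
Qed.
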